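(* Let $\mu\in\mathbb{R}$ and let $s<3/4$. Consider the initial value problem for the 5th-order Gardner equation for a real-valued function $v=v(t,x)$, $x\in\mathbb{R}$, $$v_t+10\mu^2v_{xxx}+v_{5x}+\left[\mathcal{K}_\mu(v)\right]_x=0,\qquad v(0,x)=v_0(x),$$ where $$\mathcal{K}_\mu(v)=10(\mu+v)v_x^2+20\mu\, v v_{xx}+10v^2v_{xx}+60\mu^3v^2+60\mu^2v^3+30\mu v^4+6v^5 .$$ Then, for $t>0$, the data-solution mapping $v_0\mapsto v(t)=v(t,\cdot)$ is not uniformly continuous in $H^s(\mathbb{R})$, in the sense specified in the context.
   Context: Here $v_{5x}=\partial_x^5v$, and $H^s(\mathbb{R})$ is the usual $L^2$-based Sobolev space with norm $\|f\|_{H^s}=\|(1+|\xi|^2)^{s/2}\hat f(\xi)\|_{L^2}$. The data-solution mapping at time $t$ sends an initial datum $v_0$ to $v(t)$, where $v$ is a solution of the initial value problem with datum $v_0$. Uniform continuity of this mapping at time $t$ in $H^s(\mathbb{R})$ means: for every $\epsilon>0$ and $M>0$ there exists $\delta=\delta(\epsilon,M)>0$ such that, whenever $v_1,v_2$ are solutions with initial data $v_{01},v_{02}$ satisfying $\|v_{0i}\|_{H^s}\le M$ ($i=1,2$) and $\|v_{01}-v_{02}\|_{H^s}<\delta$, one has $\|v_1(t)-v_2(t)\|_{H^s}<\epsilon$. Thus failure of uniform continuity at time $t$ means that there are $M>0$ and $\epsilon>0$ such that for every $\delta>0$ there exist two solutions $v_1,v_2$ with $\|v_i(0)\|_{H^s}\le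 M$ ($i=1,2$), $\|v_1(0)-v_2(0)\|_{H^s}<\delta$ and $\|v_1(t)-v_2(t)\|_{H^s}\ge\epsilon$. Solutions are understood as real-valued smooth (classical) solutions whose values at each time belong to $H^s(\mathbb{R})$. *)

(* Defs.v *)
From HB Require Import structures.
From mathcomp Require Import all_boot all_order all_algebra.
From mathcomp Require Import all_classical all_reals all_analysis.

Set Implicit Arguments.
Unset Strict Implicit.
Unset Printing Implicit Defensive.

Import Order.TTheory GRing.Theory Num.Theory.
Import numFieldNormedType.Exports.

Local Open Scope classical_set_scope.
Local Open Scope ring_scope.

Section Fourier.
Context {R : realType}.
Implicit Types (f psi Fre Fim : R -> R) (s x xi : R).

Definition schwartz psi : Prop :=
  (forall n x, derivable (derive1n n psi) x 1) /\
  (forall k n : nat, exists C : R, forall x, `|x ^+ k * derive1n n psi x| <= C).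

(* The Fourier transform of a real Schwartz function psi, with the convention
   \int e^{-i x xi} psi(xi) dxi, is  fourier_cos psi x - i * fourier_sin psi x. *)
Definition fourier_cos psi x : R :=
  \int[lebesgue_measure]_xi (cos (x * xi) * psi xi).
Definition fourier_sin psi x : R :=
  \int[lebesgue_measure]_xi (sin (x * xi) * psi xi).

(* Fre + i Fim is the Fourier transform of the distribution f in the sense of
   duality,  <f^, psi> = <f, psi^>.  By linearity real test functions suffice.
   Elements of H^s with s < 0 that happen to be functions need not be
   absolutely integrable against every Schwartz function, so the identity is
   required whenever f * psi^ is integrable.  As f is locally integrable, this
   includes all psi with psi^ in C_c^oo, which are dense in the Schwartz space;
   hence f determines its transform almost everywhere. *)
Definition is_fourier_transform f Fre Fim : Prop :=
  [/\ locally_integrable [set: R] f,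
      measurable_fun [set: R] Fre,
      measurable_fun [set: R] Fim &
      forall psi, schwartz psi ->
        lebesgue_measure.-integrable [set: R]
          (EFin \o (fun x => f x * fourier_cos psi x)) ->
        lebesgue_measure.-integrable [set: R]
          (EFin \o (fun x => f x * fourier_sin psi x)) ->
        \int[lebesgue_measure]_xi (Fre xi * psi xi) =
          \int[lebesgue_measure]_x (f x * fourier_cos psi x) /\
        \int[lebesgue_measure]_xi (Fim xi * psi xi) =
          - \int[lebesgue_measure]_x (f x * fourier_sin psi x)].

(* || (1 + |xi|^2)^{s/2} F ||_{L^2}  for  F = Fre + i Fim *)
Definition weighted_L2_norm s Fre Fim : \bar R :=
  Lnorm lebesgue_measure 2%:E
    (fun xi => ((1 + xi ^+ 2) `^ (s / 2) *
                Num.sqrt (Fre xi ^+ 2 + Fim xi ^+ 2))%:E).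

(* The H^s norm of f, equal to +oo when f is not in H^s.  If the transform of f
   is a function with finite weighted norm, it is unique almost everywhere, so
   the infimum is over at most one finite value; the infimum of the empty set
   is +oo. *)
Definition Hs_norm s f : \bar R :=
  ereal_inf [set N | exists Fre Fim,
    is_fourier_transform f Fre Fim /\ N = weighted_L2_norm s Fre Fim].

Definition in_Hs s f : Prop := (Hs_norm s f < +oo)%E.

End Fourier.

Section Gardner.
Context {R : realType}.
Implicit Types (v : R -> R -> R) (f : R -> R) (mu s t x : R).

Definition partial_t v : R -> R -> R := fun t x => derive1 (v ^~ x) t.
Definition partial_x v : R -> R -> R := fun t x => derive1 (v t) x.

(* Iterated mixed partial derivative, true standing for d/dt, false for d/dx. *)
Definition partials (w : seq bool) v : R -> R -> R :=
  foldr (fun b u => if b then partial_t u else partial_x u) v w.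

Definition smooth2 v : Prop :=
  forall w : seq bool,
    continuous (fun p : R * R => partials w v p.1 p.2) /\
    forall t x, derivable (partials w v ^~ x) t 1 /\
                derivable (partials w v t) x 1.

Definition gardnerK mu f x : R :=
  let u := f x in let ux := derive1 f x in let uxx := derive1n 2 f x in
  10 * (mu + u) * ux ^+ 2 + 20 * mu * u * uxx + 10 * u ^+ 2 * uxx
  + 60 * mu ^+ 3 * u ^+ 2 + 60 * mu ^+ 2 * u ^+ 3
  + 30 * mu * u ^+ 4 + 6 * u ^+ 5.

Definition gardner5 mu v : Prop :=
  forall t x,
    partial_t v t x + 10 * mu ^+ 2 * derive1n 3 (v t) x + derive1n 5 (v t) x
    + derive1 (gardnerK mu (v t)) x = 0.

(* Real-valued classical solutions v = v(t,x), defined for all (t,x); the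
   initial datum of v is v 0. *)
Definition gardner5_solution mu s v : Prop :=
  [/\ smooth2 v, gardner5 mu v & forall t, in_Hs s (v t)].

Definition data_solution_map_unif_continuous mu s t : Prop :=
  forall eps M : R, 0 < eps -> 0 < M ->
  exists2 delta : R, 0 < delta &
  forall v1 v2,
    gardner5_solution mu s v1 -> gardner5_solution mu s v2 ->
    (Hs_norm s (v1 0)%R <= M%:E)%E -> (Hs_norm s (v2 0)%R <= M%:E)%E ->
    (Hs_norm s (v1 0 \- v2 0)%R < delta%:E)%E ->
    (Hs_norm s (v1 t \- v2 t)%R < eps%:E)%E.

End Gardner.

(* Main.v *)
(* The equation has the explicit solutions v = 2 d/dx arg(F + i G), where F + i G is a
   sum of exponentials satisfying two bilinear equations.

   For -1/2 <= s < 3/4 we use breathers, wave packets of frequency al with an envelope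
   of width 1/be and height be, where be ~ al^(-2s) keeps the H^s norm of order 1.  Let
   q = (3 - 4s)/2 > 0.  Two breathers with the same envelope and with frequencies al and
   al + al^(-q) be are at distance O(al^(-q) + al^(-1/2)) in H^s.  Their group velocities
   differ so much that at time t > 0 the envelopes are separated by about t al^q widths,
   so that the distance has become of order 1.

   For s < -1/2 we use two solitons with parameters k and k + 1.  At time 0 both are
   close in H^s to a fixed multiple of the same Dirac mass, but their velocities differ by
   more than k, so that at time t they are close to Dirac masses at distant points.

   Norms are bounded above through a one-sided Plancherel inequality, and below by
   pairing the function with the Fourier transform of a modulated Gaussian. *)
Require Import Defs.
From HB Require Import structures.
From mathcomp Require Import all_boot all_order all_algebra.
From mathcomp Require Import all_classical all_reals all_analysis measurable_realfun.
From mathcomp Require Import ring lra.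

Set Implicit Arguments.
Unset Strict Implicit.
Unset Printing Implicit Defensive.

Import Order.TTheory GRing.Theory Num.Theory.
Import numFieldNormedType.Exports.
Local Open Scope classical_set_scope.
Local Open Scope ring_scope.

(** * Derivatives and integrals *)

Section Derivatives.
Context {R : realType}.
Implicit Types (f g h F G : R -> R).

(** The two ranges of s reflect the limits of the two families. A wave packet needs an envelope
    wider than its wavelength, so [be] must stay below [al]; with [be] of order al^(-2s) this means
    s >= -1/2. A Dirac mass has finite H^s norm exactly for s < -1/2.

    The main obstacle is uniformity. Breathers are large rational functions of exponentials and
    cosines, and the bounds on them, on their derivatives and on their differences must not depend
    on [al], [be] or the time. After rescaling, all of these are fixed expressions in six bounded
    variables, with denominators bounded below. Expressions are therefore reified as syntax, and
    smoothness, bounds and Lipschitz dependence follow by induction on it.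

    A second obstacle is mu. For mu <> 0 the argument of F + i G has different limits at the two
    ends of the line, so the breather has no decaying primitive. The slowly varying part of the
    argument is split off as a kink with a small derivative. The remaining oscillating part has a
    decaying primitive, and its fractional norms follow from bounds on that primitive and on the
    derivative of the packet. *)

Definition has_deriv f g := forall x : R, is_derive x 1 f (g x).

Lemma has_deriv_ext f f' g g' : has_deriv f g -> f =1 f' -> g =1 g' ->
  has_deriv f' g'.
Proof. by move=> h /funext <- /funext <-. Qed.

Lemma has_derivE f g : has_deriv f g -> derive1 f = g.
Proof. by move=> h; apply/funext => x; rewrite derive1E; have := h x => /@derive_val. Qed.

Lemma has_deriv_derivable f g x : has_deriv f g -> derivable f x 1.
Proof. by move=> h; have := h x => /@ex_derive. Qed.

Lemma derivable_has_deriv f : (forall x, derivable f x 1) -> has_deriv f (derive1 f).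
Proof. by move=> h x; rewrite derive1E; apply: DeriveDef. Qed.

Lemma has_deriv_cont f g : has_deriv f g -> continuous f.
Proof.
move=> h x; apply: differentiable_continuous; apply/derivable1_diffP.
exact: has_deriv_derivable h.
Qed.

Lemma has_deriv_cst (a : R) : has_deriv (fun=> a) (fun=> 0).
Proof. by move=> x; exact: is_derive_cst. Qed.

Lemma has_deriv_id : has_deriv id (fun=> 1).
Proof. by move=> x; exact: is_derive_id. Qed.

Lemma has_derivD f f' g g' : has_deriv f f' -> has_deriv g g' ->
  has_deriv (fun x => f x + g x) (fun x => f' x + g' x).
Proof. by move=> hf hg x; have := hf x; have := hg x => *; exact: is_deriveD. Qed.

Lemma has_derivN f f' : has_deriv f f' -> has_deriv (fun x => - f x) (fun x => - f' x).
Proof. by move=> hf x; have := hf x => *; exact: is_deriveN. Qed.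

Lemma has_derivB f f' g g' : has_deriv f f' -> has_deriv g g' ->
  has_deriv (fun x => f x - g x) (fun x => f' x - g' x).
Proof. by move=> hf hg; apply: has_derivD => //; exact: has_derivN. Qed.

Lemma has_derivM f f' g g' : has_deriv f f' -> has_deriv g g' ->
  has_deriv (fun x => f x * g x) (fun x => f' x * g x + f x * g' x).
Proof.
move=> hf hg x; have Hf := hf x; have Hg := hg x.
apply: is_derive_eq (is_deriveM Hf Hg) _.
by rewrite /GRing.scale /=; ring.
Qed.

Lemma has_derivZ (a : R) f f' : has_deriv f f' ->
  has_deriv (fun x => a * f x) (fun x => a * f' x).
Proof.
move=> hf; apply: has_deriv_ext (has_derivM (has_deriv_cst a) hf) _ _ => // x.
by rewrite mul0r add0r.
Qed.

Lemma has_deriv_comp f f' g g' : has_deriv f f' -> has_deriv g g' ->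
  has_deriv (fun x => f (g x)) (fun x => g' x * f' (g x)).
Proof.
move=> hf hg x; have Hf := hf (g x); have Hg := hg x.
by have := @is_derive1_comp R f g x _ _ Hf Hg; rewrite /comp mulrC.
Qed.

Lemma has_derivV f f' : (forall x, f x != 0) -> has_deriv f f' ->
  has_deriv (fun x => (f x)^-1) (fun x => - f' x / f x ^+ 2).
Proof.
move=> f0 hf x; have Hf := hf x.
apply: is_derive_eq (is_deriveV (f0 x) Hf) _.
by rewrite /GRing.scale /= mulNr mulrC mulNr.
Qed.

Lemma has_deriv_expR f f' : has_deriv f f' ->
  has_deriv (fun x => expR (f x)) (fun x => f' x * expR (f x)).
Proof. by move=> hf; apply: (@has_deriv_comp expR expR) => // x; exact: is_derive_expR. Qed.

Lemma has_deriv_cos f f' : has_deriv f f' ->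
  has_deriv (fun x => cos (f x)) (fun x => - (f' x * sin (f x))).
Proof.
move=> hf; have hc : has_deriv (@cos R) (fun x => - sin x) by move=> x; exact: is_derive_cos.
by apply: has_deriv_ext (has_deriv_comp hc hf) _ _ => // x; rewrite mulrN.
Qed.

Lemma has_deriv_sin f f' : has_deriv f f' ->
  has_deriv (fun x => sin (f x)) (fun x => f' x * cos (f x)).
Proof. by move=> hf; apply: (@has_deriv_comp sin cos) => // x; exact: is_derive_sin. Qed.

Lemma has_deriv_atan f f' : has_deriv f f' ->
  has_deriv (fun x => atan (f x)) (fun x => f' x / (1 + f x ^+ 2)).
Proof.
move=> hf; apply: (@has_deriv_comp atan (fun x => (1 + x ^+ 2)^-1)) => // x.
exact: is_derive1_atan.
Qed.

Lemma has_deriv_affine (a b : R) : has_deriv (fun x => a * x + b) (fun=> a).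
Proof.
apply: has_deriv_ext (has_derivD (has_derivZ a has_deriv_id) (has_deriv_cst b)) _ _ => // x.
by rewrite mulr1 addr0.
Qed.

Lemma lipschitz_of_deriv f f' (K : R) : has_deriv f f' -> (forall x, `|f' x| <= K) ->
  forall x y, `|f x - f y| <= K * `|x - y|.
Proof.
move=> hf hK; suff H x y : x < y -> `|f x - f y| <= K * `|x - y|.
  move=> x y; case: (ltgtP x y) => [|yx|->]; first exact: H.
  - by rewrite distrC (distrC x); exact: H.
  - by rewrite !subrr normr0 mulr0.
move=> xy.
have [||c _ E] := @MVT R f f' x y xy.
- by move=> z _; exact: hf.
- by apply: continuous_subspaceT; exact: has_deriv_cont hf.
by rewrite distrC E normrM (distrC x) ler_wpM2r.
Qed.

Lemma atan_lipschitz (x y : R) : `|atan x - atan y| <= `|x - y|.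
Proof.
have := @lipschitz_of_deriv atan _ 1 (has_deriv_atan has_deriv_id).
rewrite -[leRHS]mul1r; apply=> z.
rewrite mul1r ger0_norm ?invr_ge0 ?addr_ge0 ?sqr_ge0 //.
by rewrite invf_le1 ?lerDl ?sqr_ge0 // ltr_pwDl ?sqr_ge0.
Qed.

Lemma sin_lipschitz (x y : R) : `|sin x - sin y| <= `|x - y|.
Proof.
have := @lipschitz_of_deriv sin _ 1 (has_deriv_sin has_deriv_id).
rewrite -[leRHS]mul1r; apply=> z; rewrite mul1r.
by rewrite ler_norml cos_geN1 cos_le1.
Qed.

Lemma cos_lipschitz (x y : R) : `|cos x - cos y| <= `|x - y|.
Proof.
have := @lipschitz_of_deriv cos _ 1 (has_deriv_cos has_deriv_id).
rewrite -[leRHS]mul1r; apply=> z; rewrite mul1r normrN.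
by rewrite ler_norml sin_geN1 sin_le1.
Qed.

Lemma atan_bound (x : R) : `|atan x| <= 2.
Proof.
have h1 := atan_ltpi2 x; have h2 := atan_gtNpi2 x; have h3 := @pihalf_02 R.
move: h3 => /andP[_ h3]; rewrite ler_norml; lra.
Qed.

End Derivatives.

(** * Integrals over the line and quadratic decay *)

Section Integrals.
Context {R : realType}.
Implicit Types (f g h F G H : R -> R) (a b c B C K : R).

Notation leb := (@lebesgue_measure R).
Definition integ f := leb.-integrable [set: R] (EFin \o f).
(** The Lorentzian is the common majorant of all decay estimates: it has the bounded primitive
    [atan], and its affine rescalings are just as easy to integrate. *)
Definition lor (x : R) : R := (1 + x ^+ 2)^-1.

Lemma cont_meas f : continuous f -> measurable_fun [set: R] f.
Proof. exact: continuous_measurable_fun. Qed.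

Lemma cont_measE f : continuous f -> measurable_fun [set: R] (fun x => (f x)%:E).
Proof. by move=> cf; apply/measurable_EFinP; exact: cont_meas. Qed.

(** For a nonnegative integrand the integral is a monotone limit over the intervals [-n, n], each of
    them computed by the fundamental theorem of calculus. *)
Lemma int_antideriv h H : continuous h -> (forall x, 0 <= h x) -> has_deriv H h ->
  (H n%:R - H (- n%:R))%:E @[n --> \oo] --> (\int[leb]_x (h x)%:E)%E.
Proof.
move=> ch h0 dH.
have E : (fun n : nat => (H n%:R - H (- n%:R))%:E) =
  (fun n : nat => (\int[leb]_(x in `[(- n%:R)%R, n%:R%R]%classic) (h x)%:E)%E).
  apply/funext => -[|n].
    by rewrite oppr0 subrr set_itv1 integral_set1.
  rewrite (@continuous_FTC2 R h H) //.
  - by rewrite ltrNl (lt_le_trans (y := 0)) ?oppr_lt0 ?ltr0n // oppr_le0.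
  - exact: continuous_subspaceT.
  - split=> [x _||].
    + exact: has_deriv_derivable dH.
    + by apply: cvg_at_right_filter; exact: (has_deriv_cont dH).
    + by apply: cvg_at_left_filter; exact: (has_deriv_cont dH).
  - by move=> x _; rewrite (has_derivE dH).
rewrite E.
have -> : [set: R] = \bigcup_n `[- (n%:R : R), n%:R]%classic.
  apply/seteqP; split=> // x _.
  exists (Num.trunc `|x|).+1 => //=.
  by rewrite in_itv /= -ler_norml ltW // Num.Theory.truncnS_gt.
apply: ge0_nondecreasing_set_cvg_integral => //.
- apply/nondecreasing_seqP => n; apply/subsetPset => x /=.
  by rewrite !in_itv /= -!ler_norml => /le_trans; apply; rewrite ler_nat.
- by move=> n; apply: measurable_funTS; exact: cont_measE.
- by move=> n x _; rewrite lee_fin.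
Qed.

Lemma int_antideriv_le h H B : continuous h -> (forall x, 0 <= h x) -> has_deriv H h ->
  (forall x, `|H x| <= B) -> (\int[leb]_x (h x)%:E <= (2 * B)%:E)%E.
Proof.
move=> ch h0 dH hB; apply: cvge_le (int_antideriv ch h0 dH).
apply: nearW => n; rewrite lee_fin.
have := hB n%:R; have := hB (- n%:R); rewrite !ler_norml => /andP[? ?] /andP[? ?]; lra.
Qed.

Lemma integ_ge0 h B : continuous h -> (forall x, 0 <= h x) ->
  (\int[leb]_x (h x)%:E <= B%:E)%E -> integ h.
Proof.
move=> ch h0 hB; apply/integrableP; split; first exact: cont_measE.
rewrite (_ : (\int[leb]_x `|(EFin \o h) x|)%E = (\int[leb]_x (h x)%:E)%E).
  by rewrite (le_lt_trans hB) ?ltry.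
by apply: eq_integral => x _ /=; rewrite ger0_norm.
Qed.

Lemma integ_antideriv h H B : continuous h -> (forall x, 0 <= h x) -> has_deriv H h ->
  (forall x, `|H x| <= B) -> integ h /\ \int[leb]_x h x <= 2 * B.
Proof.
move=> ch h0 dH hB; have hi := int_antideriv_le ch h0 dH hB.
split; first exact: integ_ge0 hi.
rewrite -lee_fin /Rintegral fineK //.
have := integ_ge0 ch h0 hi => /integrable_fin_num; exact.
Qed.

Lemma integ_dom f g : measurable_fun [set: R] f -> (forall x, `|f x| <= g x) -> integ g -> integ f.
Proof.
move=> mf fg ig; apply: (le_integrable _ _ _ ig) => //; first exact/measurable_EFinP.
by move=> x _ /=; rewrite lee_fin (le_trans (fg x)) // ler_norm.
Qed.

Lemma integD f g : integ f -> integ g -> integ (fun x => f x + g x).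
Proof.
by move=> hf hg; have := @integrableD _ _ _ leb setT measurableT _ _ hf hg.
Qed.

Lemma integZ a f : integ f -> integ (fun x => a * f x).
Proof. by move=> hf; have := @integrableZl _ _ _ leb setT measurableT a _ hf. Qed.

Lemma integN f : integ f -> integ (fun x => - f x).
Proof. by move=> hf; have := @integrableN _ _ _ leb setT _ hf. Qed.

Lemma integB f g : integ f -> integ g -> integ (fun x => f x - g x).
Proof. by move=> hf hg; apply: integD => //; exact: integN. Qed.

Lemma int_le f g : integ f -> integ g -> (forall x, f x <= g x) ->
  \int[leb]_x f x <= \int[leb]_x g x.
Proof. by move=> hf hg fg; apply: le_Rintegral => //. Qed.

Lemma int_norm_le f g : integ f -> integ g -> (forall x, `|f x| <= g x) ->
  `|\int[leb]_x f x| <= \int[leb]_x g x.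
Proof.
move=> hf hg fg; apply: le_trans (le_normr_Rintegral _ hf) _ => //.
by apply: int_le => //; exact: (integrable_norm hf).
Qed.

Lemma int_ge0 f : (forall x, 0 <= f x) -> 0 <= \int[leb]_x f x.
Proof. by move=> f0; apply: Rintegral_ge0 => x _. Qed.

Lemma int_EFin f : integ f -> (\int[leb]_x (f x)%:E = (\int[leb]_x f x)%:E)%E.
Proof. by move=> hf; rewrite fineK //; exact: (integrable_fin_num _ hf). Qed.

Lemma lor_gt0 x : 0 < lor x.
Proof. by rewrite invr_gt0 ltr_pwDl ?sqr_ge0. Qed.

Lemma lor_ge0 x : 0 <= lor x. Proof. exact: ltW (lor_gt0 x). Qed.

Lemma lor_le1 x : lor x <= 1.
Proof. by rewrite invf_le1 ?lerDl ?sqr_ge0 // ltr_pwDl ?sqr_ge0. Qed.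

Lemma one_sqr_neq0 x : 1 + x ^+ 2 != 0 :> R.
Proof. by rewrite gt_eqF // ltr_pwDl ?sqr_ge0. Qed.

Lemma has_deriv_sqr1 : has_deriv (fun x : R => 1 + x ^+ 2) (fun x => 2 * x).
Proof.
apply: (has_deriv_ext (has_derivD (has_deriv_cst 1) (has_derivM has_deriv_id has_deriv_id))).
  by move=> x; rewrite expr2.
by move=> x /=; ring.
Qed.

Lemma cont_lor : continuous lor.
Proof. exact: has_deriv_cont (has_derivV one_sqr_neq0 has_deriv_sqr1). Qed.

Lemma has_deriv_atan_lor : has_deriv (@atan R) lor.
Proof. by move=> x; exact: is_derive1_atan. Qed.

Lemma integ_lor : integ lor.
Proof. by have [] := integ_antideriv cont_lor lor_ge0 has_deriv_atan_lor (@atan_bound R). Qed.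

Lemma int_lor_scaled a b : 0 < a ->
  integ (fun x => lor (a * x + b)) /\ \int[leb]_x lor (a * x + b) <= 4 / a.
Proof.
move=> a0.
have cl : continuous (fun x : R => lor (a * x + b)).
  move=> x; apply: (@continuous_comp _ _ _ (fun x => a * x + b) lor); last exact: cont_lor.
  exact: (has_deriv_cont (has_deriv_affine a b)).
have d : has_deriv (fun x => a^-1 * atan (a * x + b)) (fun x => lor (a * x + b)).
  apply: (has_deriv_ext (has_derivZ a^-1 (has_deriv_atan (has_deriv_affine a b)))) => // x.
  by rewrite mulrA mulVf ?mul1r // gt_eqF.
have h x : `|a^-1 * atan (a * x + b)| <= 2 / a.
  rewrite normrM (ger0_norm (x := a^-1)) ?invr_ge0 ?(ltW a0) // mulrC.
  by rewrite ler_wpM2r ?invr_ge0 ?(ltW a0) ?atan_bound.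
have [h1 h2] := integ_antideriv cl (fun x => lor_ge0 _) d h.
by split => //; apply: le_trans h2 _; rewrite mulrA -natrM.
Qed.

(** Quadratic decay suffices for integrability and for vanishing boundary terms, and it survives
    sums, products and bounded continuous factors. All functions whose norms are estimated lie in
    this class. *)
Definition tame f := continuous f /\ exists C, forall x, `|f x| <= C * lor x.

Lemma tame_integ f : tame f -> integ f.
Proof.
move=> [cf [C hC]]; apply: integ_dom (cont_meas cf) hC _.
exact: integZ integ_lor.
Qed.

Lemma contD f g : continuous f -> continuous g -> continuous (fun x => f x + g x).
Proof. by move=> cf cg x; apply: continuousD; [exact: cf|exact: cg]. Qed.

Lemma contM f g : continuous f -> continuous g -> continuous (fun x => f x * g x).
Proof. by move=> cf cg x; apply: continuousM; [exact: cf|exact: cg]. Qed.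

Lemma contN f : continuous f -> continuous (fun x => - f x).
Proof. by move=> cf x; apply: continuousN; exact: cf. Qed.

Lemma contC c : continuous (fun _ : R => c).
Proof. by move=> x; exact: cvg_cst. Qed.

Lemma tame_mul_bounded f g K : tame f -> continuous g -> (forall x, `|g x| <= K) ->
  tame (fun x => f x * g x).
Proof.
move=> [cf [C hC]] cg hK; split; first exact: contM.
exists (C * K) => x; rewrite normrM mulrAC.
by apply: ler_pM => //.
Qed.

Lemma tameD f g : tame f -> tame g -> tame (fun x => f x + g x).
Proof.
move=> [cf [C hC]] [cg [C' hC']]; split; first exact: contD.
by exists (C + C') => x; rewrite mulrDl (le_trans (ler_normD _ _)) // lerD.
Qed.

Lemma tameZ a f : tame f -> tame (fun x => a * f x).
Proof.
move=> [cf [C hC]]; split; first by apply: contM => //; exact: contC.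
by exists (`|a| * C) => x; rewrite normrM -mulrA ler_wpM2l.
Qed.

Lemma tameN f : tame f -> tame (fun x => - f x).
Proof.
move=> [cf [C hC]]; split; first exact: contN.
by exists C => x; rewrite normrN.
Qed.

Lemma tameB f g : tame f -> tame g -> tame (fun x => f x - g x).
Proof. by move=> hf hg; apply: tameD => //; exact: tameN. Qed.

Lemma tame_bounded f : tame f -> exists2 K, 0 <= K & forall x, `|f x| <= K.
Proof.
move=> [cf [C hC]]; exists `|C| => // x; apply: le_trans (hC x) _.
apply: le_trans (ler_norm _) _; rewrite normrM (ger0_norm (lor_ge0 x)).
by apply: ler_piMr (lor_le1 x) => //; exact: normr_ge0.
Qed.

Lemma tame_mul f g : tame f -> tame g -> tame (fun x => f x * g x).
Proof.
move=> hf hg; have [K _ hK] := tame_bounded hg.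
exact: tame_mul_bounded hf hg.1 hK.
Qed.

Lemma lorZ x : lor x * (1 + x ^+ 2) = 1.
Proof. by rewrite mulVf // one_sqr_neq0. Qed.

Lemma lor_cvg0 C : (C * lor n%:R) @[n --> \oo] --> (0 : R).
Proof.
rewrite -[X in _ --> X](mulr0 C); apply: cvgMr.
apply: (@squeeze_cvgr _ _ _ _ (fun=> 0) (@harmonic R)).
- near=> n; rewrite lor_ge0 /= lef_pV2 ?posrE ?ltr_pwDl ?sqr_ge0 //.
  by rewrite -natrX -[1](natrX _ 1 0) -natrD ler_nat expn0 add1n ltnS -mulnn; case: (n) => // k; rewrite leq_pmull.
- exact: cvg_cst.
- exact: cvg_harmonic.
Unshelve. all: by end_near.
Qed.

(** Monotone convergence needs a nonnegative integrand. Adding [C * lor] to [f] provides one, with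
    primitive [F + C * atan]. The same limit for [C * lor] alone is then subtracted, and the
    boundary terms of [F] vanish by decay. *)
Lemma int_deriv0 F f : has_deriv F f -> tame F -> tame f -> \int[leb]_x f x = 0.
Proof.
move=> dF [cF [CF hF]] [cf [C hC]].
have cK c : continuous (fun x => c * lor x) by apply: contM; [exact: contC|exact: cont_lor].
have C0 : 0 <= C by have := le_trans (normr_ge0 _) (hC 0); rewrite pmulr_lge0 ?lor_gt0.
pose h x := f x + C * lor x.
have ch : continuous h by apply: contD.
have h0 x : 0 <= h x by rewrite -lerBlDr sub0r; have := hC x; rewrite ler_norml => /andP[].
have dK := has_derivZ C has_deriv_atan_lor.
have lim1 := int_antideriv ch h0 (has_derivD dF dK).
have lim2 := int_antideriv (cK C) (fun x => mulr_ge0 C0 (lor_ge0 x)) dK.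
have iL : integ (fun x => C * lor x) := integZ C integ_lor.
have iF : integ f := tame_integ (conj cf (ex_intro _ C hC)).
rewrite (int_EFin (integD iF iL)) in lim1; rewrite (int_EFin iL) in lim2.
move/fine_cvg: lim1 => /=; move/fine_cvg: lim2 => /= lim2 lim1.
have lim3 : (F n%:R - F (- n%:R)) @[n --> \oo] --> \int[leb]_x f x.
  have -> : \int[leb]_x f x = \int[leb]_x (f x + C * lor x) - \int[leb]_x (C * lor x).
    by rewrite RintegralD // addrK.
  have -> : (fun n : nat => F n%:R - F (- n%:R)) = (fun n : nat =>
      (F n%:R + C * atan n%:R - (F (- n%:R) + C * atan (- n%:R))) -
      (C * atan n%:R - C * atan (- n%:R))).
    by apply/funext => n; ring.
  exact: cvgB.
apply: (cvg_unique (@Rhausdorff R) lim3); apply/norm_cvg0P.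
apply: (@squeeze_cvgr _ _ _ _ (fun=> 0) (fun n => (2 * CF) * lor n%:R)).
- near=> n; rewrite normr_ge0 /= (le_trans (ler_normB _ _)) //.
  rewrite -mulrA mulr_natl mulr2n lerD //.
  by apply: le_trans (hF _) _; rewrite /lor sqrrN.
- exact: cvg_cst.
- exact: lor_cvg0.
Unshelve. all: by end_near.
Qed.

Lemma int_ge_itv f g G p q : p < q -> continuous f -> integ f -> (forall x, 0 <= f x) -> continuous g ->
  has_deriv G g -> (forall x, p <= x <= q -> 0 <= g x <= f x) ->
  G q - G p <= \int[leb]_x f x.
Proof.
move=> pq cf iF f0 cg dG gf; rewrite -lee_fin -int_EFin // EFinB.
rewrite -(@continuous_FTC2 R g G p q) //.
- apply: (@le_trans _ _ (\int[leb]_(x in `[p, q]%classic) (f x)%:E)%E).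
    apply: ge0_le_integral => //=.
    + by move=> x /=; rewrite in_itv /= => /gf /andP[]; rewrite lee_fin.
    + by apply: measurable_funTS; exact: cont_measE.
    + by apply: measurable_funTS; exact: cont_measE.
    + by move=> x /=; rewrite in_itv /= => /gf /andP[]; rewrite lee_fin.
  apply: ge0_subset_integral => //; first exact: cont_measE.
  by move=> x _; rewrite lee_fin.
- exact: continuous_subspaceT.
- split=> [x _||].
  + exact: has_deriv_derivable dG.
  + by apply: cvg_at_right_filter; exact: (has_deriv_cont dG).
  + by apply: cvg_at_left_filter; exact: (has_deriv_cont dG).
- by move=> x _; rewrite (has_derivE dG).
Qed.

(** The term with [lor] is the tail of the primitive and disappears in the limit; with [e = 0] the
    integral is evaluated exactly. *)
Lemma int_approx_antideriv h H L e C : continuous h -> (forall x, 0 <= h x) -> has_deriv H h ->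
  integ h -> (forall n : nat, `|H n%:R - H (- n%:R) - L| <= e + C * lor n%:R) ->
  `|\int[leb]_x h x - L| <= e.
Proof.
move=> ch h0 dH ih hb.
have := int_antideriv ch h0 dH; rewrite int_EFin // => /fine_cvg /= lim.
have l1 : (`|H n%:R - H (- n%:R) - L|) @[n --> \oo] --> `|\int[leb]_x h x - L|.
  by apply: cvg_norm; apply: cvgB => //; exact: cvg_cst.
have l2 : (e + C * lor n%:R) @[n --> \oo] --> e.
  by rewrite -[X in _ --> X]addr0; apply: cvgD; [exact: cvg_cst|exact: lor_cvg0].
by apply: ler_cvg_to l1 l2 _; exact: nearW.
Qed.

End Integrals.

(** * Fourier transforms *)

Section Fubini.
Context {R : realType}.
Implicit Types (f g h F G H : R -> R) (a b c B C K : R) (k : R -> R -> R).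
Notation leb := (@lebesgue_measure R).

Definition bounded_kernel k := measurable_fun [set: R * R] (fun z => k z.1 z.2) /\
  exists K, forall x y, `|k x y| <= K.

Lemma int_norm_EFin f : integ f -> (\int[leb]_x `|f x|%:E = (\int[leb]_x `|f x|)%:E)%E.
Proof. by move=> hf; apply: (@int_EFin R (fun x => `|f x|)); exact: (integrable_norm hf). Qed.

Lemma integ_meas f : integ f -> measurable_fun [set: R] f.
Proof. by move=> /integrableP [/measurable_EFinP]. Qed.

Lemma kernel_integrable k f g : bounded_kernel k -> integ f -> integ g ->
  (leb \x leb)%E.-integrable [set: R * R] (fun z => (f z.1 * (k z.1 z.2 * g z.2))%:E).
Proof.
move=> [mk [K hK]] hf hg.
have mz : measurable_fun [set: R * R] (fun z => f z.1 * (k z.1 z.2 * g z.2)).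
  apply: measurable_funM.
    apply: (measurableT_comp (integ_meas hf)); exact: measurable_fst.
  apply: measurable_funM => //.
  apply: (measurableT_comp (integ_meas hg)); exact: measurable_snd.
apply/integrable12ltyP; first exact/measurable_EFinP.
have hK0 : 0 <= K by apply: le_trans (hK 0 0).
have hk : integ (fun y => K * `|g y|) by apply: integZ; exact: (integrable_norm hg).
set J := \int[leb]_y (K * `|g y|).
apply: (@le_lt_trans _ _ (\int[leb]_x (J * `|f x|)%:E)%E); last first.
  rewrite int_EFin ?ltry //; apply: integZ; exact: (integrable_norm hf).
apply: ge0_le_integral => //=.
- by move=> x _; exact: integral_ge0.
- apply: (@measurable_fun_fubini_tonelli_F _ _ _ _ _ leb (fun z => (`|f z.1 * (k z.1 z.2 * g z.2)|)%:E)) => //.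
  apply/measurable_EFinP; exact: (measurableT_comp _ mz).
- apply/measurable_EFinP; apply: measurable_funM => //.
  exact: (measurableT_comp _ (integ_meas hf)).
move=> x _.
have -> : (J * `|f x|)%:E = (\int[leb]_y (`|f x| * (K * `|g y|))%:E)%E.
  rewrite (@int_EFin R (fun y => `|f x| * (K * `|g y|))); last exact: integZ.
  by rewrite RintegralZl // mulrC.
have mfx : measurable_fun [set: R] (fun y => f x * (k x y * g y)).
  exact: (measurableT_comp mz (measurable_pair1 x)).
apply: ge0_le_integral => //=.
- by apply/measurable_EFinP; exact: (measurableT_comp _ mfx).
- by apply/measurable_EFinP; exact: integ_meas (integZ _ hk).
- move=> y _; rewrite lee_fin !normrM ler_wpM2l // ler_wpM2r //.
Qed.

Lemma kernel_row_integ k g x : bounded_kernel k -> integ g -> integ (fun y => k x y * g y).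
Proof.
move=> [mk [K hK]] hg.
apply: (@integ_dom R _ (fun y => K * `|g y|)).
- apply: measurable_funM; last exact: integ_meas.
  exact: (measurableT_comp mk (measurable_pair1 x)).
- by move=> y; rewrite normrM ler_wpM2r.
- by apply: integZ; exact: (integrable_norm hg).
Qed.

Lemma bounded_kernel_sym k : bounded_kernel k -> bounded_kernel (fun x y => k y x).
Proof.
move=> [mk [K hK]]; split; last by exists K => x y; exact: hK.
apply: (measurableT_comp (f := fun z => k z.1 z.2) (g := fun z : R * R => (z.2, z.1))) => //.
by apply/measurable_fun_pair; [exact: measurable_snd|exact: measurable_fst].
Qed.

Lemma kernel_swap k f g : bounded_kernel k -> integ f -> integ g ->
  \int[leb]_x (f x * \int[leb]_y (k x y * g y)) =
  \int[leb]_y (g y * \int[leb]_x (k x y * f x)).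
Proof.
move=> hk hf hg.
have := Fubini (kernel_integrable hk hf hg) => /= E.
rewrite /Rintegral; congr fine.
transitivity (\int[leb]_x \int[leb]_y (f x * (k x y * g y))%:E)%E.
  apply: eq_integral => x _; have hr := kernel_row_integ x hk hg.
  by rewrite (@int_EFin R (fun y => f x * (k x y * g y))) ?RintegralZl //; exact: integZ.
rewrite E; apply: eq_integral => y _.
have hr := kernel_row_integ y (bounded_kernel_sym hk) hf.
transitivity (\int[leb]_x (g y * (k x y * f x))%:E)%E.
  by apply: eq_integral => x _; congr EFin; ring.
by rewrite (@int_EFin R (fun x => g y * (k x y * f x))) ?RintegralZl //; exact: integZ.
Qed.

Lemma kernel_integ k f g : bounded_kernel k -> integ f -> integ g ->
  integ (fun x => f x * \int[leb]_y (k x y * g y)).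
Proof.
move=> hk hf hg; have := integrable_fubini_F (kernel_integrable hk hf hg).
rewrite /fubini_F /integ; congr integrable; apply/funext => x /=.
have hr := kernel_row_integ x hk hg.
by rewrite (@int_EFin R (fun y => f x * (k x y * g y))) ?RintegralZl //; exact: integZ.
Qed.

(** Fubini's theorem gives measurability of the inner integral together with an integrable factor in
    the outer variable. Here that factor is [lor], which is divided out afterwards. *)
Lemma kernel_meas k g : bounded_kernel k -> integ g ->
  measurable_fun [set: R] (fun x => \int[leb]_y (k x y * g y)).
Proof.
move=> hk hg; have := integ_meas (kernel_integ hk integ_lor hg) => h.
have -> : (fun x => \int[leb]_y (k x y * g y)) =
   (fun x => (1 + x ^+ 2) * (lor x * \int[leb]_y (k x y * g y))).
  by apply/funext => x; rewrite mulrA [_ * lor x]mulrC lorZ mul1r.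
apply: measurable_funM => //; apply: cont_meas; exact: (has_deriv_cont has_deriv_sqr1).
Qed.

End Fubini.

(** * Exchange and differentiation rules for Fourier integrals *)

Section FourierTools.
Context {R : realType}.
Implicit Types (f g F G H psi : R -> R) (a b c h B C K s x xi : R) (k : R -> R -> R).
Notation leb := (@lebesgue_measure R).

Lemma cont_cos : continuous (@cos R). Proof. exact: continuous_cos. Qed.
Lemma cont_sin : continuous (@sin R). Proof. exact: continuous_sin. Qed.

Lemma norm_cos x : `|cos x| <= 1. Proof. by rewrite ler_norml cos_geN1 cos_le1. Qed.
Lemma norm_sin x : `|sin x| <= 1. Proof. by rewrite ler_norml sin_geN1 sin_le1. Qed.

Lemma bounded_kernel_mul (u : R -> R) : continuous u -> (forall x, `|u x| <= 1) ->
  bounded_kernel (fun x y => u (x * y)).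
Proof.
move=> cu hu; split; last by exists 1 => x y; exact: hu.
apply: (measurableT_comp (cont_meas cu)).
by apply: measurable_funM; [exact: measurable_fst|exact: measurable_snd].
Qed.

Lemma kernel_cos : bounded_kernel (fun x y : R => cos (x * y)).
Proof. exact: (bounded_kernel_mul cont_cos norm_cos). Qed.
Lemma kernel_sin : bounded_kernel (fun x y : R => sin (x * y)).
Proof. exact: (bounded_kernel_mul cont_sin norm_sin). Qed.

Lemma integ_cos f x : integ f -> integ (fun y => cos (x * y) * f y).
Proof. exact: (kernel_row_integ x kernel_cos). Qed.
Lemma integ_sin f x : integ f -> integ (fun y => sin (x * y) * f y).
Proof. exact: (kernel_row_integ x kernel_sin). Qed.

Lemma fourier_cos_swap f g : integ f -> integ g ->
  \int[leb]_x (fourier_cos f x * g x) = \int[leb]_x (f x * fourier_cos g x).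
Proof.
move=> hf hg; rewrite [RHS](kernel_swap kernel_cos hf hg); apply: eq_Rintegral => x _.
by rewrite mulrC; congr (_ * _); apply: eq_Rintegral => y _; rewrite (mulrC x).
Qed.

Lemma fourier_sin_swap f g : integ f -> integ g ->
  \int[leb]_x (fourier_sin f x * g x) = \int[leb]_x (f x * fourier_sin g x).
Proof.
move=> hf hg; rewrite [RHS](kernel_swap kernel_sin hf hg); apply: eq_Rintegral => x _.
by rewrite mulrC; congr (_ * _); apply: eq_Rintegral => y _; rewrite (mulrC x).
Qed.

Lemma fourier_cos_meas f : integ f -> measurable_fun [set: R] (fourier_cos f).
Proof. exact: (kernel_meas kernel_cos). Qed.
Lemma fourier_sin_meas f : integ f -> measurable_fun [set: R] (fourier_sin f).
Proof. exact: (kernel_meas kernel_sin). Qed.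

Lemma fourier_cos_bound f x : integ f -> `|fourier_cos f x| <= \int[leb]_y `|f y|.
Proof.
move=> hf; apply: int_norm_le; [exact: integ_cos|exact: (integrable_norm hf)|].
by move=> y; rewrite normrM ler_piMl // norm_cos.
Qed.
Lemma fourier_sin_bound f x : integ f -> `|fourier_sin f x| <= \int[leb]_y `|f y|.
Proof.
move=> hf; apply: int_norm_le; [exact: integ_sin|exact: (integrable_norm hf)|].
by move=> y; rewrite normrM ler_piMl // norm_sin.
Qed.

Lemma fourier_cosD f g x : integ f -> integ g ->
  fourier_cos (fun y => f y + g y) x = fourier_cos f x + fourier_cos g x.
Proof.
move=> hf hg; rewrite -RintegralD //; [|exact: integ_cos|exact: integ_cos].
by apply: eq_Rintegral => y _; rewrite mulrDr.
Qed.
Lemma fourier_sinD f g x : integ f -> integ g ->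
  fourier_sin (fun y => f y + g y) x = fourier_sin f x + fourier_sin g x.
Proof.
move=> hf hg; rewrite -RintegralD //; [|exact: integ_sin|exact: integ_sin].
by apply: eq_Rintegral => y _; rewrite mulrDr.
Qed.

Lemma has_deriv_cosl x : has_deriv (fun y : R => cos (x * y)) (fun y => - (x * sin (x * y))).
Proof.
apply: (has_deriv_ext (has_deriv_cos (has_derivZ x has_deriv_id))) => y //=.
by rewrite mulr1.
Qed.
Lemma has_deriv_sinl x : has_deriv (fun y : R => sin (x * y)) (fun y => x * cos (x * y)).
Proof.
apply: (has_deriv_ext (has_deriv_sin (has_derivZ x has_deriv_id))) => y //=.
by rewrite mulr1.
Qed.

Lemma tame_ext f g : f =1 g -> tame f -> tame g. Proof. by move=> /funext ->. Qed.
Lemma integ_ext f g : f =1 g -> integ f -> integ g. Proof. by move=> /funext ->. Qed.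

Lemma tame_cos f x : tame f -> tame (fun y => cos (x * y) * f y).
Proof.
move=> hf; have := tame_mul_bounded hf (has_deriv_cont (has_deriv_cosl x)) (fun y => norm_cos _).
by apply: tame_ext => y; rewrite mulrC.
Qed.
Lemma tame_sin f x : tame f -> tame (fun y => sin (x * y) * f y).
Proof.
move=> hf; have := tame_mul_bounded hf (has_deriv_cont (has_deriv_sinl x)) (fun y => norm_sin _).
by apply: tame_ext => y; rewrite mulrC.
Qed.

Lemma fourier_cos_deriv F f x : has_deriv F f -> tame F -> tame f ->
  fourier_cos f x = x * fourier_sin F x.
Proof.
move=> dF tF tf.
have iF := tame_integ tF; have if' := tame_integ tf.
have := int_deriv0 (has_derivM (has_deriv_cosl x) dF) (tame_cos x tF).
rewrite -RintegralZl //; last exact: integ_sin.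
move=> H; apply/eqP; rewrite -subr_eq0 -RintegralB //; [|exact: integ_cos|exact/integZ/integ_sin].
apply/eqP; rewrite -[RHS]H; last first.
  apply: tameD; last exact: tame_cos.
  have := tameN (tameZ x (tame_sin x tF)).
  by apply: tame_ext => y; rewrite mulrA mulNr.
by apply: eq_Rintegral => y _; ring.
Qed.

Lemma fourier_sin_deriv F f x : has_deriv F f -> tame F -> tame f ->
  fourier_sin f x = - (x * fourier_cos F x).
Proof.
move=> dF tF tf.
have iF := tame_integ tF; have if' := tame_integ tf.
have := int_deriv0 (has_derivM (has_deriv_sinl x) dF) (tame_sin x tF).
rewrite -RintegralZl //; last exact: integ_cos.
move=> H; apply/eqP; rewrite -subr_eq0 opprK -RintegralD //; [|exact: integ_sin|exact/integZ/integ_cos].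
apply/eqP; rewrite -[RHS]H; last first.
  apply: tameD; last exact: tame_sin.
  have := tameZ x (tame_cos x tF).
  by apply: tame_ext => y; rewrite mulrA.
by apply: eq_Rintegral => y _; ring.
Qed.

(** Fourier integrals are differentiated through a uniform quadratic remainder: the pointwise
    remainders [cos_quad] and [sin_quad], integrated against a function, are bounded by its absolute
    second moment times h^2. *)
Lemma has_deriv_quad F f C : (forall x h, `|F (x + h) - F x - h * f x| <= C * h ^+ 2) -> has_deriv F f.
Proof.
move=> hC x.
have lim : h^-1 *: (F (h *: (1 : R) + x) - F x) @[h --> 0^'] --> f x.
  apply/cvgrPdist_le => e e0; near=> h.
  have h0 : h != 0 by near: h; exact: nbhs_dnbhs_neq.
  have he : `|h| * (`|C| + 1) <= e.
    rewrite -ler_pdivlMr ?ltr_wpDl //; near: h.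
    apply: (@cvgr_norm_le _ _ _ _ _ id 0); last by rewrite normr0 divr_gt0 // ltr_wpDl.
    exact: nbhs_dnbhs.
  rewrite /GRing.scale /= mulr1 (addrC h).
  have -> : f x - h^-1 * (F (x + h) - F x) = - (h^-1 * (F (x + h) - F x - h * f x)).
    by rewrite (mulrBr _ _ (h * _)) mulKf //; ring.
  rewrite normrN normrM normfV ler_pdivrMl ?normr_gt0 //.
  apply: le_trans (hC x h) _; rewrite -[h ^+ 2]ger0_norm ?sqr_ge0 // normrX.
  have := ler_norm C; have := normr_ge0 h; nra.
split; first by apply/cvg_ex; exists (f x).
exact: (cvg_lim (@Rhausdorff R) lim).
Unshelve. all: by end_near.
Qed.

Lemma cos_quad x v : `|cos (x + v) - cos x + v * sin x| <= v ^+ 2.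
Proof.
pose ph (t : R) := cos (t * v + x) - cos x + t * (v * sin x).
have dph : has_deriv ph (fun t => v * (sin x - sin (t * v + x))).
  have d1 : has_deriv (fun t => t * v + x) (fun=> v).
    by apply: (has_deriv_ext (has_deriv_affine v x)) => // t; rewrite mulrC.
  apply: (has_deriv_ext (has_derivD (has_derivB (has_deriv_cos d1) (has_deriv_cst (cos x)))
     (has_derivM has_deriv_id (has_deriv_cst (v * sin x))))) => t //=; ring.
have [||c hc E] := @MVT R ph (fun t => v * (sin x - sin (t * v + x))) 0 1 ltr01.
- by move=> z _; exact: dph.
- by apply: continuous_subspaceT; exact: has_deriv_cont dph.
have -> : cos (x + v) - cos x + v * sin x = ph 1 - ph 0.
  by rewrite /ph !mul1r !mul0r add0r addr0 subrr subr0 (addrC v).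
have -> : v ^+ 2 = `|v| * `|v| by rewrite -normrM -expr2 ger0_norm ?sqr_ge0.
rewrite E subr0 mulr1 normrM ler_wpM2l //.
move: hc; rewrite in_itv /= => /andP[c0 c1].
apply: le_trans (sin_lipschitz _ _) _.
rewrite (_ : x - (c * v + x) = - (c * v)); last by ring.
rewrite normrN normrM.
by rewrite ler_piMl // ger0_norm ltW.
Qed.

Lemma sin_quad x v : `|sin (x + v) - sin x - v * cos x| <= v ^+ 2.
Proof.
have := cos_quad (x - pi / 2) v.
have -> : x - pi / 2 + v = x + v - pi / 2 by ring.
by rewrite !cosBpihalf sinBpihalf mulrN.
Qed.

Lemma has_deriv_fourier_cos f : integ f -> integ (fun x => x * f x) -> integ (fun x => x ^+ 2 * f x) ->
  has_deriv (fourier_cos f) (fun x => - fourier_sin (fun y => y * f y) x).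
Proof.
move=> h0 h1 h2; have h2n := integrable_norm h2.
apply: (@has_deriv_quad _ _ (\int[leb]_y `|y ^+ 2 * f y|)) => x h.
have -> : fourier_cos f (x + h) - fourier_cos f x - h * - fourier_sin (fun y => y * f y) x =
  \int[leb]_y ((cos (x * y + h * y) - cos (x * y) + (h * y) * sin (x * y)) * f y).
  rewrite mulrN opprK -RintegralZl //; last exact: integ_sin.
  rewrite -RintegralB //; [|exact: integ_cos|exact: integ_cos].
  rewrite -RintegralD //; [|apply: integB; exact: integ_cos|exact/integZ/integ_sin].
  by apply: eq_Rintegral => y _; rewrite mulrDl; ring.
rewrite mulrC -RintegralZl //; apply: int_norm_le.
- have := integD (integB (integ_cos (x + h) h0) (integ_cos x h0)) (integZ h (integ_sin x h1)).
  by congr integ; apply/funext => y; rewrite mulrDl; ring.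
- exact: integZ h2n.
- move=> y; rewrite normrM [in leRHS]normrM mulrA ler_wpM2r //.
  by apply: le_trans (cos_quad _ _) _; rewrite exprMn (ger0_norm (sqr_ge0 y)).
Qed.

Lemma has_deriv_fourier_sin f : integ f -> integ (fun x => x * f x) -> integ (fun x => x ^+ 2 * f x) ->
  has_deriv (fourier_sin f) (fun x => fourier_cos (fun y => y * f y) x).
Proof.
move=> h0 h1 h2; have h2n := integrable_norm h2.
apply: (@has_deriv_quad _ _ (\int[leb]_y `|y ^+ 2 * f y|)) => x h.
have -> : fourier_sin f (x + h) - fourier_sin f x - h * fourier_cos (fun y => y * f y) x =
  \int[leb]_y ((sin (x * y + h * y) - sin (x * y) - (h * y) * cos (x * y)) * f y).
  rewrite -RintegralZl //; last exact: integ_cos.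
  rewrite -RintegralB //; [|exact: integ_sin|exact: integ_sin].
  rewrite -RintegralB //; [|apply: integB; exact: integ_sin|exact/integZ/integ_cos].
  by apply: eq_Rintegral => y _; rewrite mulrDl; ring.
rewrite mulrC -RintegralZl //; apply: int_norm_le.
- have := integB (integB (integ_sin (x + h) h0) (integ_sin x h0)) (integZ h (integ_cos x h1)).
  by congr integ; apply/funext => y; rewrite mulrDl; ring.
- exact: integZ h2n.
- move=> y; rewrite normrM [in leRHS]normrM mulrA ler_wpM2r //.
  by apply: le_trans (sin_quad _ _) _; rewrite exprMn (ger0_norm (sqr_ge0 y)).
Qed.

End FourierTools.

(** * Gaussians and their transforms *)

Section Gaussian.
Context {R : realType}.
Implicit Types (f g F G psi : R -> R) (p : {poly R}) (a b c h B C K s x xi : R).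
Notation leb := (@lebesgue_measure R).

Definition gauss a c x : R := expR (- (a * (x - c) ^+ 2)).

Lemma gauss_gt0 a c x : 0 < gauss a c x. Proof. exact: expR_gt0. Qed.

Lemma has_deriv_gauss a c : has_deriv (gauss a c) (fun x => - (2 * a * (x - c)) * gauss a c x).
Proof.
have d0 := has_derivB has_deriv_id (has_deriv_cst c).
have d1 := has_derivN (has_derivZ a (has_derivM d0 d0)).
apply: (has_deriv_ext (has_deriv_expR d1)) => x; rewrite /gauss /= expr2 //; ring.
Qed.

Lemma cont_gauss a c : continuous (gauss a c).
Proof. exact: has_deriv_cont (has_deriv_gauss a c). Qed.

(** Peetre's inequality: moving the centre of the weight costs a factor that depends on the shift
    only. *)
Lemma shift_sqr1 x c : 1 + x ^+ 2 <= 2 * (1 + c ^+ 2) * (1 + (x - c) ^+ 2).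
Proof. have := sqr_ge0 (x - 2 * c); have := sqr_ge0 (c * (x - c)); lra. Qed.

(** The exponential of a u is the power n + 1 of the exponential of a u / (n + 1). Each such factor
    dominates 1 + u up to the constant [D], since expR z >= 1 + z. Taking n + 1 factors, although n
    would match the power, keeps the denominator nonzero for n = 0. *)
Lemma gauss_poly_bound a c n : 0 < a ->
  exists2 C, 0 <= C & forall x, (1 + x ^+ 2) ^+ n * gauss a c x <= C.
Proof.
move=> a0; pose u x := (x - c) ^+ 2.
pose D : R := 1 + n.+1%:R / a.
have D0 : 0 <= D by rewrite addr_ge0 // divr_ge0 // ltW.
have h1 x : 1 + u x <= D * expR (a * u x / n.+1%:R).
  apply: (@le_trans _ _ (D * (1 + a * u x / n.+1%:R))); last first.
    by rewrite ler_wpM2l // expR_ge1Dx.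
  rewrite /D mulrDl mul1r mulrDr mulr1.
  have -> : n.+1%:R / a * (a * u x / n.+1%:R) = u x.
    have N0 : n.+1%:R != 0 :> R by rewrite pnatr_eq0.
    have a_0 : a != 0 by rewrite gt_eqF.
    by move: (n.+1%:R : R) N0 => N N0; field; apply/andP; split.
  have : 0 <= a * u x / n.+1%:R by rewrite divr_ge0 // mulr_ge0 ?sqr_ge0 // ltW.
  have : 0 <= n.+1%:R / a by rewrite divr_ge0 // ltW.
  by move: (u x) (a * u x / _) (n.+1%:R / a) => p q r; lra.
exists ((2 * (1 + c ^+ 2) * D) ^+ n).
  by rewrite exprn_ge0 // mulr_ge0 // mulr_ge0 // addr_ge0 // sqr_ge0.
move=> x.
have hx : (1 + x ^+ 2) ^+ n <= (2 * (1 + c ^+ 2) * D) ^+ n * expR (a * u x / n.+1%:R) ^+ n.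
  rewrite -exprMn lerXn2r ?nnegrE ?addr_ge0 ?sqr_ge0 //.
    by rewrite !mulr_ge0 ?expR_ge0 // addr_ge0 ?sqr_ge0.
  apply: le_trans (shift_sqr1 x c) _; rewrite -(mulrA _ D).
  apply: ler_wpM2l; last exact: h1.
  by rewrite mulr_ge0 // addr_ge0 ?sqr_ge0.
apply: le_trans (ler_wpM2r (ltW (gauss_gt0 a c x)) hx) _.
rewrite -(mulrA (_ ^+ n)); apply: ler_piMr.
  by rewrite exprn_ge0 // mulr_ge0 // mulr_ge0 // addr_ge0 // sqr_ge0.
rewrite -expRM_natl -expRD -[leRHS]expR0 ler_expR /u -mulr_natl.
have e1 : n%:R * (a * (x - c) ^+ 2 / n.+1%:R) <= a * (x - c) ^+ 2.
  rewrite mulrCA; apply: (ler_piMr (mulr_ge0 (ltW a0) (sqr_ge0 _))).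
  by rewrite ler_pdivrMr ?ltr0n // mul1r ler_nat.
by rewrite ?mulr1 subr_le0.
Qed.

Lemma poly_bound p : exists C n, forall x, `|p.[x]| <= C * (1 + x ^+ 2) ^+ n.
Proof.
elim/poly_ind: p => [|p c [C [n IH]]].
  by exists 0, 0%N => x; rewrite horner0 normr0 mul0r.
exists (C + `|c|), n.+1 => x; rewrite hornerMXaddC.
have x1 : 1 <= 1 + x ^+ 2 by rewrite lerDl sqr_ge0.
have x2 : `|x| <= 1 + x ^+ 2.
  by rewrite -(ger0_norm (sqr_ge0 x)) normrX; have := sqr_ge0 (`|x| - 1); have := normr_ge0 x; nra.
rewrite mulrDl; apply: le_trans (ler_normD _ _) _; apply: lerD.
  by rewrite normrM exprSr mulrA; apply: ler_pM.
by rewrite ler_peMr // exprn_ege1.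
Qed.

Lemma gauss_poly_lor a c p : 0 < a -> tame (fun x => p.[x] * gauss a c x).
Proof.
move=> a0; have [C [n hC]] := poly_bound p.
have [D D0 hD] := gauss_poly_bound c n.+1 a0.
split.
  apply: contM; last exact: cont_gauss.
  by move=> x; exact: continuous_horner.
exists (C * D) => x; rewrite normrM (gtr0_norm (gauss_gt0 _ _ _)).
rewrite /lor ler_pdivlMr; last by rewrite ltr_pwDl ?sqr_ge0.
apply: (@le_trans _ _ (C * ((1 + x ^+ 2) ^+ n.+1 * gauss a c x))).
  have -> : C * ((1 + x ^+ 2) ^+ n.+1 * gauss a c x) = (C * (1 + x ^+ 2) ^+ n) * gauss a c x * (1 + x ^+ 2).
    by rewrite exprSr; ring.
  rewrite ler_wpM2r ?addr_ge0 ?sqr_ge0 // ler_wpM2r //; exact: ltW (gauss_gt0 _ _ _).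
apply: ler_wpM2l => //.
by have := le_trans (normr_ge0 _) (hC 0); rewrite expr0n addr0 expr1n mulr1.
Qed.

Lemma derive1n_gauss a c n : exists p, derive1n n (gauss a c) = (fun x => p.[x] * gauss a c x).
Proof.
elim: n => [|n [p IH]].
  by exists 1; apply/funext => x; rewrite hornerC mul1r.
exists (p^`() - p * (2 * a)%:P * ('X - c%:P)).
rewrite derive1nS IH.
have dp : has_deriv (fun x => p.[x]) (fun x => p^`().[x]) by move=> x; exact: is_derive_poly.
have := has_derivM dp (has_deriv_gauss a c) => /has_derivE ->.
by apply/funext => x; rewrite hornerD hornerN !hornerM hornerC hornerXsubC; ring.
Qed.

Lemma schwartz_gauss a c : 0 < a -> schwartz (gauss a c).
Proof.
move=> a0; split.
  move=> n x; have [p ->] := derive1n_gauss a c n.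
  have dp : has_deriv (fun x => p.[x]) (fun x => p^`().[x]) by move=> y; exact: is_derive_poly.
  exact: has_deriv_derivable (has_derivM dp (has_deriv_gauss a c)).
move=> k n; have [p ->] := derive1n_gauss a c n.
have [_ [C hC]] := gauss_poly_lor c ('X^k * p) a0.
exists `|C| => x; have := hC x; rewrite hornerM hornerXn -mulrA => /le_trans; apply.
apply: le_trans (ler_norm _) _; rewrite normrM (ger0_norm (lor_ge0 x)).
by apply: ler_piMr (lor_le1 x) => //; exact: normr_ge0.
Qed.

Lemma has_deriv0_cst F f x y : has_deriv F f -> (forall z, f z = 0) -> F x = F y.
Proof. by move=> d f0; apply: is_derive_0_is_cst => z; rewrite -(f0 z); exact: d. Qed.
Arguments has_deriv0_cst {F f x} y.

Section Transform.
Variables (a c : R).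
Hypothesis a0 : 0 < a.
Let g := gauss a c.

Let t0 : tame g.
Proof. by have := gauss_poly_lor c 1 a0; apply: tame_ext => x; rewrite hornerC mul1r. Qed.
Let t1 : tame (fun x => x * g x).
Proof. by have := gauss_poly_lor c 'X a0; apply: tame_ext => x; rewrite hornerX. Qed.
Let t2 : tame (fun x => x ^+ 2 * g x).
Proof. by have := gauss_poly_lor c ('X^2) a0; apply: tame_ext => x; rewrite hornerXn. Qed.

Lemma tame_gauss : tame (gauss a c). Proof. exact: t0. Qed.

Let dg : has_deriv g (fun x => - (2 * a) * (x * g x) + 2 * a * c * g x).
Proof. by apply: (has_deriv_ext (has_deriv_gauss a c)) => x //; rewrite /g; ring. Qed.

Let tdg : tame (fun x => - (2 * a) * (x * g x) + 2 * a * c * g x).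
Proof. by apply: tameD; exact: tameZ. Qed.

Let a2 : 2 * a != 0 :> R. Proof. by rewrite mulf_neq0 ?pnatr_eq0 // gt_eqF. Qed.

Let fc1 x : fourier_cos (fun y => y * g y) x = c * fourier_cos g x - x / (2 * a) * fourier_sin g x.
Proof.
have := fourier_cos_deriv x dg t0 tdg.
rewrite fourier_cosD; [|exact/integZ/tame_integ|exact/integZ/tame_integ].
have Z b f : integ f -> fourier_cos (fun y => b * f y) x = b * fourier_cos f x.
  move=> hf; rewrite -RintegralZl //; last exact: integ_cos.
  by apply: eq_Rintegral => y _; ring.
rewrite !Z; [|exact: tame_integ|exact: tame_integ] => E.
have -> : x / (2 * a) * fourier_sin g x = (x * fourier_sin g x) / (2 * a) by ring.
by rewrite -E; field; rewrite gt_eqF.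
Qed.

Let fs1 x : fourier_sin (fun y => y * g y) x = c * fourier_sin g x + x / (2 * a) * fourier_cos g x.
Proof.
have := fourier_sin_deriv x dg t0 tdg.
rewrite fourier_sinD; [|exact/integZ/tame_integ|exact/integZ/tame_integ].
have Z b f : integ f -> fourier_sin (fun y => b * f y) x = b * fourier_sin f x.
  move=> hf; rewrite -RintegralZl //; last exact: integ_sin.
  by apply: eq_Rintegral => y _; ring.
rewrite !Z; [|exact: tame_integ|exact: tame_integ] => E.
have -> : x / (2 * a) * fourier_cos g x = - (- (x * fourier_cos g x)) / (2 * a) by rewrite opprK; ring.
by rewrite -E; field; rewrite gt_eqF.
Qed.

Let dC : has_deriv (fourier_cos g) (fun x => - (c * fourier_sin g x + x / (2 * a) * fourier_cos g x)).
Proof.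
by apply: (has_deriv_ext (has_deriv_fourier_cos (tame_integ t0) (tame_integ t1) (tame_integ t2))) => // x; rewrite fs1.
Qed.
Let dS : has_deriv (fourier_sin g) (fun x => c * fourier_cos g x - x / (2 * a) * fourier_sin g x).
Proof.
by apply: (has_deriv_ext (has_deriv_fourier_sin (tame_integ t0) (tame_integ t1) (tame_integ t2))) => // x; rewrite fc1.
Qed.

Let E x := expR ((4 * a)^-1 * x ^+ 2).
Let dE : has_deriv E (fun x => x / (2 * a) * E x).
Proof.
apply: (has_deriv_ext (has_deriv_expR (has_derivZ (4 * a)^-1 (has_derivM has_deriv_id has_deriv_id)))) => x.
  by rewrite /E expr2.
by rewrite /= /E expr2; congr (_ * _); field; rewrite gt_eqF.
Qed.

Let dcos : has_deriv (fun x => cos (c * x)) (fun x => - (c * sin (c * x))).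
Proof. exact: has_deriv_cosl. Qed.
Let dsin : has_deriv (fun x => sin (c * x)) (fun x => c * cos (c * x)).
Proof. exact: has_deriv_sinl. Qed.

(** As g' is a combination of g and y g, integration by parts leads to the closed linear system
    [dC], [dS]. It is a damping, undone by the factor [E], combined with a rotation of angular speed
    [c]. Undoing both leaves the two constants of [U] and [W], which are read off at x = 0. *)
Let U x : E x * (fourier_cos g x * cos (c * x) + fourier_sin g x * sin (c * x)) = \int[leb]_y g y.
Proof.
have d := has_derivM dE (has_derivD (has_derivM dC dcos) (has_derivM dS dsin)).
rewrite (has_deriv0_cst 0 d); last by move=> y; ring.
  rewrite !mulr0 sin0 cos0 mulr0 addr0 mulr1 /E expr0n mulr0 expR0 mul1r.
by apply: eq_Rintegral => y _; rewrite mul0r cos0 mul1r.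
Qed.

Let W x : fourier_sin g x * cos (c * x) - fourier_cos g x * sin (c * x) = 0.
Proof.
have d := has_derivM dE (has_derivB (has_derivM dS dcos) (has_derivM dC dsin)).
have : E x * (fourier_sin g x * cos (c * x) - fourier_cos g x * sin (c * x)) = 0.
  rewrite (has_deriv0_cst 0 d); last by move=> y; ring.
    rewrite !mulr0 sin0 cos0 mulr0 subr0 mulr1 /E expr0n mulr0 expR0 mul1r.
  rewrite /fourier_sin /Rintegral integral0_eq // => y _.
  by rewrite mul0r sin0 mul0r.
by move/eqP; rewrite mulf_eq0 gt_eqF ?expR_gt0 //= => /eqP.
Qed.

Let EK x : gauss (4 * a)^-1 0 x * E x = 1.
Proof. by rewrite /gauss /E subr0 -expRD addNr expR0. Qed.

Lemma fourier_cos_gauss x :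
  fourier_cos (gauss a c) x = (\int[leb]_y gauss a c y) * cos (c * x) * gauss (4 * a)^-1 0 x.
Proof.
rewrite -/g -(U x); have := W x; have := cos2Dsin2 (c * x); have := EK x.
move: (gauss _ 0 x) (E x) (fourier_cos g x) (fourier_sin g x) (cos _) (sin _) => G e C S co si h1 h2 h3.
transitivity (C * (co ^+ 2 + si ^+ 2)); first by rewrite h2 mulr1.
transitivity ((G * e) * (C * (co ^+ 2 + si ^+ 2) + si * (S * co - C * si))); last by ring.
by rewrite h3 h1; ring.
Qed.

Lemma gauss_le_lor x : gauss a c x <= lor (Num.sqrt a * x - Num.sqrt a * c).
Proof.
rewrite /gauss /lor expRN -mulrBr exprMn sqr_sqrtr ?(ltW a0) //.
by rewrite lef_pV2 ?posrE ?expR_gt0 ?expR_ge1Dx // ltr_pwDl // mulr_ge0 ?sqr_ge0 // ltW.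
Qed.

Lemma int_gauss_le : \int[leb]_x gauss a c x <= 4 / Num.sqrt a.
Proof.
have sa : 0 < Num.sqrt a by rewrite sqrtr_gt0.
have [h1 h2] := int_lor_scaled (- (Num.sqrt a * c)) sa.
apply: le_trans h2; apply: int_le => //; last exact: gauss_le_lor.
exact: tame_integ.
Qed.

(** On the interval of length 1 / (2 sqrt a) to the right of the centre the exponent is at least
    -1/4, so the Gaussian is at least 3/4; the contribution 3/8 of 1 / sqrt a exceeds one third. *)
Lemma int_gauss_ge : (3 * Num.sqrt a)^-1 <= \int[leb]_x gauss a c x.
Proof.
have sa : 0 < Num.sqrt a by rewrite sqrtr_gt0.
have := @int_ge_itv R g (fun=> 3 / 4) (fun x => 3 / 4 * x + 0) c (c + (2 * Num.sqrt a)^-1).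
rewrite !addr0 -mulrBr addrAC subrr add0r => H.
apply: le_trans (H _ _ _ _ _ _ _).
- have : 0 < (Num.sqrt a)^-1 by rewrite invr_gt0.
  by rewrite !invfM; move: (Num.sqrt a)^-1 => q; lra.
- by rewrite ltrDl invr_gt0 mulr_gt0.
- exact: cont_gauss.
- exact: tame_integ.
- by move=> x; exact: ltW (gauss_gt0 _ _ _).
- exact: contC.
- exact: has_deriv_affine.
- move=> x /andP[x1 x2]; apply/andP; split; first lra.
  rewrite /g /gauss; apply: le_trans (expR_ge1Dx _).
  have h : Num.sqrt a * (x - c) <= 2^-1.
    rewrite -(@mulfK _ (Num.sqrt a) _ 2^-1) ?gt_eqF // mulrAC mulrC -invfM.
    by rewrite ler_pM2r // lerBlDl.
  rewrite -{1}(sqr_sqrtr (ltW a0)) -exprMn.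
  have : 0 <= Num.sqrt a * (x - c) by rewrite mulr_ge0 ?subr_ge0 ?(ltW sa).
  by move: (_ * (x - c)) h => z; nra.
Qed.
End Transform.
End Gaussian.

(** * The upper Plancherel inequality *)

Section Plancherel.
Context {R : realType}.
Implicit Types (f g F G psi : R -> R) (a b c h B C K s x xi : R).
Notation leb := (@lebesgue_measure R).

Definition spectrum f xi : R := fourier_cos f xi ^+ 2 + fourier_sin f xi ^+ 2.

Lemma spectrum_ge0 f xi : 0 <= spectrum f xi.
Proof. by rewrite addr_ge0 ?sqr_ge0. Qed.

Lemma spectrum_meas f : integ f -> measurable_fun [set: R] (spectrum f).
Proof.
move=> hf; apply: measurable_funD; apply: measurable_funX.
- exact: fourier_cos_meas.
- exact: fourier_sin_meas.
Qed.

Lemma integ_mul_bounded f g K : integ f -> measurable_fun [set: R] g -> (forall x, `|g x| <= K) ->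
  integ (fun x => g x * f x).
Proof.
move=> hf mg hK; apply: (@integ_dom R _ (fun x => K * `|f x|)).
- by apply: measurable_funM => //; exact: integ_meas.
- by move=> x; rewrite normrM ler_wpM2r.
- by apply: integZ; exact: (integrable_norm hf).
Qed.

(* Multiplying the spectrum by a Gaussian makes Fubini's theorem applicable: the
   regularised integral is the quadratic form of the kernel k, bounded by Schur's test
   uniformly in a. *)
Section Regularised.
Variables (a : R) (f : R -> R).
Hypotheses (a0 : 0 < a) (tf : tame f).
Let g := gauss a 0.
Let K0 := \int[leb]_y gauss a 0 y.
Let b := (4 * a)^-1.
Let k x y := K0 * gauss b x y.

Let b0 : 0 < b. Proof. by rewrite invr_gt0 mulr_gt0. Qed.
Let ig : integ g. Proof. exact: (tame_integ (tame_gauss 0 a0)). Qed.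
Let if' : integ f. Proof. exact: tame_integ. Qed.
Let K0_ge0 : 0 <= K0. Proof. by apply: int_ge0 => x; exact: ltW (gauss_gt0 _ _ _). Qed.

Let gauss_le1 c x : gauss b c x <= 1.
Proof.
rewrite /gauss -[leRHS]expR0 ler_expR oppr_le0 mulr_ge0 ?sqr_ge0 //; exact: ltW.
Qed.

Let hk : bounded_kernel k.
Proof.
split.
  apply: measurable_funM => //.
  rewrite (_ : (fun z : R * R => gauss b z.1 z.2) =
     gauss b 0 \o (fun z : R * R => z.2 - z.1)); last first.
    by apply/funext => z; rewrite /gauss /= subr0.
  apply: (measurableT_comp (cont_meas (@cont_gauss R b 0))).
  by apply: measurable_funB; [exact: measurable_snd|exact: measurable_fst].
exists K0 => x y; rewrite /k normrM (ger0_norm K0_ge0) (gtr0_norm (gauss_gt0 _ _ _)).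
by rewrite ler_piMr.
Qed.

Let k_ge0 x y : 0 <= k x y.
Proof. by rewrite mulr_ge0 // ltW // gauss_gt0. Qed.

Let k_sym x y : k x y = k y x.
Proof. by rewrite /k /gauss -sqrrN opprB. Qed.

(** The two masses scale inversely: at most 4 / sqrt a for [K0], and at most 4 / sqrt b = 8 sqrt a
    for the other Gaussian. Their product 32 is independent of [a], which is what allows the
    regularisation to be removed later. *)
Let int_k x : integ (k x) /\ \int[leb]_y k x y <= 32.
Proof.
have igb : integ (gauss b x) := tame_integ (tame_gauss x b0).
split; first exact: integZ.
rewrite RintegralZl //.
apply: le_trans (ler_pM K0_ge0 _ (int_gauss_le 0 a0) (int_gauss_le x b0)) _.
  by apply: int_ge0 => y; exact: ltW (gauss_gt0 _ _ _).
have sa : 0 < Num.sqrt a by rewrite sqrtr_gt0.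
have -> : Num.sqrt b = (2 * Num.sqrt a)^-1.
  rewrite /b sqrtrV ?mulr_ge0 ?(ltW a0) // sqrtrM //; congr (_ * _)^-1.
  by rewrite (_ : 4 = 2 ^+ 2 :> R) ?sqrtr_sqr ?ger0_norm // -natrX.
rewrite invrK le_eqVlt; apply/orP; left; apply/eqP.
by move: (Num.sqrt a) sa => r r0; field; rewrite gt_eqF.
Qed.

Lemma plancherel_gauss : integ (fun xi => spectrum f xi * gauss a 0 xi) /\
  \int[leb]_xi (spectrum f xi * gauss a 0 xi) <= 32 * \int[leb]_x (f x ^+ 2).
Proof.
pose Cf := fourier_cos f; pose Sf := fourier_sin f.
have iC : integ (fun xi => Cf xi * g xi).
  exact: (integ_mul_bounded ig (fourier_cos_meas if') (fun x => fourier_cos_bound x if')).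
have iS : integ (fun xi => Sf xi * g xi).
  exact: (integ_mul_bounded ig (fourier_sin_meas if') (fun x => fourier_sin_bound x if')).
have iCC : integ (fun xi => Cf xi * (Cf xi * g xi)).
  exact: (integ_mul_bounded iC (fourier_cos_meas if') (fun x => fourier_cos_bound x if')).
have iSS : integ (fun xi => Sf xi * (Sf xi * g xi)).
  exact: (integ_mul_bounded iS (fourier_sin_meas if') (fun x => fourier_sin_bound x if')).
have E0 : (fun xi => spectrum f xi * gauss a 0 xi) =
    (fun xi => Cf xi * (Cf xi * g xi) + Sf xi * (Sf xi * g xi)).
  by apply/funext => xi; rewrite /spectrum -/(Cf xi) -/(Sf xi) -/(g xi); ring.
split; first by rewrite E0; exact: integD.
(* The formula for the cosine of a difference merges the two double transforms into one integral
   operator. Its kernel is the transform of [g] at y - x, which is again Gaussian. *)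
have inner x : fourier_cos (fun xi => Cf xi * g xi) x + fourier_sin (fun xi => Sf xi * g xi) x =
    \int[leb]_y (k x y * f y).
  have igc := integ_cos x ig; have igs := integ_sin x ig.
  have -> : fourier_cos (fun xi => Cf xi * g xi) x = \int[leb]_y (f y * fourier_cos (fun xi => cos (x * xi) * g xi) y).
    by rewrite -fourier_cos_swap //; apply: eq_Rintegral => y _; rewrite -/(Cf y); ring.
  have -> : fourier_sin (fun xi => Sf xi * g xi) x = \int[leb]_y (f y * fourier_sin (fun xi => sin (x * xi) * g xi) y).
    by rewrite -fourier_sin_swap //; apply: eq_Rintegral => y _; rewrite -/(Sf y); ring.
  rewrite -RintegralD //; last 2 first.
  - by apply: (kernel_integ kernel_cos).
  - by apply: (kernel_integ kernel_sin).
  apply: eq_Rintegral => y _; rewrite -mulrDr mulrC; congr (_ * _).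
  have -> : k x y = fourier_cos g (y - x).
    rewrite fourier_cos_gauss // mul0r cos0 mulr1 /k; congr (_ * _).
    by rewrite /gauss subr0.
  rewrite -RintegralD //; [|exact: integ_cos|exact: integ_sin].
  by apply: eq_Rintegral => xi _; rewrite mulrBl cosB; ring.
have i1 : integ (fun x => f x * fourier_cos (fun xi => Cf xi * g xi) x).
  by apply: (kernel_integ kernel_cos).
have i2 : integ (fun x => f x * fourier_sin (fun xi => Sf xi * g xi) x).
  by apply: (kernel_integ kernel_sin).
have -> : \int[leb]_xi (spectrum f xi * gauss a 0 xi) = \int[leb]_x (f x * \int[leb]_y (k x y * f y)).
  rewrite E0 (RintegralD measurableT iCC iSS) (fourier_cos_swap if' iC) (fourier_sin_swap if' iS).
  rewrite -(RintegralD measurableT i1 i2).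
  by apply: eq_Rintegral => x _; rewrite -mulrDr inner.
have if2 : integ (fun x => f x ^+ 2).
  by have := tame_integ (tame_mul tf tf); apply: integ_ext => x; rewrite expr2.
(* Schur's test: 2 f(x) f(y) <= f(x)^2 + f(y)^2 splits the quadratic form. One half is bounded by
   the row mass of [k]; the other is half the integral of [h], which Tonelli's theorem reduces to
   the column mass. *)
pose h x := \int[leb]_y (k x y * f y ^+ 2).
have h0 x : 0 <= h x by apply: int_ge0 => y; rewrite mulr_ge0 ?sqr_ge0.
have hT : (\int[leb]_x (h x)%:E <= (32 * \int[leb]_x (f x ^+ 2))%:E)%E.
  have -> : (\int[leb]_x (h x)%:E = \int[leb]_x \int[leb]_y (k x y * f y ^+ 2)%:E)%E.
    apply: eq_integral => x _; rewrite -int_EFin //.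
    exact: (kernel_row_integ x hk if2).
  have mk2 : measurable_fun [set: R * R] (fun z => k z.1 z.2 * f z.2 ^+ 2).
    apply: measurable_funM; first exact: hk.1.
    by apply: (measurableT_comp (integ_meas if2)); exact: measurable_snd.
  have := @fubini_tonelli _ _ _ _ R leb leb (fun z => (k z.1 z.2 * f z.2 ^+ 2)%:E) => /= ->; last 2 first.
  - exact/measurable_EFinP.
  - by move=> z; rewrite lee_fin mulr_ge0 ?sqr_ge0.
  apply: (@le_trans _ _ (\int[leb]_y (32 * f y ^+ 2)%:E)%E).
    apply: ge0_le_integral => //.
    - by move=> y _; apply: integral_ge0 => x _; rewrite lee_fin mulr_ge0 ?sqr_ge0.
    - apply: (@measurable_fun_fubini_tonelli_G _ _ _ _ _ leb (fun z => (k z.1 z.2 * f z.2 ^+ 2)%:E)) => //.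
        exact/measurable_EFinP.
      by move=> z; rewrite lee_fin mulr_ge0 ?sqr_ge0.
    - by apply/measurable_EFinP; exact: integ_meas (integZ _ if2).
    - move=> y _; have [k1 k2] := int_k y.
      have e : (fun x => k x y * f y ^+ 2) = (fun x => f y ^+ 2 * k y x).
        by apply/funext => x; rewrite k_sym mulrC.
      rewrite (@int_EFin R (fun x => k x y * f y ^+ 2)); last by rewrite e; exact: integZ.
      by rewrite lee_fin e RintegralZl // mulrC ler_wpM2r ?sqr_ge0.
  rewrite (@int_EFin R (fun y => 32 * f y ^+ 2)); last exact: integZ.
  by rewrite RintegralZl.
have ih : integ h.
  apply/integrableP; split; first by apply/measurable_EFinP; exact: kernel_meas.
  rewrite (_ : (\int[leb]_x `|(EFin \o h) x|)%E = (\int[leb]_x (h x)%:E)%E).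
    by rewrite (le_lt_trans hT) ?ltry.
  by apply: eq_integral => x _ /=; rewrite ger0_norm.
have hI : \int[leb]_x h x <= 32 * \int[leb]_x (f x ^+ 2) by rewrite -lee_fin -int_EFin.
have iA : integ (fun x => 16 * f x ^+ 2 + 2^-1 * h x) by apply: integD; exact: integZ.
apply: (@le_trans _ _ (\int[leb]_x (16 * f x ^+ 2 + 2^-1 * h x))).
  apply: int_le => //; first exact: kernel_integ.
  move=> x; have [k1 k2] := int_k x; have kr := kernel_row_integ x hk if2.
  have krf := kernel_row_integ x hk if'.
  apply: (@le_trans _ _ (\int[leb]_y (2^-1 * f x ^+ 2 * k x y + 2^-1 * (k x y * f y ^+ 2)))).
    rewrite -RintegralZl //; apply: int_le; [exact: integZ|by apply: integD; exact: integZ|].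
    by move=> y; have := mulr_ge0 (k_ge0 x y) (sqr_ge0 (f x - f y)); lra.
  rewrite RintegralD //; [|exact: integZ|exact: integZ].
  rewrite (RintegralZl (2^-1) measurableT kr) (RintegralZl (2^-1 * f x ^+ 2) measurableT k1).
  rewrite -/(h x) lerD2r.
  have := sqr_ge0 (f x); move: (f x ^+ 2) (\int[leb]_y k x y) k2 => p q; nra.
rewrite RintegralD //; [|exact: integZ|exact: integZ].
rewrite !RintegralZl //; lra.
Qed.

End Regularised.

(** The Gaussians with a = 1 / (n + 1) increase to 1 pointwise, and the bound of [plancherel_gauss]
    does not depend on [a], so monotone convergence applies. *)
Lemma plancherel_le f : tame f ->
  (\int[leb]_xi (spectrum f xi)%:E <= (32 * \int[leb]_x (f x ^+ 2))%:E)%E.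
Proof.
move=> tf; have if' := tame_integ tf.
pose u n xi := (spectrum f xi * gauss n.+1%:R^-1 0 xi)%:E.
have a0 n : 0 < n.+1%:R^-1 :> R by rewrite invr_gt0 ltr0n.
have mu n : measurable_fun [set: R] (u n).
  apply/measurable_EFinP; apply: measurable_funM; first exact: spectrum_meas.
  by apply: cont_meas; exact: cont_gauss.
have u0 n x : [set: R] x -> (0 <= u n x)%E.
  by move=> _; rewrite lee_fin mulr_ge0 ?spectrum_ge0 // ltW // gauss_gt0.
have ui x : [set: R] x -> {homo u^~ x : n m / (n <= m)%N >-> (n <= m)%E}.
  move=> _ n m nm; rewrite lee_fin ler_wpM2l ?spectrum_ge0 // /gauss ler_expR lerN2.
  by rewrite ler_wpM2r ?sqr_ge0 // lef_pV2 ?posrE ?ltr0n // ler_nat.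
have := @cvg_monotone_convergence _ _ _ leb _ measurableT u mu u0 ui.
have -> : (\int[leb]_x (fun x0 => limn (u^~ x0)) x = \int[leb]_x (spectrum f x)%:E)%E.
  apply: eq_integral => x _; apply: cvg_lim => //.
  apply: cvg_EFin; first exact: nearW.
  rewrite -[X in _ --> X]mulr1; apply: cvgM; first exact: cvg_cst.
  rewrite -[X in _ --> X]expR0; apply: continuous_cvg; first exact: continuous_expR.
  rewrite -[X in _ --> X]oppr0; apply: cvgN.
  rewrite -[X in _ --> X](mul0r ((x - 0) ^+ 2)); apply: cvgM; last exact: cvg_cst.
  exact: cvg_harmonic.
move=> lim; apply: cvge_le lim; apply: nearW => n.
have [i1 i2] := plancherel_gauss (a0 n) tf.
by rewrite /u (int_EFin i1) lee_fin.
Qed.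

End Plancherel.

(** * Sobolev norms *)

Section Sobolev.
Context {R : realType}.
Implicit Types (f g F G psi : R -> R) (a b c h B C K M N s x xi : R).
Notation leb := (@lebesgue_measure R).

(** The square of the usual Sobolev weight, which makes [energy s] the squared H^s norm computed
    from the classical transform. *)
Definition weight s xi : R := (1 + xi ^+ 2) `^ s.
Definition energy s f : \bar R := (\int[leb]_xi (weight s xi * spectrum f xi)%:E)%E.

Lemma sqr1_gt0 x : 0 < 1 + x ^+ 2. Proof. by rewrite ltr_pwDl ?sqr_ge0. Qed.
Lemma sqr1_ge1 x : 1 <= 1 + x ^+ 2. Proof. by rewrite lerDl sqr_ge0. Qed.

Lemma weight_gt0 s x : 0 < weight s x. Proof. by rewrite powR_gt0 // sqr1_gt0. Qed.

Lemma weight_cont s : continuous (weight s).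
Proof.
have -> : weight s = (fun x => expR (s * ln (1 + x ^+ 2))).
  by apply/funext => x; rewrite /weight /powR gt_eqF // sqr1_gt0.
have dl : has_deriv (fun x => ln (1 + x ^+ 2)) (fun x => 2 * x / (1 + x ^+ 2)).
  move=> x; have h := is_derive1_ln (sqr1_gt0 x).
  by have := @is_derive1_comp R (@ln R) _ x _ _ h (has_deriv_sqr1 x); rewrite mulrC.
exact: has_deriv_cont (has_deriv_expR (has_derivZ s dl)).
Qed.

Lemma weight_meas s : measurable_fun [set: R] (weight s).
Proof. by apply: cont_meas; exact: weight_cont. Qed.

Lemma energy_meas s f : integ f -> measurable_fun [set: R] (fun xi => (weight s xi * spectrum f xi)%:E).
Proof.
move=> hf; apply/measurable_EFinP; apply: measurable_funM; first exact: weight_meas.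
exact: spectrum_meas.
Qed.

Lemma Lnorm2_sqr (u : R -> R) : ('N[leb]_2%:E[EFin \o u] `^ 2 = \int[leb]_x (u x ^+ 2)%:E)%E.
Proof.
rewrite poweR_Lnorm //; apply: eq_integral => x _.
rewrite (_ : `|(EFin \o u) x|%E = `|u x|%:E) //.
by rewrite poweR_EFin powR_mulrn // -normrX ger0_norm ?sqr_ge0.
Qed.

Lemma Lnorm2_le (u : R -> R) N : 0 <= N -> (\int[leb]_x (u x ^+ 2)%:E <= (N ^+ 2)%:E)%E ->
  ('N[leb]_2%:E[EFin \o u] <= N%:E)%E.
Proof.
move=> N0; rewrite -Lnorm2_sqr => h.
have := @gt0_ler_poweR R 2^-1 _ _ _ _ _ h; rewrite -poweRrM mulfV // poweRe1 ?Lnorm_ge0 //.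
rewrite poweR_EFin powR12_sqrt ?sqr_ge0 // sqrtr_sqr ger0_norm //; apply.
- by rewrite invr_ge0.
- by rewrite in_itv /= poweR_ge0 leey.
- by rewrite in_itv /= leey andbT lee_fin sqr_ge0.
Qed.

Lemma Lnorm2_lt (u : R -> R) N : ('N[leb]_2%:E[EFin \o u] < N%:E)%E ->
  (\int[leb]_x (u x ^+ 2)%:E <= (N ^+ 2)%:E)%E.
Proof.
move=> h; have N0 : 0 <= N by rewrite -lee_fin (le_trans (Lnorm_ge0 _ _ _) (ltW h)).
rewrite -Lnorm2_sqr -powR_mulrn // -poweR_EFin.
apply: gt0_ler_poweR => //; last exact: ltW.
- by rewrite in_itv /= leey andbT Lnorm_ge0.
- by rewrite in_itv /= leey andbT lee_fin.
Qed.

Lemma powR_half_sqr a s : (a `^ (s / 2)) ^+ 2 = a `^ s.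
Proof. by rewrite -(powR_mulrn 2) ?powR_ge0 // -powRrM mulfVK. Qed.

Lemma sqr_weighted s xi (A B : R) :
  ((1 + xi ^+ 2) `^ (s / 2) * Num.sqrt (A ^+ 2 + B ^+ 2)) ^+ 2 = weight s xi * (A ^+ 2 + B ^+ 2).
Proof.
rewrite exprMn sqr_sqrtr ?addr_ge0 ?sqr_ge0 //; congr (_ * _).
exact: powR_half_sqr.
Qed.

(** An infimum is bounded by any one of its members, and the classical transform is one: its duality
    with Schwartz functions is Fubini's theorem. *)
Lemma Hs_norm_le s f N : tame f -> 0 <= N -> (energy s f <= (N ^+ 2)%:E)%E ->
  (Hs_norm s f <= N%:E)%E.
Proof.
move=> tf N0 hE; have if' := tame_integ tf.
apply: ge_ereal_inf; exists (weighted_L2_norm s (fourier_cos f) (fun x => - fourier_sin f x)).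
  exists (fourier_cos f), (fun x => - fourier_sin f x); split=> //; split.
  - by apply: open_integrable_locally => //; exact: openT.
  - exact: fourier_cos_meas.
  - by apply: measurable_funN; exact: fourier_sin_meas.
  - move=> psi spsi _ _.
    have ipsi : integ psi.
      apply: tame_integ; split.
        by apply: has_deriv_cont (derivable_has_deriv (spsi.1 0%N)).
      have [C0 h0] := spsi.2 0%N 0%N; have [C2 h2] := spsi.2 2%N 0%N.
      exists (C0 + C2) => x; rewrite ler_pdivlMr ?sqr1_gt0 //.
      have := h0 x; have := h2 x; rewrite expr0 mul1r /= normrM (ger0_norm (sqr_ge0 x)).
      lra.
    split; first exact: fourier_cos_swap.
    rewrite -fourier_sin_swap // -[RHS]mulN1r -RintegralZl //; last first.
      exact: (integ_mul_bounded ipsi (fourier_sin_meas if') (fun x => fourier_sin_bound x if')).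
    by apply: eq_Rintegral => x _; ring.
apply: Lnorm2_le => //.
by under eq_integral do rewrite sqr_weighted sqrrN.
Qed.

(** Whichever transform the infimum supplies, it can be tested against [psi], and the inequality of
    Hoelder with the weights of exponents s/2 and -s/2 bounds the result. For real [psi] the cosine
    pairing sees only [Fre], which the full modulus dominates. *)
Lemma Hs_norm_duality s f psi N B : tame f -> 0 <= B -> schwartz psi -> integ psi ->
  (\int[leb]_xi (weight (- s) xi * psi xi ^+ 2)%:E <= (B ^+ 2)%:E)%E ->
  (Hs_norm s f < N%:E)%E ->
  `|\int[leb]_x (f x * fourier_cos psi x)| <= N * B.
Proof.
move=> tf B0 spsi ipsi hpsi hN; have if' := tame_integ tf.
have [_ [Fre [Fim [[_ m1 m2 H] ->]]] hlt] := ereal_inf_lt hN.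
have i1 : integ (fun x => f x * fourier_cos psi x).
  have := integ_mul_bounded if' (fourier_cos_meas ipsi) (fun x => fourier_cos_bound x ipsi).
  by apply: integ_ext => x; rewrite mulrC.
have i2 : integ (fun x => f x * fourier_sin psi x).
  have := integ_mul_bounded if' (fourier_sin_meas ipsi) (fun x => fourier_sin_bound x ipsi).
  by apply: integ_ext => x; rewrite mulrC.
have [e _] := H psi spsi i1 i2.
have N0 : 0 <= N by rewrite -lee_fin (le_trans (Lnorm_ge0 _ _ _) (ltW hlt)).
have hW := Lnorm2_lt hlt.
have mpsi := integ_meas ipsi.
pose u xi := weight (s / 2) xi * Fre xi; pose w xi := weight (- s / 2) xi * psi xi.
have mu : measurable_fun [set: R] u by apply: measurable_funM => //; exact: weight_meas.
have mw : measurable_fun [set: R] w by apply: measurable_funM => //; exact: weight_meas.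
have hu : ('N[leb]_2%:E[EFin \o u] <= N%:E)%E.
  apply: Lnorm2_le => //; apply: le_trans hW; apply: ge0_le_integral => //.
  - by move=> x _; rewrite lee_fin sqr_ge0.
  - by apply/measurable_EFinP; apply: measurable_funX.
  - apply/measurable_EFinP; under eq_fun do rewrite sqr_weighted.
    apply: measurable_funM; first exact: weight_meas.
    by apply: measurable_funD; exact: measurable_funX.
  - move=> x _; rewrite lee_fin sqr_weighted /u exprMn /weight.
    by rewrite powR_half_sqr ler_wpM2l ?powR_ge0 // lerDl sqr_ge0.
have hw : ('N[leb]_2%:E[EFin \o w] <= B%:E)%E.
  apply: Lnorm2_le => //; apply: le_trans hpsi.
  rewrite le_eqVlt; apply/orP; left; apply/eqP; apply: eq_integral => x _; congr EFin.
  by rewrite /w exprMn /weight powR_half_sqr.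
have uw : (u \* w)%R = (fun xi => Fre xi * psi xi).
  apply/funext => x; rewrite /u /w /= mulrACA /weight mulNr powRN mulfV ?mul1r //.
  by rewrite gt_eqF // powR_gt0 // sqr1_gt0.
have := @hoelder _ _ R leb u w 2 2 mu mw _ _ _; rewrite uw => /(_ _ _ _) hh.
have hI : (\int[leb]_x `|Fre x * psi x|%:E <= (N * B)%:E)%E.
  apply: le_trans (_ : ('N[leb]_2%:E[EFin \o u] * 'N[leb]_2%:E[EFin \o w] <= _)%E); last first.
    by rewrite EFinM lee_pmul // Lnorm_ge0.
  have p2 : 0 < 2 :> R by [].
  have hs : 2^-1 + 2^-1 = 1 :> R by lra.
  by have := hh p2 p2 hs; rewrite Lnorm1.
have iFp : integ (fun x => Fre x * psi x).
  apply/integrableP; split; first by apply/measurable_EFinP; apply: measurable_funM.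
  by apply: le_lt_trans hI _; rewrite ltry.
rewrite -e; apply: le_trans (le_normr_Rintegral measurableT iFp) _.
by rewrite -lee_fin -int_norm_EFin.
Qed.

Lemma energy_dom s f (w : R -> R) B : integ f -> measurable_fun [set: R] w ->
  (forall xi, weight s xi * spectrum f xi <= w xi) -> (\int[leb]_xi (w xi)%:E <= B%:E)%E ->
  (energy s f <= B%:E)%E.
Proof.
move=> hf mw hw; apply: le_trans; apply: ge0_le_integral => //.
- by move=> x _; rewrite lee_fin mulr_ge0 ?spectrum_ge0 // ltW // weight_gt0.
- exact: energy_meas.
- exact/measurable_EFinP.
- by move=> x _; rewrite lee_fin.
Qed.

Lemma integral_combine a b (u w : R -> R) A B : 0 <= a -> 0 <= b ->
  (forall x, 0 <= u x) -> (forall x, 0 <= w x) ->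
  measurable_fun [set: R] u -> measurable_fun [set: R] w ->
  (\int[leb]_x (u x)%:E <= A%:E)%E -> (\int[leb]_x (w x)%:E <= B%:E)%E ->
  (\int[leb]_x (a * u x + b * w x)%:E <= (a * A + b * B)%:E)%E.
Proof.
move=> a0 b0 u0 w0 mu mw hA hB.
under eq_integral do rewrite EFinD !EFinM.
rewrite ge0_integralD //; last 4 first.
- by move=> x _; rewrite mule_ge0 // lee_fin.
- by apply: measurable_funeM; exact/measurable_EFinP.
- by move=> x _; rewrite mule_ge0 // lee_fin.
- by apply: measurable_funeM; exact/measurable_EFinP.
rewrite !ge0_integralZl_EFin //; try (by move=> x _; rewrite lee_fin); try exact/measurable_EFinP.
by rewrite EFinD !EFinM leeD // lee_wpmul2l.
Qed.

Lemma energyD s f g A B : integ f -> integ g -> (energy s f <= A%:E)%E -> (energy s g <= B%:E)%E ->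
  (energy s (fun x => f x + g x)%R <= (2 * A + 2 * B)%:E)%E.
Proof.
move=> hf hg eA eB.
apply: (energy_dom (integD hf hg) (w := fun xi => 2 * (weight s xi * spectrum f xi) + 2 * (weight s xi * spectrum g xi))).
- by apply: measurable_funD; apply: measurable_funM => //; apply/measurable_EFinP; exact: energy_meas.
- move=> xi; rewrite mulrCA (mulrCA 2) -mulrDr ler_wpM2l ?(ltW (weight_gt0 _ _)) //.
  rewrite /spectrum fourier_cosD // fourier_sinD //.
  have := sqr_ge0 (fourier_cos f xi - fourier_cos g xi).
  have := sqr_ge0 (fourier_sin f xi - fourier_sin g xi); lra.
have nn u x : 0 <= weight s x * spectrum u x.
  by rewrite mulr_ge0 ?spectrum_ge0 // ltW // weight_gt0.
have mm u (hu : integ u) : measurable_fun [set: R] (fun xi => weight s xi * spectrum u xi).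
  by apply/measurable_EFinP; exact: energy_meas.
exact: integral_combine (nn f) (nn g) (mm f hf) (mm g hg) eA eB.
Qed.

Lemma weight_le1 s x : s <= 0 -> weight s x <= 1.
Proof.
move=> s0; rewrite /weight -[leRHS](powRr0 (1 + x ^+ 2)).
by apply: ler_powR => //; exact: sqr1_ge1.
Qed.

Lemma weight_le_sqr1 s x : s <= 1 -> weight s x <= 1 + x ^+ 2.
Proof.
move=> s1; rewrite /weight -[leRHS]powRr1 ?(ltW (sqr1_gt0 x)) //.
by apply: ler_powR => //; exact: sqr1_ge1.
Qed.

Lemma spectrum_deriv F f xi : has_deriv F f -> tame F -> tame f ->
  spectrum f xi = xi ^+ 2 * spectrum F xi.
Proof.
move=> d tF tf; rewrite /spectrum (fourier_cos_deriv _ d) // (fourier_sin_deriv _ d) //; ring.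
Qed.

Lemma energy_neg s f : tame f -> s <= 0 -> (energy s f <= (32 * \int[leb]_x (f x ^+ 2))%:E)%E.
Proof.
move=> tf s0; apply: (energy_dom (tame_integ tf) (spectrum_meas (tame_integ tf)) _ (plancherel_le tf)).
by move=> xi; rewrite ler_piMl ?spectrum_ge0 // weight_le1.
Qed.

Lemma energy_pos s f g : has_deriv f g -> tame f -> tame g -> s <= 1 ->
  (energy s f <= (32 * (\int[leb]_x (f x ^+ 2) + \int[leb]_x (g x ^+ 2)))%:E)%E.
Proof.
move=> d tf tg s1.
have mf := spectrum_meas (tame_integ tf); have mg := spectrum_meas (tame_integ tg).
apply: (energy_dom (tame_integ tf) (w := fun xi => 1 * spectrum f xi + 1 * spectrum g xi)).
- by apply: measurable_funD; apply: measurable_funM.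
- move=> xi; rewrite (spectrum_deriv _ d) // !mul1r -[X in X + _]mul1r -mulrDl.
  by rewrite ler_wpM2r ?spectrum_ge0 // weight_le_sqr1.
have := integral_combine ler01 ler01 (spectrum_ge0 f) (spectrum_ge0 g) mf mg (plancherel_le tf) (plancherel_le tg).
by rewrite !mul1r mulrDr.
Qed.

Lemma powR_le_1sqr (y p : R) : 0 <= y -> 0 <= p <= 2 -> y `^ p <= 1 + y ^+ 2.
Proof.
move=> y0 /andP[p0 p2]; have [y1|y1] := leP y 1.
  apply: (@le_trans _ _ 1); last by rewrite lerDl sqr_ge0.
  have p1 : 1 `^ p = 1 :> R by rewrite powR1.
  by rewrite -[leRHS]p1; apply: ge0_ler_powR => //; rewrite nnegrE.
apply: (@le_trans _ _ (y ^+ 2)); last by rewrite lerDr.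
by rewrite -powR_mulrn //; apply: ler_powR => //; exact: ltW.
Qed.

(* With f = F' and g = F'', weight s * xi^2 is at most 3 K + 2 K xi^4 / N^4, where
   K = N^(2s+2); this is sharp for F concentrated at |xi| ~ N. *)
Lemma energy_high s N F f g : has_deriv F f -> has_deriv f g -> tame F -> tame f -> tame g ->
  -1 <= s <= 1 -> 1 <= N ->
  (energy s f <= (96 * N `^ (2 * s + 2) *
     (\int[leb]_x (F x ^+ 2) + N ^- 4 * \int[leb]_x (g x ^+ 2)))%:E)%E.
Proof.
move=> d1 d2 tF tf tg /andP[s1 s2] N1.
have N0 : 0 < N by exact: lt_le_trans N1.
have mF := spectrum_meas (tame_integ tF); have mg := spectrum_meas (tame_integ tg).
set K := N `^ (2 * s + 2).
have K0 : 0 <= K by exact: powR_ge0.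
have iN : 0 <= N ^- 4 by rewrite invr_ge0 exprn_ge0 // ltW.
apply: (energy_dom (tame_integ tf) (w := fun xi => 3 * K * spectrum F xi + 2 * K * N ^- 4 * spectrum g xi)).
- by apply: measurable_funD; apply: measurable_funM.
- move=> xi; rewrite (spectrum_deriv _ d2) // (spectrum_deriv _ d1) //.
  rewrite (_ : 3 * K * spectrum F xi + 2 * K / N ^+ 4 * (xi ^+ 2 * (xi ^+ 2 * spectrum F xi)) =
    (3 * K + 2 * K / N ^+ 4 * (xi ^+ 2 * xi ^+ 2)) * spectrum F xi); last by ring.
  rewrite (mulrA (weight s xi) (xi ^+ 2)).
  apply: ler_wpM2r; first exact: spectrum_ge0.
  have h1 : weight s xi * xi ^+ 2 <= weight (s + 1) xi.
    rewrite /weight powRD; last by apply/implyP => _; rewrite gt_eqF ?sqr1_gt0.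
    rewrite powRr1 ?(ltW (sqr1_gt0 xi)) //.
    by apply: ler_wpM2l; [exact: powR_ge0|rewrite lerDr].
  apply: le_trans h1 _.
  (* Scaling by N^2 turns the weight into K y^(s+1) with 0 <= s + 1 <= 2, and y^(s+1) <= 1 + y^2.
     Since N >= 1, y^2 is at most 2 + 2 xi^4 / N^4. *)
  pose y := (1 + xi ^+ 2) / N ^+ 2.
  have y0 : 0 <= y by rewrite divr_ge0 ?sqr_ge0 // ltW // sqr1_gt0.
  have e : 1 + xi ^+ 2 = N ^+ 2 * y by rewrite /y mulrC divfK // expf_neq0 // gt_eqF.
  have -> : weight (s + 1) xi = K * y `^ (s + 1).
    rewrite /weight e powRM ?sqr_ge0 // -powR_mulrn ?(ltW N0) // -powRrM; congr (N `^ _ * _); ring.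
  apply: le_trans (ler_wpM2l K0 (powR_le_1sqr y0 _)) _; first by apply/andP; split; lra.
  have -> : 3 * K + 2 * K / N ^+ 4 * (xi ^+ 2 * xi ^+ 2) = K * (3 + 2 * (xi ^+ 4 / N ^+ 4)) by rewrite (exprD xi 2 2); ring.
  apply: ler_wpM2l => //.
  have -> : y ^+ 2 = (1 + xi ^+ 2) ^+ 2 / N ^+ 4 by rewrite /y expr_div_n -exprM.
  have n4 : (N ^+ 4)^-1 <= 1 by rewrite invf_le1 ?exprn_gt0 // exprn_ege1.
  have := iN; move: ((N ^+ 4)^-1) n4 => q q1 q0.
  have := sqr_ge0 (xi ^+ 2 - 1); have := sqr_ge0 xi; have e4 : xi ^+ 4 = xi ^+ 2 ^+ 2 by rewrite -exprM.
  rewrite e4; move: (xi ^+ 2) => z; nra.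
apply: le_trans (integral_combine _ _ (spectrum_ge0 F) (spectrum_ge0 g) mF mg (plancherel_le tF) (plancherel_le tg)) _.
- by rewrite mulr_ge0.
- by rewrite !mulr_ge0.
have i0 f' : 0 <= \int[leb]_x (f' x ^+ 2) by apply: int_ge0 => x; exact: sqr_ge0.
rewrite lee_fin; have := mulr_ge0 K0 (mulr_ge0 iN (i0 g)); lra.
Qed.

End Sobolev.

(** * Smoothness of rational expressions *)

Section Expressions.
Context {R : realType}.
Implicit Types (rho : nat -> R) (P : (nat -> R) -> Prop).

(** Syntax for rational functions of real variables. If each variable has a derivative that is again
    an expression, the evaluated functions are closed under differentiation, and statements about
    all derivatives become inductions on terms. *)
Inductive expr :=
| ECst of R
| EVar of nat
| EAdd of expr & expr
| EMul of expr & expr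
| EInv of expr.

Fixpoint eeval rho e : R :=
  match e with
  | ECst c => c
  | EVar n => rho n
  | EAdd a b => eeval rho a + eeval rho b
  | EMul a b => eeval rho a * eeval rho b
  | EInv a => (eeval rho a)^-1
  end.

Definition EOpp a := EMul (ECst (-1)) a.
Definition ESub a b := EAdd a (EOpp b).

Fixpoint deriv_expr (d : nat -> expr) e :=
  match e with
  | ECst _ => ECst 0
  | EVar n => d n
  | EAdd a b => EAdd (deriv_expr d a) (deriv_expr d b)
  | EMul a b => EAdd (EMul (deriv_expr d a) b) (EMul a (deriv_expr d b))
  | EInv a => EOpp (EMul (deriv_expr d a) (EMul (EInv a) (EInv a)))
  end.

(** Every denominator has one and the same positive lower bound on all of [P], because the resulting
    estimates must be uniform in the parameters. The value 1/4 suits the denominators of both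
    breathers and solitons. *)
Fixpoint guarded P e : Prop :=
  match e with
  | ECst _ | EVar _ => True
  | EAdd a b | EMul a b => guarded P a /\ guarded P b
  | EInv a => guarded P a /\ forall rho, P rho -> 4^-1 <= `|eeval rho a|
  end.

(** Differentiating an inverse only inverts the same subterm again, so no new denominators arise
    apart from those of the rules [d]. *)
Lemma guarded_deriv P d e : (forall n, guarded P (d n)) -> guarded P e ->
  guarded P (deriv_expr d e).
Proof.
move=> hd; elim: e => //= [a iha b ihb [ga gb]|a iha b ihb [ga gb]|a iha [ga ha]].
- by split; [exact: iha|exact: ihb].
- by do !split => //; [exact: iha|exact: ihb].
- by do !split => //; exact: iha.
Qed.

Lemma eval_has_deriv P (rho : R -> nat -> R) d e : (forall x, P (rho x)) ->
  (forall n, has_deriv (fun x => rho x n) (fun x => eeval (rho x) (d n))) -> guarded P e ->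
  has_deriv (fun x => eeval (rho x) e) (fun x => eeval (rho x) (deriv_expr d e)).
Proof.
move=> hP hd; elim: e => /= [c _|n _|a iha b ihb [ga gb]|a iha b ihb [ga gb]|a iha [ga ha]].
- exact: has_deriv_cst.
- exact: hd.
- by apply: has_derivD; [exact: iha|exact: ihb].
- by apply: has_derivM; [exact: iha|exact: ihb].
- have h0 x : eeval (rho x) a != 0.
    by rewrite -normr_gt0 (lt_le_trans _ (ha _ (hP x))) // invr_gt0.
  apply: (has_deriv_ext (has_derivV h0 (iha ga))) => x //.
  by rewrite expr2 invfM; ring.
Qed.

Lemma eeval_continuous P (rho : R * R -> nat -> R) e : (forall z, P (rho z)) ->
  (forall n, continuous (fun z => rho z n)) -> guarded P e ->
  continuous (fun z => eeval (rho z) e).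
Proof.
move=> hP hc; elim: e => /= [c _|n _|a iha b ihb [ga gb]|a iha b ihb [ga gb]|a iha [ga ha]].
- by move=> z; exact: cvg_cst.
- exact: hc.
- by move=> z; apply: continuousD; [exact: iha|exact: ihb].
- by move=> z; apply: continuousM; [exact: iha|exact: ihb].
- move=> z; apply: continuousV; last exact: iha.
  by rewrite -normr_gt0 (lt_le_trans _ (ha _ (hP z))) // invr_gt0.
Qed.

(** By [guarded_deriv] every mixed partial derivative is the evaluation of another guarded
    expression, so continuity and differentiability of such evaluations cover all words at once. *)
Lemma eval_smooth2 P (rho : R -> R -> nat -> R) dt dx e : (forall t x, P (rho t x)) ->
  (forall n, continuous (fun z : R * R => rho z.1 z.2 n)) ->
  (forall n, guarded P (dt n)) -> (forall n, guarded P (dx n)) ->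
  (forall n x, has_deriv (fun t => rho t x n) (fun t => eeval (rho t x) (dt n))) ->
  (forall n t, has_deriv (fun x => rho t x n) (fun x => eeval (rho t x) (dx n))) ->
  guarded P e -> smooth2 (fun t x => eeval (rho t x) e).
Proof.
move=> hP hc gt gx ht hx ge w.
have [e' [ge' ->]] : exists e', guarded P e' /\
    partials w (fun t x => eeval (rho t x) e) = (fun t x => eeval (rho t x) e').
  elim: w => [|b w [e' [ge' IH]]] /=; first by exists e.
  rewrite IH; case: b.
  - exists (deriv_expr dt e'); split; first exact: guarded_deriv.
    apply/funext => t; apply/funext => x; rewrite /partial_t.
    have := @eval_has_deriv P (fun t => rho t x) dt e' (fun t => hP t x) (fun n => ht n x) ge'.
    by move=> /has_derivE ->.
  - exists (deriv_expr dx e'); split; first exact: guarded_deriv.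
    apply/funext => t; apply/funext => x; rewrite /partial_x.
    have := @eval_has_deriv P (fun x => rho t x) dx e' (fun x => hP t x) (fun n => hx n t) ge'.
    by move=> /has_derivE ->.
split; first by apply: (@eeval_continuous P (fun z => rho z.1 z.2)) => // z; exact: hP.
move=> t x; split.
- have := @eval_has_deriv P (fun t => rho t x) dt e' (fun t => hP t x) (fun n => ht n x) ge'.
  exact: has_deriv_derivable.
- have := @eval_has_deriv P (fun x => rho t x) dx e' (fun x => hP t x) (fun n => hx n t) ge'.
  exact: has_deriv_derivable.
Qed.

(** Bound and Lipschitz estimate are proved together with a common constant, because the Lipschitz
    estimate of a product uses the bounds of its factors. *)
Lemma eval_lipschitz P e : (forall rho n, P rho -> `|rho n| <= 1) -> guarded P e ->
  exists2 C, 0 <= C & forall rho1 rho2 h, P rho1 -> P rho2 -> 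
    (forall n, `|rho1 n - rho2 n| <= h) ->
    `|eeval rho1 e| <= C /\ `|eeval rho1 e - eeval rho2 e| <= C * h.
Proof.
move=> hP; elim: e => /= [c _|n _|a iha b ihb [ga gb]|a iha b ihb [ga gb]|a iha [ga ha]].
- exists `|c| => // rho1 rho2 h _ _ hh; split=> //.
  by rewrite subrr normr0 mulr_ge0 // (le_trans _ (hh 0%N)).
- exists 1 => // rho1 rho2 h h1 h2 hh; split; first exact: hP.
  by rewrite mul1r.
- have [A A0 hA] := iha ga; have [B B0 hB] := ihb gb.
  exists (A + B); first exact: addr_ge0.
  move=> r1 r2 h h1 h2 hh; have [a1 a2] := hA _ _ _ h1 h2 hh; have [b1 b2] := hB _ _ _ h1 h2 hh.
  split; first by rewrite (le_trans (ler_normD _ _)) // lerD.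
  by rewrite opprD addrACA mulrDl (le_trans (ler_normD _ _)) // lerD.
- have [A A0 hA] := iha ga; have [B B0 hB] := ihb gb.
  exists (2 * (A * B)); first by rewrite !mulr_ge0.
  move=> r1 r2 h h1 h2 hh; have [a1 a2] := hA _ _ _ h1 h2 hh; have [b1 b2] := hB _ _ _ h1 h2 hh.
  have h0 : 0 <= h by rewrite (le_trans _ (hh 0%N)).
  have hs n : `|r2 n - r1 n| <= h by rewrite distrC.
  have [b3 _] := hB r2 r1 h h2 h1 hs.
  split.
    rewrite normrM; apply: le_trans (ler_pM _ _ a1 b1) _ => //.
    by rewrite ler_peMl ?mulr_ge0 // ler1n.
  have -> : eeval r1 a * eeval r1 b - eeval r2 a * eeval r2 b =
    (eeval r1 a - eeval r2 a) * eeval r2 b + eeval r1 a * (eeval r1 b - eeval r2 b) by ring.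
  apply: le_trans (ler_normD _ _) _; rewrite !normrM.
  have -> : 2 * (A * B) * h = (A * h) * B + A * (B * h) by ring.
  by apply: lerD; apply: ler_pM.
- have [A A0 hA] := iha ga.
  exists (4 + 16 * A); first by rewrite addr_ge0 // mulr_ge0.
  move=> r1 r2 h h1 h2 hh; have [a1 a2] := hA _ _ _ h1 h2 hh.
  have h0 : 0 <= h by rewrite (le_trans _ (hh 0%N)).
  have q1 := ha _ h1; have q2 := ha _ h2.
  have n1 : eeval r1 a != 0 by rewrite -normr_gt0 (lt_le_trans _ q1) // invr_gt0.
  have n2 : eeval r2 a != 0 by rewrite -normr_gt0 (lt_le_trans _ q2) // invr_gt0.
  have inv4 (z : R) : 4^-1 <= `|z| -> `|z^-1| <= 4.
    move=> hz; rewrite normfV -[leRHS]invrK lef_pV2 ?posrE ?invr_gt0 //.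
    by rewrite (lt_le_trans _ hz) // invr_gt0.
  split.
    by rewrite (le_trans (inv4 _ q1)) // lerDl mulr_ge0.
  have -> : (eeval r1 a)^-1 - (eeval r2 a)^-1 = - ((eeval r1 a)^-1 * (eeval r2 a)^-1 * (eeval r1 a - eeval r2 a)).
    by field; apply/andP; split.
  rewrite normrN !normrM.
  apply: (@le_trans _ _ (4 * 4 * (A * h))).
    by apply: ler_pM => //; apply: ler_pM => //; exact: inv4.
  by rewrite mulrDl; have := mulr_ge0 A0 h0; lra.
Qed.

End Expressions.

Arguments EVar {R} _%_N.
Arguments ECst {R} _%_R.
Arguments expr R : clear implicits.

(** * The Gardner equation in bilinear form *)

Section TauFunction.
Context {R : realType}.
Implicit Types (mu t x : R).

(* F n + i G n is the n-th derivative of the tau function f; Fk + i Gk with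
   k = t, tx are its derivatives in time.  The two bilinear equations are
   D_x^2 f.f* = 2 mu D_x f.f* / i and (D_t + D_x^5) f.f* / i + 5 mu D_x^4 f.f* = 0. *)
Definition tau_v (F G : nat -> R -> R -> R) t x :=
  2 * (G 1%N t x * F 0%N t x - F 1%N t x * G 0%N t x) / (F 0%N t x ^+ 2 + G 0%N t x ^+ 2).

(** Let f = F + i G and let P n + i W n be the quotient of the n-th derivative of f by f. Then v = 2
    W 1, and v_t = 2 T_x with T the imaginary part of f_t / f. Divided by the squared modulus of f,
    the bilinear equations become polynomial relations between the P n, the W n and T. They imply
    the equation integrated once in x. *)
Lemma tau_gardner mu (F G : nat -> R -> R -> R) (Ft Gt Ftx Gtx : R -> R -> R) :
  (forall n t, has_deriv (F n t) (F n.+1 t)) ->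
  (forall n t, has_deriv (G n t) (G n.+1 t)) ->
  (forall x, has_deriv (F 0%N ^~ x) (Ft ^~ x)) -> (forall x, has_deriv (G 0%N ^~ x) (Gt ^~ x)) ->
  (forall x, has_deriv (F 1%N ^~ x) (Ftx ^~ x)) -> (forall x, has_deriv (G 1%N ^~ x) (Gtx ^~ x)) ->
  (forall t, has_deriv (Ft t) (Ftx t)) -> (forall t, has_deriv (Gt t) (Gtx t)) ->
  (forall t x, F 0%N t x ^+ 2 + G 0%N t x ^+ 2 != 0) ->
  (forall t x, F 2%N t x * F 0%N t x + G 2%N t x * G 0%N t x - F 1%N t x ^+ 2 - G 1%N t x ^+ 2 =
     2 * mu * (G 1%N t x * F 0%N t x - F 1%N t x * G 0%N t x)) ->
  (forall t x, (Gt t x * F 0%N t x - Ft t x * G 0%N t x) +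
     ((G 5%N t x * F 0%N t x - F 5%N t x * G 0%N t x) - 5 * (G 4%N t x * F 1%N t x - F 4%N t x * G 1%N t x) +
      10 * (G 3%N t x * F 2%N t x - F 3%N t x * G 2%N t x)) +
     5 * mu * ((F 4%N t x * F 0%N t x + G 4%N t x * G 0%N t x) - 4 * (F 3%N t x * F 1%N t x + G 3%N t x * G 1%N t x) +
       3 * (F 2%N t x ^+ 2 + G 2%N t x ^+ 2)) = 0) ->
  gardner5 mu (tau_v F G).
Proof.
move=> dF dG dFt dGt dFtx dGtx dFt' dGt' Q0 C1 C2.
pose Q t x := F 0%N t x ^+ 2 + G 0%N t x ^+ 2.
pose P n t x := (F n t x * F 0%N t x + G n t x * G 0%N t x) / Q t x.
pose W n t x := (G n t x * F 0%N t x - F n t x * G 0%N t x) / Q t x.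
pose T t x := (Gt t x * F 0%N t x - Ft t x * G 0%N t x) / Q t x.
pose Tx t x := ((Gtx t x * F 0%N t x + Gt t x * F 1%N t x - (Ftx t x * G 0%N t x + Ft t x * G 1%N t x)) * Q t x -
  (Gt t x * F 0%N t x - Ft t x * G 0%N t x) * (2 * (F 0%N t x * F 1%N t x + G 0%N t x * G 1%N t x))) / Q t x ^+ 2.
have dQ t : has_deriv (Q t) (fun x => 2 * (F 0%N t x * F 1%N t x + G 0%N t x * G 1%N t x)).
  have := has_derivD (has_derivM (dF 0%N t) (dF 0%N t)) (has_derivM (dG 0%N t) (dG 0%N t)).
  by move=> d; apply: (has_deriv_ext d) => x; rewrite /Q ?expr2 //; ring.
have dT t : has_deriv (T t) (Tx t).
  have := has_derivM (has_derivB (has_derivM (dGt' t) (dF 0%N t)) (has_derivM (dFt' t) (dG 0%N t)))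
     (has_derivV (Q0 t) (dQ t)).
  move=> d; apply: (has_deriv_ext d) => x //; rewrite /Tx -/(Q t x).
  have := Q0 t x; rewrite -/(Q t x); move: (Q t x) => q q0; by field.
have dP n t : has_deriv (P n t) (fun x => P n.+1 t x - (P 1%N t x * P n t x - W 1%N t x * W n t x)).
  have := has_derivM (has_derivD (has_derivM (dF n t) (dF 0%N t)) (has_derivM (dG n t) (dG 0%N t)))
     (has_derivV (Q0 t) (dQ t)).
  move=> d; apply: (has_deriv_ext d) => x //; rewrite /P /W /Q.
  have := Q0 t x; move: (F _ t x) (F _ t x) (F _ t x) (F _ t x) (G _ t x) (G _ t x) (G _ t x) (G _ t x) => a b c e a' b' c' e' q0; by field.
have dW n t : has_deriv (W n t) (fun x => W n.+1 t x - (P 1%N t x * W n t x + W 1%N t x * P n t x)).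
  have := has_derivM (has_derivB (has_derivM (dG n t) (dF 0%N t)) (has_derivM (dF n t) (dG 0%N t)))
     (has_derivV (Q0 t) (dQ t)).
  move=> d; apply: (has_deriv_ext d) => x //; rewrite /P /W /Q.
  have := Q0 t x; move: (F _ t x) (F _ t x) (F _ t x) (F _ t x) (G _ t x) (G _ t x) (G _ t x) (G _ t x) => a b c e a' b' c' e' q0; by field.
(* Variable 2n stands for P n and variable 2n + 1 for W n. The rules [d] are the real and imaginary
   parts of the quotient rule: the derivative of f^(n) / f is f^(n+1) / f minus the product of f' /
   f and f^(n) / f. *)
pose rho t x n := if odd n then W n./2 t x else P n./2 t x.
pose d n : expr R := if odd n
  then ESub (EVar n.+2) (EAdd (EMul (EVar 2) (EVar n)) (EMul (EVar 3) (EVar n.-1)))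
  else ESub (EVar n.+2) (ESub (EMul (EVar 2) (EVar n)) (EMul (EVar 3) (EVar n.+1))).
have hd t n : has_deriv (fun x => rho t x n) (fun x => eeval (rho t x) (d n)).
  rewrite -(odd_double_half n); move: (odd n) (n./2) => [] k.
  - rewrite add1n /rho /d /= odd_double /= uphalf_double.
    apply: (has_deriv_ext (dW k t)) => x //=.
    by rewrite odd_double /= ?uphalf_double ?doubleK; ring.
  - rewrite add0n /rho /d /= odd_double /= doubleK.
    apply: (has_deriv_ext (dP k t)) => x //=.
    by rewrite odd_double /= ?uphalf_double ?doubleK; ring.
have hE t e : guarded (fun _ : nat -> R => True) e ->
    has_deriv (fun x => eeval (rho t x) e) (fun x => eeval (rho t x) (deriv_expr d e)).
  exact: (eval_has_deriv (P := fun=> True)).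
(* The first bilinear equation expresses P 2 through P 1 and W 1. Differentiating it once and twice
   expresses P 3 and P 4. *)
pose rhs2 : expr R := EAdd (EAdd (EMul (EVar 2) (EVar 2)) (EMul (EVar 3) (EVar 3))) (EMul (ECst (2 * mu)) (EVar 3)).
pose rhs3 : expr R := EAdd (ESub (EMul (EVar 2) (EVar 4)) (EMul (EVar 3) (EVar 5))) (deriv_expr d rhs2).
pose rhs4 : expr R := EAdd (ESub (EMul (EVar 2) (EVar 6)) (EMul (EVar 3) (EVar 7))) (deriv_expr d rhs3).
have E2 t x : rho t x 4%N = eeval (rho t x) rhs2.
  rewrite /rhs2 /= /rho /= /P /W; have := C1 t x; have := Q0 t x; rewrite -/(Q t x) => q0 c1.

  have -> : F 2%N t x * F 0%N t x + G 2%N t x * G 0%N t x = F 1%N t x ^+ 2 + G 1%N t x ^+ 2 + 2 * mu * (G 1%N t x * F 0%N t x - F 1%N t x * G 0%N t x).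
    by rewrite -c1; ring.
  rewrite /Q in q0 *; move: q0; move: (F _ t x) (F _ t x) (G _ t x) (G _ t x) => a b a' b' q0; by field.
have E3 t x : rho t x 6%N = eeval (rho t x) rhs3.
  have h := hE t (EVar 4) I; have h' := hE t rhs2 _.
  have e : (fun y => eeval (rho t y) (EVar 4)) = (fun y => eeval (rho t y) rhs2) by apply/funext => y; exact: E2.
  rewrite e in h; have := has_derivE h; rewrite (has_derivE (h' _)) // => /(congr1 (fun u => u x)) /=.
  by rewrite -/(deriv_expr d rhs2) => ->; ring.
have E4 t x : rho t x 8%N = eeval (rho t x) rhs4.
  have h := hE t (EVar 6) I; have h' := hE t rhs3 _.
  have e : (fun y => eeval (rho t y) (EVar 6)) = (fun y => eeval (rho t y) rhs3) by apply/funext => y; exact: E3.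
  rewrite e in h; have := has_derivE h; rewrite (has_derivE (h' _)) // => /(congr1 (fun u => u x)) /=.
  by move=> ->; ring.
have E5 t x : T t x = - (rho t x 11%N - 5 * (rho t x 9%N * rho t x 2%N - rho t x 8%N * rho t x 3%N) +
      10 * (rho t x 7%N * rho t x 4%N - rho t x 6%N * rho t x 5%N)) -
    5 * mu * (rho t x 8%N - 4 * (rho t x 6%N * rho t x 2%N + rho t x 7%N * rho t x 3%N) + 3 * (rho t x 4%N ^+ 2 + rho t x 5%N ^+ 2)).
  rewrite /rho /= /P /W /T /Q; have := C2 t x; have := Q0 t x.
  move: (F 0%N t x) (F 1%N t x) (F 2%N t x) (F 3%N t x) (F 4%N t x) (F 5%N t x).
  move: (G 0%N t x) (G 1%N t x) (G 2%N t x) (G 3%N t x) (G 4%N t x) (G 5%N t x) (Ft t x) (Gt t x).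
  move=> b0 b1 b2 b3 b4 b5 ft gt a0 a1 a2 a3 a4 a5 q0 c2.
  have -> : gt * a0 - ft * b0 = - (b5 * a0 - a5 * b0 - 5 * (b4 * a1 - a4 * b1) + 10 * (b3 * a2 - a3 * b2)) -
    5 * mu * (a4 * a0 + b4 * b0 - 4 * (a3 * a1 + b3 * b1) + 3 * (a2 ^+ 2 + b2 ^+ 2)).
    by apply/eqP; rewrite -subr_eq0 -[X in _ == X]c2; apply/eqP; ring.
  by field.
pose e0 : expr R := EMul (ECst 2) (EVar 3).
pose e j := iter j (deriv_expr d) e0.
have gd n : guarded (fun _ : nat -> R => True) (d n) by rewrite /d; case: ifP.
have ge j : guarded (fun _ : nat -> R => True) (e j).
  by elim: j => [|j IH] //; rewrite /e iterS; apply: guarded_deriv.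
have vE : tau_v F G = (fun t x => eeval (rho t x) (e 0%N)).
  by apply/funext => t; apply/funext => x; rewrite /tau_v /e /e0 /= /rho /= /W mulrA.
have dv t j : derive1n j (tau_v F G t) = (fun x => eeval (rho t x) (e j)).
  elim: j => [|j IH]; first by rewrite vE.
  by rewrite derive1nS IH (has_derivE (hE t _ (ge j))).
have dvt x : has_deriv (fun t => tau_v F G t x) (fun t => 2 * Tx t x).
  have dQt : has_deriv (fun t => Q t x) (fun t => 2 * (F 0%N t x * Ft t x + G 0%N t x * Gt t x)).
    have := has_derivD (has_derivM (dFt x) (dFt x)) (has_derivM (dGt x) (dGt x)).
    by move=> h; apply: (has_deriv_ext h) => t; rewrite /Q ?expr2 //; ring.
  have := has_derivM (has_derivZ 2 (has_derivB (has_derivM (dGtx x) (dFt x)) (has_derivM (dFtx x) (dGt x))))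
     (has_derivV (fun t => Q0 t x) dQt).
  move=> h; apply: (has_deriv_ext h) => t //; rewrite /Tx /Q; have := Q0 t x.
  move: (F _ t x) (F _ t x) (G _ t x) (G _ t x) => a b a' b' q0; by field.
(* The integrated equation. Once T is replaced by means of the second bilinear equation and P 2, P
   3, P 4 are eliminated, both sides are the same polynomial in the remaining variables. Its
   x-derivative is the Gardner equation. *)
have E6 t x : gardnerK mu (tau_v F G t) x =
    - (2 * T t x) - eeval (rho t x) (e 4%N) - 10 * mu ^+ 2 * eeval (rho t x) (e 2%N).
  rewrite /gardnerK -[derive1 _]/(derive1n 1 _) !dv.
  rewrite -[tau_v F G t]/(derive1n 0 _) dv (E5 t x).
  have := E4 t x; have := E3 t x; have := E2 t x.
  rewrite /rhs4 /rhs3 /rhs2 /e /e0 /d /=.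
  move: (rho t x 2%N) (rho t x 3%N) (rho t x 4%N) (rho t x 5%N) (rho t x 6%N) (rho t x 7%N) (rho t x 8%N) (rho t x 9%N) (rho t x 10%N) (rho t x 11%N).
  move=> p1 w1 p2 w2 p3 w3 p4 w4 p5 w5 -> -> ->.
  by ring.
move=> t x; rewrite /partial_t (has_derivE (dvt x)) !dv.
have -> : gardnerK mu (tau_v F G t) = (fun x => - (2 * T t x) - eeval (rho t x) (e 4%N) - 10 * mu ^+ 2 * eeval (rho t x) (e 2%N)).
  by apply/funext => y; exact: E6.
have h := has_derivB (has_derivB (has_derivN (has_derivZ 2 (dT t))) (hE t _ (ge 4%N))) (has_derivZ (10 * mu ^+ 2) (hE t _ (ge 2%N))).
rewrite (has_derivE h) -[deriv_expr d (e 4%N)]/(e 5%N) -[deriv_expr d (e 2%N)]/(e 3%N); ring.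
Qed.

End TauFunction.

(** * Breather tau functions *)

Section BreatherTau.
Context {R : realType}.
Implicit Types (mu t x al be p q : R).

(** Coordinates in the span of 1, E cos th, E sin th and E^2 with E = expR y. For affine y and th
    this span is invariant under differentiation, and [wave_step] is the derivation in these
    coordinates. *)
Record wave := Wave { wA : R; wa : R; wb : R; wB : R }.

Definition wave_val (w : wave) (y th : R) : R :=
  wA w + expR y * (wa w * cos th + wb w * sin th) + wB w * expR y ^+ 2.

Definition wave_step p q (w : wave) : wave :=
  Wave 0 (p * wa w + q * wb w) (p * wb w - q * wa w) (2 * p * wB w).

Lemma wave_val_deriv w p q (y th : R -> R) :
  has_deriv y (fun=> p) -> has_deriv th (fun=> q) ->
  has_deriv (fun x => wave_val w (y x) (th x)) (fun x => wave_val (wave_step p q w) (y x) (th x)).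
Proof.
move=> dy dth; have dE := has_deriv_expR dy.
have dc := has_derivZ (wa w) (has_deriv_cos dth); have ds := has_derivZ (wb w) (has_deriv_sin dth).
have := has_derivD (has_derivD (has_deriv_cst (wA w)) (has_derivM dE (has_derivD dc ds)))
  (has_derivZ (wB w) (has_derivM dE dE)).
move=> h; apply: (has_deriv_ext h) => x; rewrite /wave_val /= ?expr2 //; ring.
Qed.

(** Real and imaginary part of the dispersion relation -(k^5 + 10 mu^2 k^3) at the complex wave
    number k = be + i al; [soliton_freq] is the same function at real k. *)
Definition freq_re mu al be : R :=
  - (be ^+ 5 - 10 * be ^+ 3 * al ^+ 2 + 5 * be * al ^+ 4) - 10 * mu ^+ 2 * (be ^+ 3 - 3 * be * al ^+ 2).
Definition freq_im mu al be : R :=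
  - (5 * be ^+ 4 * al - 10 * be ^+ 2 * al ^+ 3 + al ^+ 5) - 10 * mu ^+ 2 * (3 * be ^+ 2 * al - al ^+ 3).

(** A two-soliton tau function with the complex conjugate wave numbers be + i al and be - i al. For
    mu = 0, G / F is the classical quotient of the modified KdV breather. *)
Definition breatherF mu al be :=
  Wave (al ^+ 2) (4 * mu * be) 0 (al ^+ 2 + be ^+ 2 - 4 * mu ^+ 2).
Definition breatherG mu al be :=
  Wave 0 (2 * be ^+ 2) (- (2 * be * al)) (- (4 * mu * be)).

Definition breather mu al be (y0 th0 : R) : R -> R -> R :=
  tau_v (fun n t x => wave_val (iter n (wave_step be al) (breatherF mu al be))
           (be * x + (freq_re mu al be * t + y0)) (al * x + (freq_im mu al be * t + th0)))
        (fun n t x => wave_val (iter n (wave_step be al) (breatherG mu al be))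
           (be * x + (freq_re mu al be * t + y0)) (al * x + (freq_im mu al be * t + th0))).

(** The bilinear identities hold only on the circle c^2 + s^2 = 1. With c and s independent, the
    defect is 1 - (c^2 + s^2) times a factor free of c and s. That factor is the value at the
    origin, so [ring] can check the divisibility. *)
Lemma circle_relation (D : R -> R -> R) (c s : R) :
  D c s = D 0 0 * (1 - (c ^+ 2 + s ^+ 2)) -> c ^+ 2 + s ^+ 2 = 1 -> D c s = 0.
Proof. by move=> -> ->; rewrite subrr mulr0. Qed.

Ltac use_circle c s :=
  lazymatch goal with |- ?X = 0 =>
    let f := eval pattern c, s in X in
    lazymatch f with ?D c s => apply: (@circle_relation D) end end.

(** The smallness of mu bounds the oscillating term by a quarter of al be E, which the square of al
    - be E absorbs. Thus the real part alone keeps the tau function away from zero. *)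
Lemma breatherF_gt0 (mu al be y th : R) : 16 * `|mu| <= al -> 0 < al -> 0 < be ->
  0 < wave_val (breatherF mu al be) y th.
Proof.
move=> hm al0 be0; rewrite /wave_val /= mul0r addr0.
have E0 := expR_gt0 y; move: (expR y) E0 => E E0.
have hc : `|mu * cos th| <= al / 16.
  rewrite normrM; apply: (@le_trans _ _ `|mu|); last by rewrite ler_pdivlMr // mulrC.
  by rewrite ler_piMr // ler_norml cos_geN1 cos_le1.
have hm2 : mu ^+ 2 <= al ^+ 2 / 256.
  rewrite -(ger0_norm (sqr_ge0 mu)) normrX; have := normr_ge0 mu; move: `|mu| hm => m h1 h2; nra.
move: hc; rewrite ler_norml => /andP[h1 _].
have -> : E * (4 * mu * be * cos th) = 4 * be * E * (mu * cos th) by ring.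
move: (mu * cos th) h1 => z h1.
have b1 : - (al * be * E / 4) <= 4 * be * E * z.
  have hz : 0 <= z + al / 16 by lra.
  by have := mulr_ge0 (mulr_ge0 (ltW be0) (ltW E0)) hz; lra.
have e2 := exprn_gt0 2 E0.
have b2 : (al ^+ 2 / 2 + be ^+ 2) * E ^+ 2 <= (al ^+ 2 + be ^+ 2 - 4 * mu ^+ 2) * E ^+ 2.
  by apply: ler_wpM2r; [exact: ltW|have := sqr_ge0 al; lra].
have a2 := exprn_gt0 2 al0.
have := sqr_ge0 (al - be * E); nra.
Qed.

Lemma breather_gardner (mu al be y0 th0 : R) : 16 * `|mu| <= al -> 0 < al -> 0 < be ->
  gardner5 mu (breather mu al be y0 th0).
Proof.
move=> hm al0 be0.
set Or := freq_re mu al be; set Oi := freq_im mu al be.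
pose y t x := be * x + (Or * t + y0); pose th t x := al * x + (Oi * t + th0).
have dyx t : has_deriv (y t) (fun=> be) by exact: has_deriv_affine.
have dthx t : has_deriv (th t) (fun=> al) by exact: has_deriv_affine.
have dyt x : has_deriv (y ^~ x) (fun=> Or).
  by apply: (has_deriv_ext (has_deriv_affine Or (be * x + y0))) => // t; rewrite /y; ring.
have dtht x : has_deriv (th ^~ x) (fun=> Oi).
  by apply: (has_deriv_ext (has_deriv_affine Oi (al * x + th0))) => // t; rewrite /th; ring.
have comm w : wave_step Or Oi (wave_step be al w) = wave_step be al (wave_step Or Oi w).
  by rewrite /wave_step /=; congr Wave; ring.
pose f := breatherF mu al be; pose g := breatherG mu al be.
apply: (@tau_gardner R mu _ _ (fun t x => wave_val (wave_step Or Oi f) (y t x) (th t x))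
  (fun t x => wave_val (wave_step Or Oi g) (y t x) (th t x))
  (fun t x => wave_val (wave_step Or Oi (wave_step be al f)) (y t x) (th t x))
  (fun t x => wave_val (wave_step Or Oi (wave_step be al g)) (y t x) (th t x))).
- by move=> n t; rewrite iterS; apply: wave_val_deriv; [exact: (dyx t)|exact: (dthx t)].
- by move=> n t; rewrite iterS; apply: wave_val_deriv; [exact: (dyx t)|exact: (dthx t)].
- by move=> x; apply: wave_val_deriv; [exact: (dyt x)|exact: (dtht x)].
- by move=> x; apply: wave_val_deriv; [exact: (dyt x)|exact: (dtht x)].
- by move=> x; apply: wave_val_deriv; [exact: (dyt x)|exact: (dtht x)].
- by move=> x; apply: wave_val_deriv; [exact: (dyt x)|exact: (dtht x)].
- by move=> t; rewrite comm; apply: wave_val_deriv; [exact: (dyx t)|exact: (dthx t)].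
- by move=> t; rewrite comm; apply: wave_val_deriv; [exact: (dyx t)|exact: (dthx t)].
- move=> t x; rewrite gt_eqF // ltr_pwDl ?sqr_ge0 // exprn_gt0 //.
  exact: breatherF_gt0.
- move=> t x; rewrite -/Or -/Oi -/(y t x) -/(th t x).
  have cs := cos2Dsin2 (th t x).
  rewrite /wave_val /wave_step /=.
  move: (cos _) (sin _) (expR _) cs => c s E cs.
  apply/eqP; rewrite -subr_eq0; apply/eqP.
  use_circle c s => //; ring.
- move=> t x; rewrite -/Or -/Oi -/(y t x) -/(th t x).
  have cs := cos2Dsin2 (th t x).
  rewrite /wave_val /wave_step /= /Or /Oi /freq_re /freq_im.
  move: (cos _) (sin _) (expR _) cs => c s E cs.
  use_circle c s => //; ring.
Qed.

End BreatherTau.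

(** * Breather profiles *)

Section BreatherProfile.
Context {R : realType}.
Implicit Types (mu t x al be y th p q kap m c s S : R) (rho : nat -> R) (e : expr R).

(* Normalised tau functions F / (al^2 (1 + E^2)), in the variables
   kap = be / al, m = mu / al, c = cos th, s = sin th, S = E / (1 + E^2), p = E^2 / (1 + E^2). *)
Definition profile_env kap m y th : nat -> R := fun n =>
  match n with
  | 0%N => kap | 1%N => m | 2%N => cos th | 3%N => sin th
  | 4%N => expR y / (1 + expR y ^+ 2) | 5%N => expR y ^+ 2 / (1 + expR y ^+ 2) | _ => 0
  end.

(** The bounds 1/16 encode 16 be <= al and 16 |mu| <= al. Inside this region the variables count as
    independent, so breathers with different parameters can be compared variable by variable. *)
Definition admissible rho := [/\ 0 <= rho 0%N <= 16^-1, `|rho 1%N| <= 16^-1,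
  `|rho 2%N| <= 1 /\ `|rho 3%N| <= 1, 0 <= rho 4%N <= 1 /\ 0 <= rho 5%N <= 1 &
  forall n, rho n.+4.+2 = 0].

Local Notation vk := (@EVar R 0). Local Notation vm := (@EVar R 1).
Local Notation vc := (@EVar R 2). Local Notation vs := (@EVar R 3).
Local Notation vS := (@EVar R 4). Local Notation vp := (@EVar R 5).

Definition profile_der (a b : expr R) n : expr R :=
  match n with
  | 2%N => EOpp (EMul b vs) | 3%N => EMul b vc
  | 4%N => EOpp (EMul a (EMul (ESub (EMul (ECst 2) vp) (ECst 1)) vS))
  | 5%N => EMul a (EMul (ECst 2) (EMul vp (ESub (ECst 1) vp)))
  | _ => ECst 0
  end.

Lemma expR_sqr1_gt0 y : 0 < 1 + expR y ^+ 2.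
Proof. by rewrite ltr_pwDl ?sqr_ge0. Qed.

Lemma profile_env_deriv kap m a b (y th : R -> R) n : has_deriv y (fun=> a) -> has_deriv th (fun=> b) ->
  has_deriv (fun x => profile_env kap m (y x) (th x) n)
    (fun x => eeval (profile_env kap m (y x) (th x)) (profile_der (ECst a) (ECst b) n)).
Proof.
move=> dy dth; have dE := has_deriv_expR dy.
have dE2 : has_deriv (fun x => 1 + expR (y x) ^+ 2) (fun x => 2 * a * expR (y x) ^+ 2).
  apply: (has_deriv_ext (has_derivD (has_deriv_cst 1) (has_derivM dE dE))) => x; rewrite ?expr2 //; ring.
have nE x : 1 + expR (y x) ^+ 2 != 0 by rewrite gt_eqF ?expR_sqr1_gt0.
case: n => [|[|[|[|[|[|n]]]]]] /=.
- exact: has_deriv_cst.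
- exact: has_deriv_cst.
- by apply: (has_deriv_ext (has_deriv_cos dth)) => x //; ring.
- exact: has_deriv_sin.
- apply: (has_deriv_ext (has_derivM dE (has_derivV nE dE2))) => x //=.
  have := nE x; move: (expR (y x)) => E e0; by field.
- apply: (has_deriv_ext (has_derivM (has_derivM dE dE) (has_derivV nE dE2))) => x //=.
  have := nE x; move: (expR (y x)) => E e0; by field.
- exact: has_deriv_cst.
Qed.

Lemma profile_env_admissible kap m y th : 0 <= kap <= 16^-1 -> `|m| <= 16^-1 ->
  admissible (profile_env kap m y th).
Proof.
move=> hk hm; have E0 := expR_gt0 y; have E1 := expR_sqr1_gt0 y; split=> //=.
- by split; rewrite ler_norml ?cos_geN1 ?cos_le1 ?sin_geN1 ?sin_le1.
- split; apply/andP; split; rewrite ?divr_ge0 ?sqr_ge0 ?(ltW E0) ?(ltW E1) //;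
    rewrite ler_pdivrMr // mul1r ?lerDr //.
  by have := sqr_ge0 (expR y - 1); move: (expR y) E0 => E E0; nra.
Qed.

Lemma profile_der_guarded P a b n : guarded P a -> guarded P b -> guarded P (profile_der a b n).
Proof. by move=> ga gb; case: n => [|[|[|[|[|[|n]]]]]] /=. Qed.

Lemma deriv_expr_scale rho d d' al e : (forall n, eeval rho (d n) = al * eeval rho (d' n)) ->
  eeval rho (deriv_expr d e) = al * eeval rho (deriv_expr d' e).
Proof.
move=> h; elim: e => /= [a|n|a -> b ->|a -> b ->|a ->]; rewrite ?mulr0 //; ring.
Qed.

(** The x-derivative divided by [al]: as y' = be = al kap and th' = al, the rescaled derivation has
    the coefficients kap and 1, which keeps all derived expressions uniform in [al]. *)
Definition nder e := deriv_expr (profile_der vk (ECst 1)) e.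

Lemma profile_has_deriv al be mu (y0 th' : R) e : al != 0 -> 0 <= be / al <= 16^-1 -> `|mu / al| <= 16^-1 ->
  guarded admissible e ->
  has_deriv (fun x => eeval (profile_env (be / al) (mu / al) (be * x + y0) (al * x + th')) e)
    (fun x => al * eeval (profile_env (be / al) (mu / al) (be * x + y0) (al * x + th')) (nder e)).
Proof.
move=> al0 hk hm ge.
have h := eval_has_deriv (rho := fun x => profile_env (be / al) (mu / al) (be * x + y0) (al * x + th'))
  (fun x => profile_env_admissible _ _ hk hm)
  (fun n => profile_env_deriv (be / al) (mu / al) n (has_deriv_affine be y0) (has_deriv_affine al th')) ge.
apply: (has_deriv_ext h) => x //; apply: deriv_expr_scale => n.
case: n => [|[|[|[|[|[|n]]]]]] /=; rewrite ?mulr0 //; field => //.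
all: by rewrite al0 ?andbT gt_eqF ?expR_sqr1_gt0.
Qed.

(** [eFk] and [eGk] are the non-oscillating parts of the normalised tau function f; let fk = Fk + i
    Gk. The argument of f is that of fk, the kink, plus that of f conj(fk), whose tangent is [eK].
    Only the latter carries the decaying factor S. The former tends to a nonzero constant if mu <>
    0, because p tends to 1, and only its derivative, which leads to [eX], decays. *)
Definition eFk := EAdd (ECst 1) (EMul (ESub (EMul vk vk) (EMul (ECst 4) (EMul vm vm))) vp).
Definition eGk := EMul (ECst (- 4)) (EMul vm (EMul vk vp)).
Definition eF := EAdd eFk (EMul (ECst 4) (EMul vm (EMul vk (EMul vS vc)))).
Definition eG := EAdd eGk (EMul (ECst 2) (EMul vk (EMul vS (ESub (EMul vk vc) vs)))).
Definition eDen := EAdd (EMul eF eFk) (EMul eG eGk).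
Definition eNum := ESub (EMul (ECst 2) (EMul (ESub (EMul vk vc) vs) eFk)) (EMul (ECst 4) (EMul vm (EMul vc eGk))).
Definition eM := EMul eNum (EInv eDen).
Definition eK := EMul vk (EMul vS eM).
Definition eQk := EAdd (EMul eFk eFk) (EMul eGk eGk).
(* (S X)' = al S (sder X) *)
Definition sder X := ESub (nder X) (EMul vk (EMul (ESub (EMul (ECst 2) vp) (ECst 1)) X)).
Definition eN1 := EMul (EMul (ECst 2) (sder eM)) (EInv (EAdd (ECst 1) (EMul eK eK))).
Definition eN2 := sder eN1.
Definition eX := EMul (ECst (- 16)) (EMul vS (EInv eQk)).
Definition eX1 := sder eX.

Lemma abs_le (a b : R) : `|a| <= b -> - b <= a <= b. Proof. by rewrite ler_norml. Qed.

Lemma profile_bounds rho : admissible rho ->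
  [/\ `|eeval rho eFk - 1| <= 32^-1, `|eeval rho eGk| <= 64^-1,
      `|eeval rho eF - 1| <= 16^-1 & `|eeval rho eG| <= 4^-1].
Proof.
move=> [/andP[k0 k1] hm [hc hs] [/andP[S0 S1] /andP[p0 p1]] _] /=.
move: (rho 0%N) (rho 1%N) (rho 2%N) (rho 3%N) (rho 4%N) (rho 5%N) k0 k1 hm hc hs S0 S1 p0 p1.
move=> k m c s S p k0 k1 hm hc hs S0 S1 p0 p1.
have hmk : `|m * k| <= 256^-1.
  rewrite normrM (ger0_norm k0); apply: le_trans (ler_pM _ _ hm k1) _ => //; lra.
have hmkp : `|m * (k * p)| <= 256^-1.
  rewrite mulrA normrM (ger0_norm p0) -[leRHS]mulr1; exact: ler_pM.
have hmkS : `|m * (k * (S * c))| <= 256^-1.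
  rewrite mulrA normrM -[leRHS]mulr1; apply: ler_pM => //; rewrite normrM (ger0_norm S0) -[leRHS]mulr1; exact: ler_pM.
have hkk : 0 <= k * k <= 256^-1.
  by rewrite mulr_ge0 //=; apply: le_trans (ler_pM _ _ k1 k1) _ => //; lra.
have hmm : 0 <= m * m <= 256^-1.
  rewrite -expr2 sqr_ge0 /= -(ger0_norm (sqr_ge0 m)) normrX expr2.
  by apply: le_trans (ler_pM _ _ hm hm) _ => //; lra.
have hpp : `|(k * k + -1 * (4 * (m * m))) * p| <= 64^-1.
  rewrite normrM (ger0_norm p0) -[leRHS]mulr1; apply: ler_pM => //.
  by rewrite ler_norml; move: hkk hmm => /andP[? ?] /andP[? ?]; apply/andP; split; lra.
have hg : `|k * (S * (k * c + -1 * s))| <= 15^-1.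
  rewrite normrM (ger0_norm k0); apply: le_trans (_ : 16^-1 * (17 / 16) <= _); last lra.
  apply: ler_pM => //; rewrite normrM (ger0_norm S0) -[leRHS]mul1r; apply: ler_pM => //.
  apply: le_trans (ler_normD _ _) _; rewrite normrM (ger0_norm k0) mulN1r normrN.
  have : k * `|c| <= 16^-1 * 1 by apply: ler_pM.
  lra.
move: hmkp hmkS hpp hg => /abs_le/andP[a1 a2] /abs_le/andP[b1 b2] /abs_le/andP[c1 c2] /abs_le/andP[d1 d2].
clear hmk hkk hmm.
split; rewrite ler_norml; apply/andP; split; [clear - c1 c2|clear - c1 c2|clear - a1 a2|clear - a1 a2|
  clear - b1 b2 c1 c2|clear - b1 b2 c1 c2|clear - a1 a2 d1 d2|clear - a1 a2 d1 d2]; lra.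
Qed.

Lemma ler_norm_r (a b : R) : b <= a -> b <= `|a|.
Proof. by move=> h; apply: le_trans (ler_norm a). Qed.

Lemma eDen_ge rho : admissible rho -> 4^-1 <= eeval rho eDen.
Proof.
move=> h; have [h1 h2 h3 h4] := profile_bounds h; rewrite /eDen -[eeval _ _]/(eeval rho eF * eeval rho eFk + eeval rho eG * eeval rho eGk).
move: (eeval rho eF) (eeval rho eFk) (eeval rho eG) (eeval rho eGk) h1 h2 h3 h4 => a b c e h1 h2 h3 h4.
have : `|c * e| <= 4^-1 * 64^-1 by rewrite normrM; apply: ler_pM.
move: h1 h2 h3 h4 => /abs_le/andP[? ?] /abs_le/andP[? ?] /abs_le/andP[? ?] /abs_le/andP[? ?] /abs_le/andP[? ?].
nra.
Qed.

Lemma eQk_ge rho : admissible rho -> 4^-1 <= eeval rho eQk.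
Proof.
move=> h; have [h1 h2 h3 h4] := profile_bounds h; rewrite /eQk -[eeval _ _]/(eeval rho eFk * eeval rho eFk + eeval rho eGk * eeval rho eGk).
move: (eeval rho eFk) (eeval rho eGk) h1 h2 => b c h1 h2.
move: h1 => /abs_le/andP[? ?]; have := sqr_ge0 c; nra.
Qed.

Lemma admissible_guards : [/\ guarded admissible eM, guarded admissible eN1, guarded admissible eN2,
  guarded admissible eX & guarded admissible eX1].
Proof.
have gn e : guarded admissible e -> guarded admissible (nder e).
  by apply: guarded_deriv => n; exact: profile_der_guarded.
have gs e : guarded admissible e -> guarded admissible (sder e).
  by move=> g; rewrite /sder; split; [exact: gn|do !split].
have gM : guarded admissible eM.
  split; first by do !split.
  split; first by do !split.
  by move=> rho h; apply: ler_norm_r; exact: eDen_ge.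
have gK : guarded admissible eK by split => //; split.
have gN1 : guarded admissible eN1.
  split; first by split => //; exact: gs.
  split; first by split => //; split.
  move=> rho h; apply: ler_norm_r; rewrite -[eeval _ _]/(1 + eeval rho eK * eeval rho eK).
  by have := sqr_ge0 (eeval rho eK); rewrite expr2; lra.
have gX : guarded admissible eX.
  split=> //; split=> //; split; first by do !split.
  by move=> rho h; apply: ler_norm_r; exact: eQk_ge.
by split; [exact: gM|exact: gN1|exact: gs|exact: gX|exact: gs].
Qed.

Section Profile.
Variables (al be mu y th' : R).
Hypotheses (al0 : 0 < al) (be0 : 0 < be) (hbe : 16 * be <= al) (hmu : 16 * `|mu| <= al).

Definition profile_path x := profile_env (be / al) (mu / al) (be * x + y) (al * x + th').
(** Half the usual hyperbolic secant, 1 / (2 cosh x). *)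
Definition sech x : R := expR x / (1 + expR x ^+ 2).
Definition packet c X x := c * sech (be * x + y) * eeval (profile_path x) X.

(* The breather is bPhi1 = bPhi', a wave packet at frequency al, plus bkink, which
   is smaller by a factor mu * be / al^2. *)
Definition bPhi x := 2 * atan (eeval (profile_path x) eK).
Definition bPhi1 := packet be eN1.
Definition bPhi2 := packet (al * be) eN2.
Definition bkink := packet (be * (mu / al) * (be / al)) eX.
Definition bkink1 := packet (al * (be * (mu / al) * (be / al))) eX1.

Let hk : 0 <= be / al <= 16^-1.
Proof. by have h := hbe; rewrite divr_ge0 ?(ltW be0) ?(ltW al0) //= ler_pdivrMr //; lra. Qed.
Let hm : `|mu / al| <= 16^-1.
Proof. by have h := hmu; rewrite normrM normfV (gtr0_norm al0) ler_pdivrMr //; lra. Qed.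
Let al_neq0 : al != 0. Proof. by rewrite gt_eqF. Qed.

Lemma profile_path_admissible x : admissible (profile_path x).
Proof. exact: profile_env_admissible. Qed.

Lemma packet_deriv c X : guarded admissible X -> has_deriv (packet c X) (packet (al * c) (sder X)).
Proof.
move=> gX; have dS := profile_has_deriv y th' al_neq0 hk hm (I : guarded admissible vS).
have dX := profile_has_deriv y th' al_neq0 hk hm gX.
apply: (has_deriv_ext (has_derivM (has_derivZ c dS) dX)) => x //.
by rewrite /packet /profile_path /sder /= -/(nder X) /sech; ring.
Qed.

Lemma bPhi_deriv : has_deriv bPhi bPhi1.
Proof.
have [gM _ _ _ _] := admissible_guards.
have dK : has_deriv (fun x => eeval (profile_path x) eK) (packet (al * (be / al)) (sder eM)).
  apply: (has_deriv_ext (packet_deriv (be / al) gM)) => x //.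
  by rewrite /packet /eK /= /sech -mulrA.
apply: (has_deriv_ext (has_derivZ 2 (has_deriv_atan dK))) => x //.
rewrite /bPhi1 /packet -[eeval _ eN1]/(2 * eeval (profile_path x) (sder eM) / (1 + eeval (profile_path x) eK * eeval (profile_path x) eK)).
by rewrite (mulrC al) divfK // expr2; ring.
Qed.

Lemma bPhi1_deriv : has_deriv bPhi1 bPhi2.
Proof. by have [_ gN _ _ _] := admissible_guards; exact: packet_deriv. Qed.

Lemma bkink_deriv : has_deriv bkink bkink1.
Proof. by have [_ _ _ gX _] := admissible_guards; exact: packet_deriv. Qed.

(** The derivative of the identity arg f = arg fk + arg(f conj(fk)), carried out on real and
    imaginary parts. *)
Lemma breather_profile x (F G : nat -> R -> R -> R) t :
  F 0%N t x = wave_val (breatherF mu al be) (be * x + y) (al * x + th') ->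
  F 1%N t x = wave_val (wave_step be al (breatherF mu al be)) (be * x + y) (al * x + th') ->
  G 0%N t x = wave_val (breatherG mu al be) (be * x + y) (al * x + th') ->
  G 1%N t x = wave_val (wave_step be al (breatherG mu al be)) (be * x + y) (al * x + th') ->
  tau_v F G t x = bPhi1 x + bkink x.
Proof.
rewrite /tau_v => -> -> -> ->.
have adm := profile_path_admissible x.
have [b1 b2 b3 b4] := profile_bounds adm; have D0 := eDen_ge adm; have Q0 := eQk_ge adm.
pose ev e := eeval (profile_path x) e.
have nE : 1 + expR (be * x + y) ^+ 2 != 0 by rewrite gt_eqF ?expR_sqr1_gt0.
have hF : wave_val (breatherF mu al be) (be * x + y) (al * x + th') = al ^+ 2 * (1 + expR (be * x + y) ^+ 2) * ev eF.
  rewrite /wave_val /ev /eF /eFk /=; move: (cos _) (expR _) nE => c u nu; field; exact/andP.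
have hG : wave_val (breatherG mu al be) (be * x + y) (al * x + th') = al ^+ 2 * (1 + expR (be * x + y) ^+ 2) * ev eG.
  rewrite /wave_val /ev /eG /eGk /=; move: (cos _) (sin _) (expR _) nE => c s u nu; field; exact/andP.
have hF1 : wave_val (wave_step be al (breatherF mu al be)) (be * x + y) (al * x + th') =
    al ^+ 3 * (1 + expR (be * x + y) ^+ 2) * ev (nder eF) + 2 * be * al ^+ 2 * expR (be * x + y) ^+ 2 * ev eF.
  rewrite /wave_val /ev /eF /eFk /=; move: (cos _) (sin _) (expR _) nE => c s u nu; field; exact/andP.
have hG1 : wave_val (wave_step be al (breatherG mu al be)) (be * x + y) (al * x + th') =
    al ^+ 3 * (1 + expR (be * x + y) ^+ 2) * ev (nder eG) + 2 * be * al ^+ 2 * expR (be * x + y) ^+ 2 * ev eG.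
  rewrite /wave_val /ev /eG /eGk /=; move: (cos _) (sin _) (expR _) nE => c s u nu; field; exact/andP.
rewrite hF hG hF1 hG1.
have hN : (be / al) * (sech (be * x + y) * ev eNum) = ev eG * ev eFk - ev eF * ev eGk.
  rewrite /ev /eNum /eG /eF /= /sech; ring.
have hN1 : (be / al) * (sech (be * x + y) * ev (sder eNum)) =
    ev (nder eG) * ev eFk + ev eG * ev (nder eFk) - ev (nder eF) * ev eGk - ev eF * ev (nder eGk).
  rewrite /ev /eNum /eG /eF /eFk /eGk /= /sech; ring.
have hX : ev (nder eGk) * ev eFk - ev (nder eFk) * ev eGk = - 8 * (mu / al) * (be / al) ^+ 2 * sech (be * x + y) ^+ 2.
  rewrite /ev /eFk /eGk /= /sech; field; exact/andP.
rewrite /bPhi1 /bkink /packet.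
have -> : eeval (profile_path x) eX = - 16 * (sech (be * x + y) * (ev eQk)^-1) by [].
have -> : eeval (profile_path x) eN1 = 2 * (ev (sder eNum) / ev eDen - ev eNum * (ev (nder eDen) / (ev eDen * ev eDen))) /
    (1 + (be / al * (sech (be * x + y) * (ev eNum / ev eDen))) ^+ 2).
  rewrite expr2 -[eeval _ eN1]/(2 * ev (sder eM) / (1 + (be / al * (sech (be * x + y) * (ev eNum / ev eDen))) * (be / al * (sech (be * x + y) * (ev eNum / ev eDen))))).
  congr (2 * _ / _).
  rewrite -[ev (sder eM)]/(ev (nder eNum) / ev eDen + ev eNum * (-1 * (ev (nder eDen) * ((ev eDen)^-1 * (ev eDen)^-1))) +
    -1 * (be / al * ((2 * ev vp + -1 * 1) * (ev eNum / ev eDen)))).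
  rewrite -[ev (sder eNum)]/(ev (nder eNum) + -1 * (be / al * ((2 * ev vp + -1 * 1) * ev eNum))).
  by rewrite invfM; ring.
have eD : ev eDen = ev eF * ev eFk + ev eG * ev eGk by [].
have eD1 : ev (nder eDen) = ev (nder eF) * ev eFk + ev eF * ev (nder eFk) + (ev (nder eG) * ev eGk + ev eG * ev (nder eGk)) by [].
have eQ : ev eQk = ev eFk * ev eFk + ev eGk * ev eGk by [].
have D1 : ev eDen != 0 by rewrite gt_eqF // (lt_le_trans _ D0).
have Q1 : ev eQk != 0 by rewrite gt_eqF // (lt_le_trans _ Q0).
have Qs : ev eF ^+ 2 + ev eG ^+ 2 != 0.
  have : 0 < ev eF by move: b3 => /abs_le/andP[]; rewrite -/(ev eF); lra.
  by move=> h; rewrite gt_eqF // ltr_pwDl ?sqr_ge0 // exprn_gt0.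
move: hN hN1 hX eD eD1 eQ D1 Q1 Qs.
move: (sech _) (ev eF) (ev eG) (ev eFk) (ev eGk) (ev (nder eF)) (ev (nder eG)) (ev (nder eFk)) (ev (nder eGk)).
move: (ev eNum) (ev (sder eNum)) (ev eDen) (ev (nder eDen)) (ev eQk).
move=> N N1 D D1 Q S f g fk gk f1 g1 fk1 gk1 hN hN1 hX eD eD1 eQ D0' Q0' Qs.
(* The normalising factor [w] is real, so it leaves the argument unchanged and the terms with its
   derivative cancel. *)
set w := al ^+ 2 * (1 + expR (be * x + y) ^+ 2).
have w0 : w != 0 by rewrite mulf_neq0 // expf_neq0.
have -> : 2 * ((al ^+ 3 * (1 + expR (be * x + y) ^+ 2) * g1 + 2 * be * al ^+ 2 * expR (be * x + y) ^+ 2 * g) * (w * f) -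
   (al ^+ 3 * (1 + expR (be * x + y) ^+ 2) * f1 + 2 * be * al ^+ 2 * expR (be * x + y) ^+ 2 * f) * (w * g)) / ((w * f) ^+ 2 + (w * g) ^+ 2) =
   2 * al * (g1 * f - f1 * g) / (f ^+ 2 + g ^+ 2).
  have -> : (w * f) ^+ 2 + (w * g) ^+ 2 = w ^+ 2 * (f ^+ 2 + g ^+ 2) by ring.
  move: (f ^+ 2 + g ^+ 2) Qs => q Qs; rewrite /w; move: (expR _) nE => u nu.
  by field; rewrite ?Qs ?nu ?al_neq0.
(* Multiplicativity of the modulus for f conj(fk). It rewrites the denominator 1 + K^2 of the
   differentiated arctangent. *)
have key : f ^+ 2 + g ^+ 2 = (D ^+ 2 + (be / al * (S * N)) ^+ 2) / Q.
  by apply: (mulIf Q0'); rewrite divfK // hN eD eQ; ring.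
have key2 : 1 + (be / al * (S * (N / D))) ^+ 2 = (f ^+ 2 + g ^+ 2) * Q / D ^+ 2.
  by rewrite key divfK //; field; rewrite ?D0' ?al_neq0.
rewrite key2.
have -> : be * S * (2 * (N1 / D - N * (D1 / (D * D))) / ((f ^+ 2 + g ^+ 2) * Q / D ^+ 2)) =
   2 * al * ((be / al * (S * N1)) * D - (be / al * (S * N)) * D1) / ((f ^+ 2 + g ^+ 2) * Q).
  by move: (f ^+ 2 + g ^+ 2) Qs => q Qs; field; rewrite ?D0' ?Q0' ?Qs ?al_neq0.
have -> : be * (mu / al) * (be / al) * S * (- 16 * (S * Q^-1)) = 2 * al * (- 8 * (mu / al) * (be / al) ^+ 2 * S ^+ 2) / Q.
  by field; rewrite ?Q0' ?al_neq0.
rewrite -hX hN hN1 eD eD1.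
have -> : (g1 * fk + g * fk1 - f1 * gk - f * gk1) * (f * fk + g * gk) - (g * fk - f * gk) * (f1 * fk + f * fk1 + (g1 * gk + g * gk1)) =
  (g1 * f - f1 * g) * (fk * fk + gk * gk) - (gk1 * fk - fk1 * gk) * (f ^+ 2 + g ^+ 2) by ring.
rewrite -eQ; move: (f ^+ 2 + g ^+ 2) Qs (g1 * f - f1 * g) (gk1 * fk - fk1 * gk) => q Qs r1 r2.
by field; rewrite ?Q0' ?Qs.
Qed.
End Profile.

End BreatherProfile.

(** * Norms of breathers *)

Section BreatherBounds.
Context {R : realType}.
Implicit Types (f g F G : R -> R) (t x p q c a : R) (rho : nat -> R) (e X : expr R).
Notation leb := (@lebesgue_measure R).
Local Opaque eM eN1 eN2 eX eX1.

Lemma sech_ge0 (x : R) : 0 <= sech x.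
Proof. by rewrite divr_ge0 ?expR_ge0 // ltW // expR_sqr1_gt0. Qed.

Lemma sech_le_exp (x : R) : sech x <= expR (- `|x|).
Proof.
rewrite /sech ler_pdivrMr ?expR_sqr1_gt0 //; case: (lerP 0 x) => x0; rewrite ?(ger0_norm x0) ?(ltr0_norm x0).
- rewrite expRN mulrDr mulr1 expr2 mulrA mulVf ?mul1r ?lerDr ?invr_ge0 ?expR_ge0 //.
  by rewrite gt_eqF ?expR_gt0.
- by rewrite opprK mulrDr mulr1 lerDl mulr_ge0 ?expR_ge0 ?sqr_ge0.
Qed.

(** The factor 1 + |x| leaves room for phase errors that grow linearly along the envelope. The
    constant is 4^4, from expR |x| >= (1 + |x| / 4)^4. *)
Lemma sech_lor (x : R) : sech x * (1 + `|x|) <= 256 * lor x.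
Proof.
have a0 := normr_ge0 x; apply: le_trans (ler_wpM2r _ (sech_le_exp x)) _; first by rewrite addr_ge0.
have h4 : (1 + `|x| / 4) ^+ 4 <= expR `|x|.
  have -> : expR `|x| = expR (`|x| / 4) ^+ 4 by rewrite -expRM_natl; congr expR; rewrite mulrC divfK.
  by rewrite lerXn2r ?nnegrE ?expR_ge0 ?expR_ge1Dx // addr_ge0 // divr_ge0.
rewrite expRN mulrC ler_pdivrMr ?expR_gt0 // /lor mulrAC ler_pdivlMr ?sqr1_gt0 //.
apply: le_trans (ler_wpM2l (ler0n R 256) h4).
rewrite -(ger0_norm (sqr_ge0 x)) normrX; move: `|x| a0 => a a0.
have -> : 256 * (1 + a / 4) ^+ 4 = (4 + a) ^+ 4 by field.
have e1 : 1 + a <= 4 + a by rewrite lerD2r ler1n.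
have e2 : 1 + a ^+ 2 <= (4 + a) ^+ 3.
  by have := mulr_ge0 a0 a0; have := mulr_ge0 a0 (mulr_ge0 a0 a0); lra.
rewrite (exprS _ 3); apply: ler_pM => //; first by rewrite addr_ge0.
by rewrite addr_ge0 // sqr_ge0.
Qed.

Lemma sech_le_lor (x : R) : sech x <= 256 * lor x.
Proof.
apply: le_trans (sech_lor x); rewrite ler_peMr ?sech_ge0 // lerDl; exact: normr_ge0.
Qed.

Lemma sech_le1 (x : R) : sech x <= 1.
Proof.
rewrite /sech ler_pdivrMr ?expR_sqr1_gt0 // mul1r.
by have := sqr_ge0 (expR x - 1); have := expR_gt0 x; move: (expR x) => E; nra.
Qed.

Lemma lor_shift (a b : R) : lor (a + b) <= 2 * (1 + a ^+ 2) * lor b.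
Proof.
rewrite /lor ler_pdivlMr ?sqr1_gt0 // ler_pdivrMl ?sqr1_gt0 //.
have := sqr_ge0 (2 * a + b); have := sqr_ge0 (a * (a + b)); lra.
Qed.

Lemma tame_lor_scaled f (be y A : R) : 0 < be -> 0 <= A -> continuous f ->
  (forall x, `|f x| <= A * lor (be * x + y)) -> tame f.
Proof.
move=> be0 A0 cf hf; split=> //.
exists (A * (1 + (2 + 2 * y ^+ 2) / be ^+ 2)) => x; apply: le_trans (hf x) _.
rewrite -mulrA ler_wpM2l // /lor ler_pdivlMr ?sqr1_gt0 // ler_pdivrMl ?sqr1_gt0 //.
set u := be * x + y.
have hx : x ^+ 2 = (u - y) ^+ 2 / be ^+ 2.
  by rewrite /u addrK exprMn mulrAC mulfV ?mul1r // expf_neq0 // gt_eqF.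
rewrite hx; have i0 : 0 < (be ^+ 2)^-1 by rewrite invr_gt0 exprn_gt0.
move: (be ^+ 2)^-1 i0 => i i0.
have h : (u - y) ^+ 2 <= (1 + u ^+ 2) * (2 + 2 * y ^+ 2).
  by have := sqr_ge0 (u + y); have := sqr_ge0 (u * y); lra.
have := ler_wpM2r (ltW i0) h; have := sqr_ge0 u; lra.
Qed.

Lemma int_sqr_lor f (be y A : R) : 0 < be -> 0 <= A -> continuous f ->
  (forall x, `|f x| <= A * lor (be * x + y)) -> \int[leb]_x (f x ^+ 2) <= A ^+ 2 * (4 / be).
Proof.
move=> be0 A0 cf hf; have [i1 i2] := int_lor_scaled y be0.
have tf := tame_lor_scaled be0 A0 cf hf.
apply: (@le_trans _ _ (\int[leb]_x (A ^+ 2 * lor (be * x + y)))).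
  apply: int_le; first by apply: integ_ext (tame_integ (tame_mul tf tf)) => x; rewrite expr2.
    exact: integZ.
  move=> x; rewrite -(ger0_norm (sqr_ge0 (f x))) normrX.
  apply: (@le_trans _ _ ((A * lor (be * x + y)) ^+ 2)).
    by rewrite lerXn2r ?nnegrE // mulr_ge0 // lor_ge0.
  rewrite exprMn ler_wpM2l ?sqr_ge0 // expr2 ler_piMr ?lor_ge0 //; exact: lor_le1.
by rewrite RintegralZl // ler_wpM2l ?sqr_ge0.
Qed.

(** [energy_high] with N = al. The primitive is smaller by the factor 1 / al and the derivative
    larger by al, so both terms of that bound contribute equally. Each contains a Lorentzian
    integral 4 / be, hence 768 = 96 * 8. *)
Lemma energy_wave s (al be y A : R) F f g : has_deriv F f -> has_deriv f g ->
  continuous g -> tame f -> -1 <= s <= 1 -> 1 <= al -> 0 < be -> 0 <= A ->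
  (forall x, `|F x| <= A * (be / al) * lor (be * x + y)) ->
  (forall x, `|g x| <= A * (al * be) * lor (be * x + y)) ->
  (energy s f <= (768 * A ^+ 2 * (al `^ (2 * s) * be))%:E)%E.
Proof.
move=> d1 d2 cg tf s1 al1 be0 A0 hF hg; have al0 : 0 < al by exact: lt_le_trans al1.
have A1 : 0 <= A * (be / al) by rewrite mulr_ge0 // divr_ge0 // ltW.
have A2 : 0 <= A * (al * be) by rewrite !mulr_ge0 // ltW.
have cF := has_deriv_cont d1.
have tF := tame_lor_scaled be0 A1 cF hF; have tg := tame_lor_scaled be0 A2 cg hg.
apply: le_trans (energy_high d1 d2 tF tf tg s1 al1) _; rewrite lee_fin.
have iF := int_sqr_lor be0 A1 cF hF; have ig := int_sqr_lor be0 A2 cg hg.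
have -> : al `^ (2 * s + 2) = al `^ (2 * s) * al ^+ 2.
  rewrite powRD; last by apply/implyP => _; rewrite gt_eqF.
  by rewrite powR_mulrn // ltW.
have P0 : 0 <= 96 * (al `^ (2 * s) * al ^+ 2) by rewrite mulr_ge0 // mulr_ge0 ?powR_ge0 ?sqr_ge0.
have i4 : 0 <= al ^- 4 by rewrite invr_ge0 exprn_ge0 // ltW.
apply: le_trans (ler_wpM2l P0 (lerD iF (ler_wpM2l i4 ig))) _.
rewrite le_eqVlt; apply/orP; left; apply/eqP.
by move: (al `^ _) => P; field; rewrite !gt_eqF.
Qed.

Lemma energy_packet s (be y A B : R) f g : has_deriv f g -> continuous g -> s <= 1 ->
  0 < be -> 0 <= A -> 0 <= B ->
  (forall x, `|f x| <= A * lor (be * x + y)) -> (forall x, `|g x| <= B * lor (be * x + y)) ->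
  (energy s f <= (128 * (A ^+ 2 + (if s <= 0 then 0 else B ^+ 2)) / be)%:E)%E.
Proof.
move=> d cg s1 be0 A0 B0 hf hg; have cf := has_deriv_cont d.
have tf := tame_lor_scaled be0 A0 cf hf; have tg := tame_lor_scaled be0 B0 cg hg.
have i1 := int_sqr_lor be0 A0 cf hf; have i2 := int_sqr_lor be0 B0 cg hg.
case: ifPn => s0.
  apply: le_trans (energy_neg tf s0) _; rewrite lee_fin addr0; move: i1; rewrite mulrA; lra.
apply: le_trans (energy_pos d tf tg s1) _; rewrite lee_fin.
by move: i1 i2; rewrite !mulrA; lra.
Qed.

Definition lip_bound C e := forall rho1 rho2 h, admissible rho1 -> admissible rho2 ->
  (forall n, `|rho1 n - rho2 n| <= h) ->
  `|eeval rho1 e| <= C /\ `|eeval rho1 e - eeval rho2 e| <= C * h.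

Lemma admissible_le1 rho n : admissible rho -> `|rho n| <= 1.
Proof.
move=> [/andP[k0 k1] hm [hc hs] [/andP[S0 S1] /andP[p0 p1]] hr].
have i16 : 16^-1 <= 1 :> R by lra.
case: n => [|[|[|[|[|[|n]]]]]] //.
- by rewrite ger0_norm // (le_trans k1).
- by rewrite (le_trans hm).
- by rewrite ger0_norm.
- by rewrite ger0_norm.
- by rewrite hr normr0.
Qed.

(** The constant comes from the five expressions alone. The parameters, position and time enter only
    through the values of the variables, so one [C] serves all breathers. *)
Lemma profile_lipschitz : exists2 C, 0 < C &
  [/\ lip_bound C (@eM R), lip_bound C (@eN1 R), lip_bound C (@eN2 R), lip_bound C (@eX R) & lip_bound C (@eX1 R)].
Proof.
have [g1 g2 g3 g4 g5] := @admissible_guards R.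
have L e (ge : guarded admissible e) := eval_lipschitz (fun rho n => @admissible_le1 rho n) ge.
have [C1 p1 h1] := L _ g1; have [C2 p2 h2] := L _ g2; have [C3 p3 h3] := L _ g3.
have [C4 p4 h4] := L _ g4; have [C5 p5 h5] := L _ g5.
exists (1 + C1 + C2 + C3 + C4 + C5); first lra.
have W e C D : C <= D -> (forall rho1 rho2 h, admissible rho1 -> admissible rho2 ->
    (forall n, `|rho1 n - rho2 n| <= h) ->
    `|eeval rho1 e| <= C /\ `|eeval rho1 e - eeval rho2 e| <= C * h) -> lip_bound D e.
  move=> CD hC r1 r2 h a1 a2 hh; have [b1 b2] := hC _ _ _ a1 a2 hh.
  have h0 : 0 <= h by apply: le_trans (hh 0%N).
  by split; [exact: le_trans CD|apply: le_trans b2 _; rewrite ler_wpM2r].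
by split; [apply: W h1|apply: W h2|apply: W h3|apply: W h4|apply: W h5]; lra.
Qed.

Lemma lip_bound_abs C e rho : lip_bound C e -> admissible rho -> `|eeval rho e| <= C.
Proof. by move=> h a; have [] := h rho rho 0 a a (fun n => _) => // n; rewrite subrr normr0. Qed.

Lemma packetE (al be mu y th' : R) c X x :
  packet al be mu y th' c X x = c * sech (be * x + y) * eeval (profile_path al be mu y th' x) X.
Proof. by []. Qed.

Lemma breatherE (mu al be y0 th' : R) t : 0 < al -> 0 < be -> 16 * be <= al -> 16 * `|mu| <= al ->
  breather mu al be y0 th' t = (fun x =>
    bPhi1 al be mu (freq_re mu al be * t + y0) (freq_im mu al be * t + th') x +
    bkink al be mu (freq_re mu al be * t + y0) (freq_im mu al be * t + th') x).
Proof.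
by move=> al0 be0 hbe hmu; apply/funext => x; rewrite /breather; apply: breather_profile.
Qed.

Lemma breather_smooth2 (mu al be y0 th' : R) : 0 < al -> 0 < be -> 16 * be <= al -> 16 * `|mu| <= al ->
  smooth2 (breather mu al be y0 th').
Proof.
move=> al0 be0 hbe hmu.
pose v t x := be * x + (freq_re mu al be * t + y0).
pose w t x := al * x + (freq_im mu al be * t + th').
pose rho t x := profile_env (be / al) (mu / al) (v t x) (w t x).
pose e : expr R := EAdd (EMul (EMul (ECst be) (EVar 4)) (@eN1 R))
  (EMul (EMul (ECst (be * (mu / al) * (be / al))) (EVar 4)) (@eX R)).
have -> : breather mu al be y0 th' = (fun t x => eeval (rho t x) e).
  by apply/funext => t; rewrite breatherE.
have [_ gN _ gX _] := @admissible_guards R.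
have cE (c d k : R) : continuous (fun z : R * R => c * z.2 + (d * z.1 + k)).
  move=> z; apply: cvgD; first by apply: cvgM; [exact: cvg_cst|exact: cvg_snd].
  by apply: cvgD; [apply: cvgM; [exact: cvg_cst|exact: cvg_fst]|exact: cvg_cst].
have cexp : continuous (fun z : R * R => expR (v z.1 z.2)).
  by move=> z; apply: (@continuous_comp _ _ _ (fun z : R * R => v z.1 z.2) expR); [exact: cE|exact: continuous_expR].
(* In [ei] the single variable stands for expR y, so continuity of S and p in (t, x) is an instance
   of [eeval_continuous]. *)
pose ei : expr R := EInv (EAdd (ECst 1) (EMul (EVar 0) (EVar 0))).
have gi : guarded (fun _ : nat -> R => True) ei.
  split=> // r _ /=; apply: ler_norm_r.
  by have := sqr_ge0 (r 0%N); rewrite expr2; lra.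
have ci e' : guarded (fun _ : nat -> R => True) e' -> continuous (fun z : R * R => eeval (fun=> expR (v z.1 z.2)) e').
  by move=> g; exact: (@eeval_continuous R (fun=> True) (fun z _ => expR (v z.1 z.2)) e' (fun=> I) (fun=> cexp) g).
apply: (@eval_smooth2 R admissible rho
  (profile_der (ECst (freq_re mu al be)) (ECst (freq_im mu al be))) (profile_der (ECst be) (ECst al))).
- move=> t x; apply: profile_env_admissible.
    by rewrite divr_ge0 ?(ltW be0) ?(ltW al0) //= ler_pdivrMr //; lra.
  by rewrite normrM normfV (gtr0_norm al0) ler_pdivrMr //; lra.
- move=> n; case: n => [|[|[|[|[|[|n]]]]]] z /=.
  + exact: cvg_cst.
  + exact: cvg_cst.
  + by apply: (@continuous_comp _ _ _ (fun z : R * R => w z.1 z.2) cos); [exact: cE|exact: continuous_cos].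
  + by apply: (@continuous_comp _ _ _ (fun z : R * R => w z.1 z.2) sin); [exact: cE|exact: continuous_sin].
  + exact: (ci (EMul (EVar 0) ei) (conj I gi)).
  + exact: (ci (EMul (EMul (EVar 0) (EVar 0)) ei) (conj (conj I I) gi)).
  + exact: cvg_cst.
- by move=> n; apply: profile_der_guarded.
- by move=> n; apply: profile_der_guarded.
- move=> n x; apply: profile_env_deriv.
  + by apply: (has_deriv_ext (has_deriv_affine (freq_re mu al be) (be * x + y0))) => // t; rewrite /v; ring.
  + by apply: (has_deriv_ext (has_deriv_affine (freq_im mu al be) (al * x + th'))) => // t; rewrite /w; ring.
- by move=> n t; apply: profile_env_deriv; exact: has_deriv_affine.
- by do !split => //.
Qed.

Section Energies.
Variables (C : R).
Hypotheses (C0 : 0 < C) (hM : lip_bound C (@eM R)) (hN1 : lip_bound C (@eN1 R))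
  (hN2 : lip_bound C (@eN2 R)) (hX : lip_bound C (@eX R)) (hX1 : lip_bound C (@eX1 R)).

Lemma packet_bound (al be mu y th' : R) c X x : 0 < al -> 0 < be -> 16 * be <= al -> 16 * `|mu| <= al ->
  lip_bound C X -> `|packet al be mu y th' c X x| <= `|c| * C * sech (be * x + y).
Proof.
move=> al0 be0 hbe hmu hX'; rewrite packetE normrM normrM (ger0_norm (sech_ge0 _)) mulrAC.
apply: ler_wpM2r; first exact: sech_ge0.
apply: ler_wpM2l => //; apply: lip_bound_abs => //; exact: profile_path_admissible.
Qed.

Lemma packet_bound_lor (al be mu y th' : R) c X x : 0 < al -> 0 < be -> 16 * be <= al -> 16 * `|mu| <= al ->
  lip_bound C X -> `|packet al be mu y th' c X x| <= `|c| * C * 256 * lor (be * x + y).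
Proof.
move=> al0 be0 hbe hmu hX'; apply: le_trans (packet_bound y th' c x al0 be0 hbe hmu hX') _.
by rewrite -[leRHS]mulrA ler_wpM2l ?mulr_ge0 ?(ltW C0) // sech_le_lor.
Qed.

Lemma packet_cont (al be mu y th' : R) c X : 0 < al -> 0 < be -> 16 * be <= al -> 16 * `|mu| <= al ->
  guarded admissible X -> continuous (packet al be mu y th' c X).
Proof. by move=> al0 be0 hbe hmu gX; exact: has_deriv_cont (packet_deriv y th' al0 be0 hbe hmu c gX). Qed.

Lemma packet_tame (al be mu y th' : R) c X : 0 < al -> 0 < be -> 16 * be <= al -> 16 * `|mu| <= al ->
  guarded admissible X -> lip_bound C X -> tame (packet al be mu y th' c X).
Proof.
move=> al0 be0 hbe hmu gX hX'.
apply: (@tame_lor_scaled _ be y (`|c| * C * 256)).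
- exact: be0.
- by rewrite !mulr_ge0 // ltW.
- exact: packet_cont.
- by move=> x; exact: packet_bound_lor.
Qed.

Lemma bPhi_bound (al be mu y th' : R) x : 0 < al -> 0 < be -> 16 * be <= al -> 16 * `|mu| <= al ->
  `|bPhi al be mu y th' x| <= 512 * C * (be / al) * lor (be * x + y).
Proof.
move=> al0 be0 hbe hmu; rewrite /bPhi normrM ger0_norm //.
apply: (@le_trans _ _ (2 * `|eeval (profile_path al be mu y th' x) (@eK R)|)).
  by rewrite ler_wpM2l //; have := atan_lipschitz (eeval (profile_path al be mu y th' x) (@eK R)) 0; rewrite atan0 !subr0.
have -> : eeval (profile_path al be mu y th' x) (@eK R) = packet al be mu y th' (be / al) (@eM R) x.
  by rewrite packetE -mulrA.
have := packet_bound_lor y th' (be / al) x al0 be0 hbe hmu hM.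
have k0 : 0 <= be / al by rewrite divr_ge0 // ltW.
by rewrite (ger0_norm k0); lra.
Qed.

Lemma energy_bPhi1 s (al be mu y th' : R) : 1 <= al -> 0 < be -> 16 * be <= al -> 16 * `|mu| <= al ->
  -1 <= s <= 1 -> (energy s (bPhi1 al be mu y th') <= (768 * (512 * C) ^+ 2 * (al `^ (2 * s) * be))%:E)%E.
Proof.
move=> al1 be0 hbe hmu s1; have al0 : 0 < al by exact: lt_le_trans al1.
have [_ gN1 gN2 _ _] := @admissible_guards R.
apply: (energy_wave (y := y) (bPhi_deriv y th' al0 be0 hbe hmu) (bPhi1_deriv y th' al0 be0 hbe hmu)).
- exact: packet_cont.
- exact: packet_tame.
- exact: s1.
- exact: al1.
- exact: be0.
- by apply: mulr_ge0; [exact: ler0n|exact: ltW].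
- by move=> x; exact: bPhi_bound.
- move=> x; apply: le_trans (packet_bound_lor y th' _ x al0 be0 hbe hmu hN2) _.
  have k0 : 0 <= al * be by apply: mulr_ge0; exact: ltW.
  rewrite (ger0_norm k0); apply: ler_wpM2r; first exact: lor_ge0.
  by have := mulr_ge0 (mulr_ge0 (ltW al0) (ltW be0)) (ltW C0); lra.
Qed.

(** The amplitude be (mu / al)(be / al) gives an L2 energy of order mu^2 be^3 / al^4, at most mu^2 /
    al because be <= al. For s > 0 the derivative is estimated too and costs al^2; the resulting
    mu^2 be^3 / al^2 is where be <= 1 enters. *)
Lemma energy_bkink s (al be mu y th' : R) : 1 <= al -> 0 < be -> 16 * be <= al -> 16 * `|mu| <= al ->
  s <= 1 -> (0 < s -> be <= 1) ->
  (energy s (bkink al be mu y th') <= (128 * (256 * C) ^+ 2 * ((1 + mu ^+ 2) / al))%:E)%E.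
Proof.
move=> al1 be0 hbe hmu s1 hs; have al0 : 0 < al by exact: lt_le_trans al1.
have [_ _ _ gX gX1] := @admissible_guards R.
pose c := be * (mu / al) * (be / al).
apply: le_trans (energy_packet (y := y) (A := `|c| * C * 256) (B := `|al * c| * C * 256)
  (bkink_deriv y th' al0 be0 hbe hmu) _ s1 be0 _ _ _ _) _.
- exact: packet_cont.
- by rewrite !mulr_ge0 // ltW.
- by rewrite !mulr_ge0 // ltW.
- by move=> x; exact: packet_bound_lor.
- by move=> x; exact: packet_bound_lor.
rewrite lee_fin.
have n2 (z : R) : (`|z| * C * 256) ^+ 2 = z ^+ 2 * (256 * C) ^+ 2.
  by rewrite -(ger0_norm (sqr_ge0 z)) normrX; ring.
rewrite !n2.
set K := (256 * C) ^+ 2; have K0 : 0 <= K by exact: sqr_ge0.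
have -> : 128 * (c ^+ 2 * K + (if s <= 0 then 0 else (al * c) ^+ 2 * K)) / be =
    128 * K * ((c ^+ 2 + (if s <= 0 then 0 else (al * c) ^+ 2)) / be) by case: ifP => _; ring.
apply: ler_wpM2l; first by rewrite mulr_ge0.
set r := al^-1; have r0 : 0 < r by rewrite invr_gt0.
have hr : al * r = 1 by rewrite mulfV // gt_eqF.
have r1 : r <= 1 by rewrite invf_le1.
have kr : be * r <= 16^-1 by rewrite ler_pdivrMr //; lra.
have br0 : 0 <= be * r by rewrite mulr_ge0 // ltW.
have mu2 := sqr_ge0 mu.
have -> : c ^+ 2 = be * (mu ^+ 2 * (be * r) ^+ 2 * (be * r) * r) by rewrite /c -/r; ring.
have -> : (al * (be * (mu / al) * (be / al))) ^+ 2 = be * (mu ^+ 2 * (be * r) ^+ 2 * be * (al * r) ^+ 2).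
  by rewrite -/r; ring.
rewrite hr expr1n mulr1.
have k2 : (be * r) ^+ 2 <= 16^-1 by rewrite expr2; nra.
have m2 : mu ^+ 2 * (be * r) ^+ 2 <= mu ^+ 2 * 16^-1 by apply: ler_wpM2l.
have m0 : 0 <= mu ^+ 2 * (be * r) ^+ 2 by rewrite mulr_ge0 // sqr_ge0.
have h1 : mu ^+ 2 * (be * r) ^+ 2 * (be * r) * r <= mu ^+ 2 * 16^-1 * r.
  apply: ler_wpM2r; first exact: ltW.
  by move: (mu ^+ 2 * (be * r) ^+ 2) m2 m0 => z z1 z0; nra.
have cancel z : be * z / be = z by rewrite mulrAC mulfV ?mul1r // gt_eqF.
rewrite mulrDl cancel.
case: ifPn => s0.
  by rewrite mul0r addr0; have := mulr_ge0 mu2 (ltW r0); lra.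
have b1 : be <= 1 by apply: hs; rewrite ltNge.
rewrite cancel.
have h2 : mu ^+ 2 * (be * r) ^+ 2 * be <= mu ^+ 2 * 16^-1 * r.
  have e1 : (be * r) ^+ 2 * be <= 16^-1 * r.
    rewrite expr2 (mulrC _ be) mulrA; have : be * (be * r) <= 1 * 16^-1 by apply: ler_pM => //; exact: ltW.
    have : be * r <= r by rewrite ler_piMl // ltW.
    move=> hw hu; have := ler_pM (mulr_ge0 (ltW be0) br0) br0 hu hw.
    by rewrite mul1r !mulrA.
  by rewrite -(mulrA (mu ^+ 2)) -(mulrA (mu ^+ 2)); apply: ler_wpM2l.
by have := mulr_ge0 mu2 (ltW r0); lra.
Qed.

End Energies.

End BreatherBounds.

(** * Comparison of breathers and pairing with wave packets *)

Section BreatherPairs.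
Context {R : realType}.
Implicit Types (f g F G : R -> R) (t x p q c a : R) (rho : nat -> R) (e X : expr R).
Notation leb := (@lebesgue_measure R).

(** In the limit of separated scales the packet is -4 be [sech] times a cosine. The Lipschitz bound
    measures the distance to this limit by kap + |m|. *)
Lemma eN1_limit rho : rho 0%N = 0 -> rho 1%N = 0 -> eeval rho (@eN1 R) = - 4 * rho 2%N.
Proof.
move=> h0 h1; rewrite /eN1 /sder /eM /eDen /eNum /eF /eG /eFk /eGk /= h0 h1.
by rewrite !(mul0r, mulr0, addr0, add0r, mulr1, mul1r, invr1); ring.
Qed.

Local Opaque eM eN1 eN2 eX eX1.
Variables (C : R).
Hypotheses (C0 : 0 < C) (hM : lip_bound C (@eM R)) (hN1 : lip_bound C (@eN1 R))
  (hN2 : lip_bound C (@eN2 R)) (hX : lip_bound C (@eX R)) (hX1 : lip_bound C (@eX1 R)).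

Section Nearby.
Variables (al al' be mu y th' et : R).
Hypotheses (al1 : 1 <= al) (be0 : 0 < be) (hbe : 16 * be <= al) (hmu : 16 * `|mu| <= al)
  (et0 : 0 <= et) (ale : al' = al + et * be).
Let al0 : 0 < al. Proof. exact: lt_le_trans al1. Qed.
Let al_le : al <= al'. Proof. by rewrite ale lerDl mulr_ge0 // ltW. Qed.
Let al'0 : 0 < al'. Proof. exact: lt_le_trans al_le. Qed.
Let hbe' : 16 * be <= al'. Proof. exact: le_trans al_le. Qed.
Let hmu' : 16 * `|mu| <= al'. Proof. exact: le_trans al_le. Qed.
Let rho x := profile_path al be mu y th' x.
Let rho' x := profile_path al' be mu y (th' + et * y) x.

Let kap_le1 : be / al <= 1.
Proof. by rewrite ler_pdivrMr // mul1r; have := hbe; have := be0; lra. Qed.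

Let inv_diff z : 0 <= z -> 0 <= z / al - z / al' <= et * (be / al) * (z / al).
Proof.
move=> z0; have -> : z / al - z / al' = et * (be / al') * (z / al).
  by rewrite ale; field; rewrite -?ale !gt_eqF.
rewrite !mulr_ge0 ?invr_ge0 ?(ltW al0) ?(ltW al'0) ?(ltW be0) //=.
apply: ler_wpM2r; first by rewrite divr_ge0 // ltW.
apply: ler_wpM2l => //; apply: ler_wpM2l; first exact: ltW.
by rewrite lef_pV2 ?posrE.
Qed.

(** The phase shift et y of the second breather makes the phase difference equal to et times the
    envelope coordinate be x + y. It is therefore small where the envelope lives and grows only
    linearly elsewhere, which the decay in [sech_lor] absorbs. *)
Lemma nearby_env x n : `|rho x n - rho' x n| <= et * (1 + `|be * x + y|).
Proof.
have a0 := normr_ge0 (be * x + y).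
have E : al' * x + (th' + et * y) = (al * x + th') + et * (be * x + y) by rewrite ale; ring.
have small z : 0 <= z -> z <= al -> `|z / al - z / al'| <= et * (1 + `|be * x + y|).
  move=> z0 zl; have /andP[d0 d1] := inv_diff z0; rewrite ger0_norm //; apply: le_trans d1 _.
  rewrite -mulrA ler_wpM2l //; apply: (@le_trans _ _ (1 * 1)); last by rewrite mulr1 lerDl.
  apply: ler_pM kap_le1 _; rewrite ?divr_ge0 ?(ltW be0) ?(ltW al0) //.
  by rewrite ler_pdivrMr // mul1r.
have ang : `|et * (be * x + y)| <= et * (1 + `|be * x + y|).
  by rewrite normrM (ger0_norm et0) ler_wpM2l // lerDr.
case: n => [|[|[|[|n]]]].
- by rewrite /rho /rho' /=; apply: small; [exact: ltW|have := hbe; have := be0; lra].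
- rewrite /rho /rho' /=.
  have -> : mu / al - mu / al' = Num.sg mu * (`|mu| / al - `|mu| / al').
    by rewrite mulrBr !mulrA -numEsg.
  rewrite normrM; apply: le_trans (_ : 1 * `| `|mu| / al - `|mu| / al'| <= _).
    by apply: ler_wpM2r => //; rewrite normr_sg; case: (mu != 0).
  by rewrite mul1r; apply: small => //; have := hmu; have := normr_ge0 mu; lra.
- rewrite /rho /rho' /= E; apply: le_trans (cos_lipschitz _ _) _.
  by rewrite opprD addNKr normrN.
- rewrite /rho /rho' /= E; apply: le_trans (sin_lipschitz _ _) _.
  by rewrite opprD addNKr normrN.
- rewrite (_ : rho' x n.+4 = rho x n.+4) ?subrr ?normr0 ?mulr_ge0 ?addr_ge0 //.
Qed.

Let adm x : admissible (rho x). Proof. exact: profile_path_admissible. Qed.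
Let adm' x : admissible (rho' x). Proof. exact: profile_path_admissible. Qed.

Let scaled_diff X x (k k' : R) : lip_bound C X -> 0 <= k -> `|k - k'| <= et * k ->
  `|k * sech (be * x + y) * eeval (rho x) X - k' * sech (be * x + y) * eeval (rho' x) X| <=
    512 * C * et * k * lor (be * x + y).
Proof.
move=> hX' k0 hk; have [_ h2] := hX' _ _ _ (adm x) (adm' x) (nearby_env x).
have h1 := lip_bound_abs hX' (adm' x).
have s0 := sech_ge0 (be * x + y); have sl := sech_lor (be * x + y).
have a0 := normr_ge0 (be * x + y).
move: (sech _) (eeval _ _) (eeval _ _) s0 sl h1 h2 => S A B s0 sl h1 h2.
have -> : k * S * A - k' * S * B = S * (k * (A - B) + (k - k') * B) by ring.
rewrite normrM (ger0_norm s0).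
have b : `|k * (A - B) + (k - k') * B| <= 2 * (C * et * k) * (1 + `|be * x + y|).
  apply: le_trans (ler_normD _ _) _; rewrite !normrM (ger0_norm k0).
  have e1 : k * `|A - B| <= k * (C * (et * (1 + `|be * x + y|))) by apply: ler_wpM2l.
  have e2 : `|k - k'| * `|B| <= et * k * C by apply: ler_pM.
  have e3 : 0 <= C * et * k * `|be * x + y| by rewrite !mulr_ge0 // ltW.
  lra.
apply: le_trans (ler_wpM2l s0 b) _.
have c0 : 0 <= 2 * (C * et * k) by rewrite !mulr_ge0 // ltW.
by have := ler_wpM2l c0 sl; lra.
Qed.

Lemma energy_nearby s : -1 <= s <= 1 ->
  (energy s (fun x => bPhi1 al be mu y th' x - bPhi1 al' be mu y (th' + et * y) x)%R <=
    (768 * (1024 * C * et) ^+ 2 * (al `^ (2 * s) * be))%:E)%E.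
Proof.
move=> s1; have [_ gN1 gN2 _ _] := @admissible_guards R.
apply: (energy_wave (y := y)
  (has_derivB (bPhi_deriv y th' al0 be0 hbe hmu) (bPhi_deriv y (th' + et * y) al'0 be0 hbe' hmu'))
  (has_derivB (bPhi1_deriv y th' al0 be0 hbe hmu) (bPhi1_deriv y (th' + et * y) al'0 be0 hbe' hmu'))).
- by apply: contD; [|apply: contN]; apply: packet_cont.
- by apply: tameB; apply: (packet_tame C0).
- exact: s1.
- exact: al1.
- exact: be0.
- exact: mulr_ge0 (mulr_ge0 (ler0n _ _) (ltW C0)) et0.
- move=> x; rewrite /bPhi -mulrBr normrM ger0_norm //.
  have kE r : eeval r (@eK R) = r 0%N * r 4%N * eeval r (@eM R) by rewrite /= mulrA.
  have := @scaled_diff (@eM R) x (be / al) (be / al') hM.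
  have k0 : 0 <= be / al by rewrite divr_ge0 // ltW.
  have /andP[d0 d1] := inv_diff (ltW be0).
  move=> /(_ k0) h; have {}h := h _; apply: (@le_trans _ _ (2 * (512 * C * et * (be / al) * lor (be * x + y)))); last first.
    by rewrite le_eqVlt; apply/orP; left; apply/eqP; ring.
  apply: ler_wpM2l => //; apply: le_trans (atan_lipschitz _ _) _.
  rewrite !kE //; apply: h; rewrite ger0_norm //; apply: le_trans d1 _.
  by rewrite ler_wpM2r // ler_piMr.
- move=> x; have := @scaled_diff (@eN2 R) x (al * be) (al' * be) hN2.
  have k0 : 0 <= al * be by rewrite mulr_ge0 // ltW.
  move=> /(_ k0) h; apply: le_trans (h _) _.
    rewrite ale (_ : al * be - (al + et * be) * be = - (et * (be * be))); last by ring.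
    rewrite normrN ger0_norm ?mulr_ge0 ?(ltW be0) // ler_wpM2l // ler_wpM2r ?(ltW be0) //.
    by have := hbe; have := be0; lra.
  apply: ler_wpM2r; first exact: lor_ge0.
  by have : 0 <= C * et * (al * be) by [rewrite !mulr_ge0 // ltW|]; lra.
Qed.

End Nearby.

Lemma gauss_lor (k : R) (x : R) : 0 < k -> expR (- (k * x ^+ 2)) * (1 + x ^+ 2) <= (1 + 2 / k) ^+ 2 * lor x.
Proof.
move=> k0; rewrite expRN mulrC ler_pdivrMr ?expR_gt0 // /lor mulrAC ler_pdivlMr ?sqr1_gt0 // -expr2.
have -> : expR (k * x ^+ 2) = expR (k * x ^+ 2 / 2) ^+ 2.
  by rewrite -expRM_natl; congr expR; rewrite [RHS]mulrC divfK.
rewrite -exprMn lerXn2r ?nnegrE ?(ltW (sqr1_gt0 x)) //.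
  by rewrite mulr_ge0 ?expR_ge0 // addr_ge0 // divr_ge0 // ltW.
have h : 1 + k * x ^+ 2 / 2 <= expR (k * x ^+ 2 / 2) by exact: expR_ge1Dx.
have k2 : 0 <= 2 / k by rewrite divr_ge0 // ltW.
have k1 : 0 <= 1 + 2 / k by rewrite addr_ge0.
apply: le_trans (ler_wpM2l k1 h).
have -> : (1 + 2 / k) * (1 + k * x ^+ 2 / 2) = 1 + x ^+ 2 + 2 / k + k * x ^+ 2 / 2.
  by field; rewrite gt_eqF.
have q : 0 <= k * x ^+ 2 / 2 by rewrite divr_ge0 // mulr_ge0 ?sqr_ge0 // ltW.
by move: (2 / k) k2 (k * x ^+ 2 / 2) q => a a0 b b0; lra.
Qed.

Section Pairing.
Variables (al be mu : R).
Hypotheses (al1 : 1 <= al) (be0 : 0 < be) (hbe : 16 * be <= al) (hmu : 16 * `|mu| <= al).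
Let al0 : 0 < al. Proof. exact: lt_le_trans al1. Qed.
Let g := gauss (be ^+ 2 / 2) 0.
Let wave x := cos (al * x) * g x.

Let gE x : g x = expR (- (2^-1 * (be * x) ^+ 2)).
Proof. by rewrite /g /gauss subr0; congr (expR (- _)); ring. Qed.

Let g0 x : 0 <= g x. Proof. exact: ltW (gauss_gt0 _ _ _). Qed.

Let b2 : 0 < be ^+ 2 / 2. Proof. by rewrite divr_gt0 // exprn_gt0. Qed.

Let cwave : continuous wave.
Proof. by apply: contM; [exact: has_deriv_cont (has_deriv_cosl al)|exact: cont_gauss]. Qed.

Let wave_le x : `|wave x| <= g x.
Proof. by rewrite normrM (ger0_norm (g0 x)) ler_piMl // norm_cos. Qed.

Let g_lor x : g x * (1 + (be * x) ^+ 2) <= 25 * lor (be * x).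
Proof.
have i2 : 0 < 2^-1 :> R by rewrite invr_gt0.
rewrite gE; have := gauss_lor (be * x) i2.
by rewrite invrK (_ : (1 + 2 * 2) ^+ 2 = 25 :> R) //; ring.
Qed.

Let wave_lor x : `|wave x| * (1 + (be * x) ^+ 2) <= 25 * lor (be * x).
Proof.
apply: le_trans (g_lor x); apply: ler_wpM2r (wave_le x); exact: ltW (sqr1_gt0 _).
Qed.

Definition breather_at (al be mu y th' : R) x := bPhi1 al be mu y th' x + bkink al be mu y th' x.

Lemma breather_at_bound (al' y th' : R) x : al <= al' ->
  `|breather_at al' be mu y th' x| <= 2 * C * be * sech (be * x + y).
Proof.
move=> hal; have al'0 : 0 < al' by exact: lt_le_trans hal.
have hbe' : 16 * be <= al' by exact: le_trans hal.
have hmu' : 16 * `|mu| <= al' by exact: le_trans hal.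
apply: le_trans (ler_normD _ _) _.
have h1 := packet_bound y th' be x al'0 be0 hbe' hmu' hN1.
have h2 := packet_bound y th' (be * (mu / al') * (be / al')) x al'0 be0 hbe' hmu' hX.
apply: le_trans (lerD h1 h2) _.
rewrite -mulrDl -mulrDl; apply: ler_wpM2r; first exact: sech_ge0.
rewrite (_ : 2 * C * be = 2 * be * C); last by ring.
apply: ler_wpM2r; first exact: ltW.
rewrite !normrM (gtr0_norm be0) normfV (gtr0_norm al'0).
have k1 : `|mu| / al' <= 1 by rewrite ler_pdivrMr // mul1r; have := hmu'; have := normr_ge0 mu; lra.
have k2 : be / al' <= 1 by rewrite ler_pdivrMr // mul1r; have := hbe'; have := be0; lra.
have p1 : 0 <= `|mu| / al' by rewrite divr_ge0 // ltW.
have p2 : 0 <= be / al' by rewrite divr_ge0 // ltW.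
have := ler_pM p1 p2 k1 k2; rewrite mulr1 => h.
have := ler_wpM2l (ltW be0) h; rewrite mulr1 -!mulrA; lra.
Qed.

Lemma breather_at_tame (al' y th' : R) : al <= al' -> tame (breather_at al' be mu y th').
Proof.
move=> hal; have al'0 : 0 < al' by exact: lt_le_trans hal.
have hbe' : 16 * be <= al' by exact: le_trans hal.
have hmu' : 16 * `|mu| <= al' by exact: le_trans hal.
have [_ gN1 _ gX _] := @admissible_guards R.
by apply: tameD; apply: (packet_tame C0).
Qed.

(** The test wave sits at 0 and the envelope at -y / be. [lor_shift] extracts the gain [lor y] at
    the price of a factor 1 + (be x)^2, for which the Gaussian of the test wave pays. *)
Lemma breather_pairing_far (al' y th' : R) : al <= al' ->
  `|\int[leb]_x (breather_at al' be mu y th' x * wave x)| <= 320 * 320 * C * lor y.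
Proof.
move=> hal; have [i1 i2] := int_lor_scaled 0 be0.
have tb := breather_at_tame y th' hal.
(* 160^2 = 1024 * 25: the first factor bounds the breather, the second the weighted test wave. The
   Lorentzian integral brings another 4. *)
pose K := 160 * 160 * C * be * lor y.
have K0 : 0 <= K.
  by apply: mulr_ge0 (lor_ge0 y); apply: mulr_ge0 (ltW be0); apply: mulr_ge0 (ltW C0); lra.
have hb x : `|breather_at al' be mu y th' x * wave x| <= K * lor (be * x + 0).
  rewrite normrM addr0.
  have h1 : `|breather_at al' be mu y th' x| <= 512 * C * be * (2 * (1 + (be * x) ^+ 2) * lor y).
    apply: le_trans (breather_at_bound y th' x hal) _.
    have h2 : sech (be * x + y) <= 256 * (2 * (1 + (be * x) ^+ 2) * lor y).
      by apply: le_trans (sech_le_lor _) _; apply: ler_wpM2l (lor_shift _ _); exact: ler0n.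
    have c0 : 0 <= 2 * C * be by apply: mulr_ge0 (ltW be0); exact: mulr_ge0 (ler0n _ _) (ltW C0).
    by have := ler_wpM2l c0 h2; lra.
  apply: le_trans (ler_wpM2r (normr_ge0 _) h1) _.
  have c0 : 0 <= 1024 * C * be * lor y.
    by apply: mulr_ge0 (lor_ge0 y); apply: mulr_ge0 (ltW be0); exact: mulr_ge0 (ler0n _ _) (ltW C0).
  by have := ler_wpM2l c0 (wave_lor x); rewrite /K; lra.
have iK : integ (fun x => K * lor (be * x + 0)) by exact: integZ.
apply: le_trans (int_norm_le _ iK hb) _.
  apply: integ_dom iK; last exact: hb.
  by apply: cont_meas; apply: contM; [exact: tb.1|exact: cwave].
rewrite RintegralZl //; apply: le_trans (ler_wpM2l K0 i2) _.
have -> : K * (4 / be) = 4 * (160 * 160 * C * lor y) by rewrite /K; field; rewrite gt_eqF.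
by have := mulr_ge0 (ltW C0) (lor_ge0 y); lra.
Qed.

(** Not the value of [sech] at 1 but a lower bound of [sech] on [0, 1], where the numerator is at
    least 1. *)
Definition sech1 : R := (1 + expR 1 ^+ 2)^-1.

(** Replacing the breather by its limit costs a multiple of C (kap + |m|). The limit has the same
    phase as the test wave, so the remaining integrand contains the square of a cosine. It is
    nonnegative, and the interval [0, 1 / be] alone gives a fixed amount. *)
Lemma breather_pairing_near :
  sech1 / 2 - 100 * C * (be / al + `|mu| / al) <=
  - \int[leb]_x (breather_at al be mu 0 0 x * wave x).
Proof.
set h := be / al + `|mu| / al.
have p1 : 0 <= `|mu| / al by rewrite divr_ge0 // ltW.
have p2 : 0 <= be / al by rewrite divr_ge0 // ltW.
have h0 : 0 <= h by rewrite addr_ge0.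
have tb := breather_at_tame 0 0 (lexx al).
have adm x := profile_path_admissible 0 0 al0 be0 hbe hmu x.
have k2 : be / al <= 1 by rewrite ler_pdivrMr // mul1r; have := hbe; have := be0; lra.
have s0 x := sech_ge0 (be * x).
have approx x : `|breather_at al be mu 0 0 x + 4 * be * sech (be * x) * cos (al * x)| <= 2 * C * h * be.
  pose rho := profile_env 0 0 (be * x + 0) (al * x + 0).
  have arho : admissible rho.
    by apply: profile_env_admissible; rewrite ?normr0 ?lexx /= invr_ge0.
  have cl n : `|profile_path al be mu 0 0 x n - rho n| <= h.
    case: n => [|[|[|[|[|[|n]]]]]]; rewrite /profile_path /rho /= ?subrr ?subr0 ?normr0 //.
    - by rewrite ger0_norm // lerDl.
    - by rewrite normrM normfV (gtr0_norm al0) lerDr.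
  have [_ hh] := hN1 (adm x) arho cl.
  have e0 : eeval rho (@eN1 R) = - 4 * cos (al * x) by rewrite eN1_limit // /rho /= addr0.
  rewrite e0 in hh.
  have e1 : breather_at al be mu 0 0 x + 4 * be * sech (be * x) * cos (al * x) =
     be * sech (be * x) * (eeval (profile_path al be mu 0 0 x) (@eN1 R) - - 4 * cos (al * x)) + bkink al be mu 0 0 x.
    by rewrite /breather_at /bPhi1 packetE addr0; ring.
  rewrite e1; apply: le_trans (ler_normD _ _) _.
  have b1 : `|be * sech (be * x) * (eeval (profile_path al be mu 0 0 x) (@eN1 R) - - 4 * cos (al * x))| <= be * (C * h).
    rewrite normrM normrM (gtr0_norm be0) (ger0_norm (s0 x)) -mulrA ler_wpM2l ?(ltW be0) //.
    apply: le_trans hh; rewrite ler_piMl //; exact: sech_le1.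
  have b2' : `|bkink al be mu 0 0 x| <= be * (C * h).
    apply: le_trans (packet_bound 0 0 _ x al0 be0 hbe hmu hX) _.
    rewrite addr0 normrM normrM (gtr0_norm be0) (ger0_norm p2) normrM normfV (gtr0_norm al0).
    have q1 : `|mu| / al * (be / al) <= h.
      by apply: le_trans (_ : `|mu| / al <= _); [rewrite ler_piMr|rewrite lerDr].
    have q0 : 0 <= C * sech (be * x) by rewrite mulr_ge0 // ltW.
    have q2 : C * sech (be * x) <= C by rewrite ler_piMr ?(ltW C0) //; exact: sech_le1.
    rewrite -[_ * C * _]mulrA -(mulrA be) -(mulrA be) ler_wpM2l ?(ltW be0) // [leRHS]mulrC.
    by apply: ler_pM => //; rewrite mulr_ge0.
  have := lerD b1 b2'; lra.
have [ig0 ig1] := (tame_integ (tame_gauss 0 b2), int_gauss_le 0 b2).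
have sq : be / 2 <= Num.sqrt (be ^+ 2 / 2).
  have e : be / 2 = Num.sqrt ((be / 2) ^+ 2) by rewrite sqrtr_sqr ger0_norm // divr_ge0 // ltW.
  by rewrite e ler_wsqrtr // expr_div_n; have := sqr_ge0 be; lra.
have ig2 : \int[leb]_x g x <= 8 / be.
  apply: le_trans ig1 _; rewrite (_ : 8 / be = 4 / (be / 2)); last by field; rewrite gt_eqF.
  rewrite ler_wpM2l // lef_pV2 ?posrE ?sqrtr_gt0 // divr_gt0 //.
pose m x := 4 * be * sech (be * x) * cos (al * x) ^+ 2 * g x.
have csech : continuous (fun x => sech (be * x)).
  have dE := has_deriv_expR (has_derivZ be (@has_deriv_id R)).
  apply: (@contM R _ (fun x => (1 + expR (be * x) ^+ 2)^-1)); first exact: has_deriv_cont dE.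
  have d2 : has_deriv (fun x => 1 + expR (be * x) ^+ 2) (fun x => 2 * be * expR (be * x) ^+ 2).
    by apply: (has_deriv_ext (has_derivD (has_deriv_cst 1) (has_derivM dE dE))) => x; rewrite ?expr2 //; ring.
  by apply: has_deriv_cont (has_derivV _ d2) => x; rewrite gt_eqF // expR_sqr1_gt0.
have cm : continuous m.
  apply: contM; last exact: cont_gauss.
  apply: contM; first by apply: contM => //; exact: contC.
  rewrite (_ : (fun x => cos (al * x) ^+ 2) = (fun x => cos (al * x) * cos (al * x))) //.
  by apply: contM; exact: has_deriv_cont (has_deriv_cosl al).
have m0 x : 0 <= m x.
  exact: mulr_ge0 (mulr_ge0 (mulr_ge0 (mulr_ge0 (ler0n _ _) (ltW be0)) (s0 x)) (sqr_ge0 _)) (g0 x).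
have im : integ m.
  apply: (@integ_dom R m (fun x => 4 * be * g x)); first exact: cont_meas.
    move=> x; rewrite ger0_norm // /m; apply: ler_wpM2r => //.
    have c1 : cos (al * x) ^+ 2 <= 1 by have := cos2Dsin2 (al * x); have := sqr_ge0 (sin (al * x)); lra.
    have := ler_pM (s0 x) (sqr_ge0 _) (sech_le1 (be * x)) c1; rewrite mulr1 => q.
    have b4 : 0 <= 4 * be by exact: mulr_ge0 (ler0n _ _) (ltW be0).
    by have := ler_wpM2l b4 q; rewrite mulr1 mulrA.
  exact: integZ.
pose r x := (breather_at al be mu 0 0 x + 4 * be * sech (be * x) * cos (al * x)) * wave x.
have hr x : `|r x| <= 2 * C * h * be * g x.
  by rewrite normrM; apply: ler_pM (approx x) (wave_le x).
have ir : integ r.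
  apply: (@integ_dom R r (fun x => 2 * C * h * be * g x)); [|exact: hr|exact: integZ].
  apply: cont_meas; apply: contM => //; apply: contD; first exact: tb.1.
  by apply: contM; [apply: contM => //; exact: contC|exact: has_deriv_cont (has_deriv_cosl al)].
have -> : - (\int[leb]_x (breather_at al be mu 0 0 x * wave x)) =
    (\int[leb]_x m x) - (\int[leb]_x r x).
  rewrite -RintegralB // -mulN1r -RintegralZl //.
    by apply: eq_Rintegral => x _; rewrite /m /r /wave; ring.
  apply: integ_ext (integB ir im) => x; rewrite /m /r /wave; ring.
have hri : `|\int[leb]_x r x| <= 16 * C * h.
  apply: le_trans (int_norm_le ir (integZ _ ig0) hr) _; rewrite RintegralZl //.
  have k0 : 0 <= 2 * C * h * be := mulr_ge0 (mulr_ge0 (mulr_ge0 (ler0n _ _) (ltW C0)) h0) (ltW be0).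
  apply: le_trans (ler_wpM2l k0 ig2) _.
  by rewrite le_eqVlt; apply/orP; left; apply/eqP; field; rewrite gt_eqF.
have hmi : sech1 / 2 <= \int[leb]_x m x.
  (* Primitive of the minorant 2 be sech1 cos(al x)^2. Its oscillating part contributes at most be /
     al <= 1/16 of the main term. *)
  pose G x := be * sech1 * (x + al^-1 * (sin (al * x) * cos (al * x))).
  have dG : has_deriv G (fun x => 2 * be * sech1 * cos (al * x) ^+ 2).
    apply: (has_deriv_ext (has_derivZ (be * sech1) (has_derivD (@has_deriv_id R)
      (has_derivZ al^-1 (has_derivM (has_deriv_sinl al) (has_deriv_cosl al)))))) => // x.
    have -> : 2 * be * sech1 * cos (al * x) ^+ 2 = be * sech1 * (1 + (cos (al * x) ^+ 2 - sin (al * x) ^+ 2)).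
      by rewrite (sin2cos2 (al * x)); ring.
    by congr (_ * (_ + _)); field; rewrite gt_eqF.
  have s1 : 0 <= sech1 by rewrite invr_ge0 ltW // expR_sqr1_gt0.
  have ib0 : 0 < be^-1 by rewrite invr_gt0.
  have c2 : continuous (fun x => 2 * be * sech1 * cos (al * x) ^+ 2).
    apply: contM; first exact: contC.
    rewrite (_ : (fun x => cos (al * x) ^+ 2) = (fun x => cos (al * x) * cos (al * x))) //.
    by apply: contM; exact: has_deriv_cont (has_deriv_cosl al).
  apply: le_trans (_ : G be^-1 - G 0 <= _).
  - rewrite /G !mulr0 sin0 mul0r mulr0 addr0 mulr0 subr0.
    have hs : - be / al <= be * (al^-1 * (sin (al * be^-1) * cos (al * be^-1))).
      have : `|sin (al * be^-1) * cos (al * be^-1)| <= 1.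
        by rewrite normrM -[leRHS]mulr1; apply: ler_pM => //; [exact: norm_sin|exact: norm_cos].
      move: (_ * cos _) => z; rewrite ler_norml => /andP[z1 _].
      by rewrite mulrA mulNr -mulrN1; apply: ler_wpM2l.
    have hk : be / al <= 16^-1 by rewrite ler_pdivrMr //; have := hbe; lra.
    rewrite -mulrA mulrCA mulrDr mulfV ?gt_eqF //; apply: ler_wpM2l => //; lra.
  - apply: (int_ge_itv ib0 cm im m0 c2 dG) => x /andP[x0 x1]; apply/andP; split.
      exact: mulr_ge0 (mulr_ge0 (mulr_ge0 (ler0n _ _) (ltW be0)) s1) (sqr_ge0 _).
    have u0 : 0 <= be * x by rewrite mulr_ge0 // ltW.
    have u1 : be * x <= 1 by rewrite mulrC -ler_pdivlMr // mul1r.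
    have g1 : 2^-1 <= g x.
      rewrite gE; apply: le_trans (expR_ge1Dx _).
      by have : (be * x) ^+ 2 <= 1; [rewrite expr2; nra|lra].
    have E1 : 1 <= expR (be * x) by rewrite -expR0 ler_expR.
    have E2 : expR (be * x) <= expR 1 by rewrite ler_expR.
    have s2 : sech1 <= sech (be * x).
      rewrite /sech1 /sech ler_pdivlMr ?expR_sqr1_gt0 // ler_pdivrMl ?expR_sqr1_gt0 //.
      by move: (expR (be * x)) (expR 1) E1 E2 => a b a1 ab; nra.
    have q : sech1 * 2^-1 <= sech (be * x) * g x by apply: ler_pM => //; rewrite invr_ge0.
    have k0 : 0 <= 4 * be * cos (al * x) ^+ 2 := mulr_ge0 (mulr_ge0 (ler0n _ _) (ltW be0)) (sqr_ge0 _).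
    by have := ler_wpM2l k0 q; rewrite /m; lra.
have := mulr_ge0 (ltW C0) h0; move: hri; rewrite ler_norml => /andP[_ hr2]; lra.
Qed.
End Pairing.
End BreatherPairs.

(** * Lower bound for the distance of separated breathers *)

Section BreatherSeparation.
Context {R : realType}.
Implicit Types (s x xi al be u : R).
Notation leb := (@lebesgue_measure R).

Lemma powR_le_base x p : 1 <= x -> 0 <= p <= 1 -> x `^ p <= x.
Proof.
move=> x1 /andP[p0 p1]; have x0 : 0 <= x by exact: le_trans x1.
by rewrite -[leRHS](powRr1 x0); exact: ler_powR.
Qed.

(** A Peetre type inequality raised to a power between 0 and 1, with u the distance to [al] in units
    of [be]. For s <= 0 it bounds xi by [al] and uses be <= al. For s > 0 it bounds [al] by xi, and
    since xi may then be small, be <= 1 is used. *)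
Lemma weight_near s al be xi : -1 <= s <= 1 -> 1 <= al -> 0 < be -> be <= al -> (0 < s -> be <= 1) ->
  weight (- s) xi <= 3 * al `^ (- (2 * s)) * (1 + ((xi - al) / be) ^+ 2).
Proof.
move=> /andP[sl sr] al1 be0 hbe hs; set u := (xi - al) / be.
have xiE : xi = al + be * u by rewrite /u mulrCA mulfV ?gt_eqF // mulr1 addrC subrK.
have al0 : 0 <= al by exact: le_trans al1.
have W1 := sqr1_ge1 xi; have Q1 := sqr1_ge1 u.
have W0 := ltW (sqr1_gt0 xi); have Q0 := ltW (sqr1_gt0 u).
have sqE p : (al ^+ 2) `^ p = al `^ (2 * p) by rewrite -powR_mulrn // -powRrM.
rewrite /weight; case: (lerP s 0) => s0.
  have p01 : 0 <= - s <= 1 by lra.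
  have hW : 1 + xi ^+ 2 <= 3 * al ^+ 2 * (1 + u ^+ 2).
    have h1 : be ^+ 2 * u ^+ 2 <= al ^+ 2 * u ^+ 2.
      by apply: (ler_wpM2r (sqr_ge0 u)); rewrite lerXn2r ?nnegrE // ltW.
    have h2 : 1 <= al ^+ 2 by rewrite expr_ge1.
    have h3 := sqr_ge0 (al - be * u); have h4 := mulr_ge0 (sqr_ge0 al) (sqr_ge0 u).
    by rewrite xiE; move: h1 h2 h3 h4; rewrite !expr2 => h1 h2 h3 h4; lra.
  apply: le_trans (_ : (3 * al ^+ 2 * (1 + u ^+ 2)) `^ (- s) <= _).
    by apply: ge0_ler_powR; rewrite ?nnegrE ?mulr_ge0 ?sqr_ge0 //; case/andP: p01.
  rewrite powRM ?mulr_ge0 ?sqr_ge0 // powRM ?sqr_ge0 // sqE mulrN.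
  apply: ler_pM; rewrite ?mulr_ge0 ?powR_ge0 //; last exact: powR_le_base.
  by apply: ler_wpM2r; [exact: powR_ge0|apply: powR_le_base => //; lra].
have p01 : 0 <= s <= 1 by lra.
have {}hs := hs s0.
have hW : al ^+ 2 <= 2 * (1 + xi ^+ 2) * (1 + u ^+ 2).
  have h1 : be ^+ 2 * u ^+ 2 <= 1 * u ^+ 2.
    by apply: (ler_wpM2r (sqr_ge0 u)); rewrite expr_le1 // ltW.
  have h3 := sqr_ge0 (xi + be * u); have h4 := mulr_ge0 (sqr_ge0 xi) (sqr_ge0 u).
  have -> : al = xi - be * u by rewrite xiE; ring.
  by move: h1 h3 h4; rewrite !expr2 => h1 h3 h4; lra.
have hp : al `^ (2 * s) <= 2 * (1 + xi ^+ 2) `^ s * (1 + u ^+ 2).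
  rewrite -sqE; apply: le_trans (_ : (2 * (1 + xi ^+ 2) * (1 + u ^+ 2)) `^ s <= _).
    by apply: ge0_ler_powR; rewrite ?nnegrE ?mulr_ge0 ?sqr_ge0 // ltW.
  rewrite powRM ?mulr_ge0 // powRM //.
  apply: ler_pM; rewrite ?mulr_ge0 ?powR_ge0 //; last exact: powR_le_base.
  by apply: ler_wpM2r; [exact: powR_ge0|apply: powR_le_base => //; lra].
have A0 : 0 < al `^ (2 * s) by rewrite powR_gt0 // (lt_le_trans ltr01).
have B0 : 0 < (1 + xi ^+ 2) `^ s by rewrite powR_gt0 // sqr1_gt0.
rewrite !powRN; move: hp A0 B0; move: (al `^ _) (_ `^ s) => A B hp A0 B0.
rewrite -[leLHS]mul1r ler_pdivrMr //.
have -> : 3 * A^-1 * (1 + u ^+ 2) * B = 3 * B * (1 + u ^+ 2) / A by ring.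
by rewrite ler_pdivlMr // mul1r; have := mulr_ge0 (ltW B0) Q0; lra.
Qed.

Local Opaque eM eN1 eN2 eX eX1.
Variables (C : R).
Hypotheses (C0 : 0 < C) (hN1 : lip_bound C (@eN1 R)) (hX : lip_bound C (@eX R)).

(** The test function [psi] is a Gaussian of width [be] around the frequency [al], with transform
    [K] times the test wave of the two pairings. The pairing is at least (be / 3) P, and the squared
    dual norm of [psi] is at most 108 al^(-2s) be; 972 = 9 * 108. *)
Lemma breather_separation s al al' be mu y th' N :
  1 <= al -> al <= al' -> 0 < be -> 16 * be <= al -> 16 * `|mu| <= al -> -1 <= s <= 1 -> (0 < s -> be <= 1) ->
  let P := @sech1 R / 2 - 100 * C * (be / al + `|mu| / al) - 320 * 320 * C * lor y in
  0 <= P ->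
  (Hs_norm s (breather_at al be mu 0 0 \- breather_at al' be mu y th')%R < N%:E)%E ->
  P ^+ 2 * (al `^ (2 * s) * be) <= 972 * N ^+ 2.
Proof.
move=> al1 hal be0 hbe hmu s1 hs P P0 hN.
have al0 : 0 < al by exact: lt_le_trans al1.
have hbl : be <= al by lra.
set a := (2 * be ^+ 2)^-1; have b20 : 0 < be ^+ 2 by rewrite exprn_gt0.
have a0 : 0 < a by rewrite invr_gt0 mulr_gt0.
set psi := gauss a al; set g := gauss (be ^+ 2 / 2) 0.
have t1 := breather_at_tame C0 hN1 hX al1 be0 hbe hmu 0 0 (lexx al).
have t2 := breather_at_tame C0 hN1 hX al1 be0 hbe hmu y th' hal.
have p1 := breather_pairing_near C0 hN1 hX al1 be0 hbe hmu.
have p2 := breather_pairing_far C0 hN1 hX al1 be0 hbe hmu y th' hal.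
set K := \int[leb]_x psi x.
have aE : be ^+ 2 / 2 = (4 * a)^-1 by rewrite /a; field; rewrite gt_eqF.
have psiE x : fourier_cos psi x = K * (cos (al * x) * g x).
  by rewrite fourier_cos_gauss // -mulrA -aE.
have K1 : be / 3 <= K.
  apply: le_trans (int_gauss_ge al a0); rewrite invfM mulrC ler_wpM2l // -sqrtrV ?(ltW a0) //.
  rewrite invrK -[leLHS](ger0_norm (ltW be0)) -sqrtr_sqr ler_wsqrtr //; move: b20; lra.
pose A := al `^ (- (2 * s)).
have A0 : 0 < A by rewrite powR_gt0.
pose B := Num.sqrt (108 * A * be).
have BB : B ^+ 2 = 108 * A * be by rewrite sqr_sqrtr // ltW // mulr_gt0 // mulr_gt0.
have psi2 : (\int[leb]_xi (weight (- s) xi * psi xi ^+ 2)%:E <= (B ^+ 2)%:E)%E.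
  have [i1 i2] := int_lor_scaled (- (al / be)) (ltac:(by rewrite invr_gt0) : 0 < be^-1).
  (* 27 = 3 * 9, with 3 from [weight_near] and 9 from [gauss_lor] at k = 1. The Lorentzian integral
     4 be turns 27 into 108. *)
  have hb xi : `|weight (- s) xi * psi xi ^+ 2| <= 27 * A * lor (be^-1 * xi + - (al / be)).
    have -> : be^-1 * xi + - (al / be) = (xi - al) / be by ring.
    set u := (xi - al) / be.
    have e : psi xi ^+ 2 = expR (- (1 * u ^+ 2)).
      rewrite /psi /gauss -expRM_natl; congr expR; rewrite /a /u.
      by field; rewrite gt_eqF.
    rewrite (ger0_norm (mulr_ge0 (ltW (weight_gt0 _ _)) (sqr_ge0 _))).
    apply: le_trans (ler_wpM2r (sqr_ge0 _) (weight_near xi s1 al1 be0 hbl hs)) _; rewrite -/u e.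
    have := gauss_lor u ltr01; rewrite divr1 => h.
    have c0 : 0 <= 3 * A by rewrite mulr_ge0 // ltW.
    have := ler_wpM2l c0 h; rewrite /A; move: (expR _) (lor u) => *; lra.
  have im : integ (fun xi => weight (- s) xi * psi xi ^+ 2).
    apply: integ_dom hb (integZ _ i1); apply: cont_meas; apply: contM; first exact: weight_cont.
    rewrite (_ : (fun xi => psi xi ^+ 2) = (fun xi => psi xi * psi xi)) //.
    by apply: contM; exact: cont_gauss.
  rewrite int_EFin // lee_fin BB; apply: le_trans (int_le im (integZ (27 * A) i1) _) _.
    by move=> xi; apply: le_trans (ler_norm _) (hb xi).
  rewrite RintegralZl //; have c0 : 0 <= 27 * A by rewrite mulr_ge0 // ltW.
  by have := ler_wpM2l c0 i2; rewrite invrK; lra.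
have B0 : 0 <= B by exact: sqrtr_ge0.
have := Hs_norm_duality (tameB t1 t2) B0 (schwartz_gauss al a0) (tame_integ (tame_gauss al a0)) psi2 hN.
have iw f : tame f -> integ (fun x => f x * (cos (al * x) * g x)).
  move=> tf; have mc : measurable_fun [set: R] (fun x => cos (al * x)).
    by apply: cont_meas; exact: has_deriv_cont (has_deriv_cosl al).
  have := integ_mul_bounded (tame_integ (tame_gauss 0 (divr_gt0 b20 (ltr0n _ 2))))
    (measurable_funM (cont_meas tf.1) mc).
  have [_ [D hD]] := tf.
  move=> /(_ D) h; apply: integ_ext (h _) => x; first by rewrite mulrA.
  rewrite normrM -[leRHS]mulr1; apply: ler_pM => //; last exact: norm_cos.
  apply: le_trans (hD x) _; rewrite ler_piMr ?lor_le1 //.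
  by have := le_trans (normr_ge0 _) (hD x); rewrite pmulr_lge0 ?lor_gt0.
have i1 := iw _ t1; have i2 := iw _ t2.
have -> : \int[leb]_x ((breather_at al be mu 0 0 x - breather_at al' be mu y th' x) * fourier_cos psi x) =
  K * ((\int[leb]_x (breather_at al be mu 0 0 x * (cos (al * x) * g x))) -
       (\int[leb]_x (breather_at al' be mu y th' x * (cos (al * x) * g x)))).
  rewrite -RintegralB // -RintegralZl //; last exact: integB.
  by apply: eq_Rintegral => x _; rewrite psiE; ring.
have K0 : 0 <= K by apply: le_trans K1; rewrite divr_ge0 // ltW.
rewrite normrM (ger0_norm K0) => h.
have h1 : be / 3 * P <= N * B.
  apply: le_trans h; apply: ler_pM K1 _; rewrite ?divr_ge0 ?(ltW be0) //.
  rewrite distrC; apply: le_trans (ler_norm _).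
  move: p1 p2; rewrite ler_norml /P -/g.
  move: (\int[leb]_x _) (\int[leb]_x _) (100 * C * _) (320 * 320 * C * _) => I2 I1 u w p1 /andP[p2 _].
  by move: p1 p2; lra.
have h2 : (be / 3 * P) ^+ 2 <= (N * B) ^+ 2.
  have q0 : 0 <= be / 3 * P := mulr_ge0 (divr_ge0 (ltW be0) (ler0n _ _)) P0.
  by rewrite lerXn2r ?nnegrE // (le_trans q0 h1).
move: h2; rewrite !exprMn BB => h2.
have AE : al `^ (2 * s) = A^-1 by rewrite /A powRN invrK.
rewrite AE -(ler_pM2r (mulr_gt0 A0 be0)).
have -> : P ^+ 2 * (A^-1 * be) * (A * be) = be ^+ 2 * P ^+ 2 by field; rewrite gt_eqF.
have e3 : be ^+ 2 * 3^-1 ^+ 2 * P ^+ 2 = 9^-1 * (be ^+ 2 * P ^+ 2) by field.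
by move: h2; rewrite e3; move: (be ^+ 2 * _) (N ^+ 2) => x z; lra.
Qed.

End BreatherSeparation.

(** * Nonuniform continuity by breathers *)

Section BreatherSolutions.
Context {R : realType}.
Implicit Types (s t x y : R).
Notation leb := (@lebesgue_measure R).

Lemma powR_unbounded (q B : R) : 0 < q -> exists2 A, 1 <= A & forall x, A <= x -> B <= x `^ q.
Proof.
move=> q0; pose B1 := Num.max 1 B; have B11 : 1 <= B1 by rewrite le_max lexx.
have B10 : 0 <= B1 by exact: le_trans B11.
exists (B1 `^ q^-1).
  by rewrite -(powRr0 B1); apply: ler_powR => //; rewrite invr_ge0 ltW.
move=> x hx; apply: (@le_trans _ _ B1); first by rewrite le_max lexx orbT.
rewrite -{1}(powRr1 B10) -(mulVf (lt0r_neq0 q0)) powRrM.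
by apply: ge0_ler_powR; rewrite ?nnegrE ?powR_ge0 ?(ltW q0) // (le_trans (powR_ge0 _ _) hx).
Qed.

Lemma energyN s (f : R -> R) B : integ f -> (energy s f <= B%:E)%E -> (energy s (fun x => - f x)%R <= B%:E)%E.
Proof.
move=> hf; rewrite /energy.
suff -> : (fun xi => (weight s xi * spectrum (fun x => - f x) xi)%:E) = (fun xi => (weight s xi * spectrum f xi)%:E) by [].
apply/funext => xi; congr (_ * _)%:E.
have N (h : R -> R) (hh : measurable_fun [set: R] h) (h1 : forall x, `|h x| <= 1) :
    \int[leb]_x (h x * - f x) = - (\int[leb]_x (h x * f x)).
  rewrite -[RHS]mulN1r -RintegralZl //; last exact: integ_mul_bounded hf hh h1.
  by apply: eq_Rintegral => x _; ring.
rewrite /spectrum /fourier_cos /fourier_sin !N ?sqrrN //.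
- by apply: cont_meas; exact: has_deriv_cont (has_deriv_sinl xi).
- by move=> x; exact: norm_sin.
- by apply: cont_meas; exact: has_deriv_cont (has_deriv_cosl xi).
- by move=> x; exact: norm_cos.
Qed.

Local Opaque eM eN1 eN2 eX eX1.
Variables (C mu : R).
Hypotheses (C0 : 0 < C) (hM : lip_bound C (@eM R)) (hN1 : lip_bound C (@eN1 R))
  (hN2 : lip_bound C (@eN2 R)) (hX : lip_bound C (@eX R)) (hX1 : lip_bound C (@eX1 R)).

Let Ka := 768 * (1024 * C) ^+ 2.
Let Kb := 128 * (256 * C) ^+ 2 * (1 + mu ^+ 2).
Let K := Ka + Kb.
Let Ka0 : 0 <= Ka. Proof. exact: mulr_ge0 (ler0n _ _) (sqr_ge0 _). Qed.
Let Kb0 : 0 <= Kb.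
Proof. exact: mulr_ge0 (mulr_ge0 (ler0n _ _) (sqr_ge0 _)) (ltW (sqr1_gt0 _)). Qed.
Let K0 : 0 <= K. Proof. exact: addr_ge0. Qed.
Let KaK : Ka <= K. Proof. by rewrite lerDl. Qed.
Let KbK : Kb <= K. Proof. by rewrite lerDr. Qed.

Definition resolved (al be : R) := [/\ 1 <= al, 0 < be, 16 * be <= al & 16 * `|mu| <= al].

Lemma resolved_gt0 al be : resolved al be -> 0 < al.
Proof. by case=> al1 _ _ _; exact: lt_le_trans al1. Qed.

Lemma breather_at_parts al be y th' : resolved al be ->
  tame (bPhi1 al be mu y th') /\ tame (bkink al be mu y th').
Proof.
move=> hr; have al0 := resolved_gt0 hr; case: hr => al1 be0 hbe hmu.
have [_ gN1 _ gX _] := @admissible_guards R.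
by split; apply: (packet_tame C0).
Qed.

Lemma energy_breather_at s al be y th' : resolved al be -> -1 <= s <= 1 -> (0 < s -> be <= 1) ->
  (energy s (breather_at al be mu y th') <= (2 * (K * (al `^ (2 * s) * be)) + 2 * (K / al))%:E)%E.
Proof.
move=> hr s1 hs; have al0 := resolved_gt0 hr; have [t1 t2] := breather_at_parts y th' hr.
case: hr => al1 be0 hbe hmu.
have e1 : (energy s (bPhi1 al be mu y th') <= (K * (al `^ (2 * s) * be))%:E)%E.
  apply: le_trans (energy_bPhi1 C0 hM hN1 hN2 y th' al1 be0 hbe hmu s1) _.
  rewrite lee_fin; apply: ler_wpM2r; first exact: mulr_ge0 (powR_ge0 _ _) (ltW be0).
  apply: le_trans KaK; apply: ler_wpM2l; first exact: ler0n.
  have c1 : 0 <= 512 * C by exact: mulr_ge0 (ler0n _ _) (ltW C0).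
  have c2 : 512 * C <= 1024 * C by apply: ler_wpM2r; [exact: ltW|rewrite ler_nat].
  by rewrite !expr2; exact: ler_pM.
have [_ s1'] := andP s1.
have e2 : (energy s (bkink al be mu y th') <= (K / al)%:E)%E.
  apply: le_trans (energy_bkink C0 hX hX1 y th' al1 be0 hbe hmu s1' hs) _.
  rewrite lee_fin mulrA; apply: ler_wpM2r KbK.
  by rewrite invr_ge0 ltW.
exact: energyD (tame_integ t1) (tame_integ t2) e1 e2.
Qed.

(** The kinks are estimated one by one, as each already has energy of order 1 / al. Only the
    oscillating packets have to be compared, and they give the factor et^2. *)
Lemma energy_breather_diff s al be y th' et : resolved al be -> 0 <= et -> -1 <= s <= 1 -> (0 < s -> be <= 1) ->
  (energy s (breather_at al be mu y th' \- breather_at (al + et * be) be mu y (th' + et * y))%R <=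
    (2 * (K * (et ^+ 2 * (al `^ (2 * s) * be))) + 8 * (K / al))%:E)%E.
Proof.
move=> hr et0 s1 hs; have al0 := resolved_gt0 hr; have [t1 t2] := breather_at_parts y th' hr.
set al' := al + et * be; have hal : al <= al'.
  by case: hr => _ be0 _ _; rewrite lerDl mulr_ge0 // ltW.
have hr' : resolved al' be by case: hr => *; split=> //; exact: le_trans hal.
have al'0 := resolved_gt0 hr'; have [t1' t2'] := breather_at_parts y (th' + et * y) hr'.
case: (hr) => al1 be0 hbe hmu; case: (hr') => al1' _ hbe' hmu'; have [_ s1'] := andP s1.
have e1 := energy_nearby C0 hM hN1 hN2 y th' al1 be0 hbe hmu et0 (erefl al') s1.
have e2 : (energy s (bkink al be mu y th') <= (K / al)%:E)%E.
  apply: le_trans (energy_bkink C0 hX hX1 y th' al1 be0 hbe hmu s1' hs) _.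
  by rewrite lee_fin mulrA; apply: ler_wpM2r KbK; rewrite invr_ge0 ltW.
have e3 : (energy s (bkink al' be mu y (th' + et * y)) <= (K / al)%:E)%E.
  apply: le_trans (energy_bkink C0 hX hX1 y (th' + et * y) al1' be0 hbe' hmu' s1' hs) _.
  rewrite lee_fin mulrA; apply: le_trans (ler_wpM2r _ KbK) _; first by rewrite invr_ge0 ltW.
  by rewrite ler_wpM2l // lef_pV2.
have e4 := energyD (tame_integ t2) (tame_integ (tameN t2')) e2 (energyN (tame_integ t2') e3).
have e5 := energyD (tame_integ (tameB t1 t1')) (tame_integ (tameB t2 t2')) e1 e4.
rewrite (_ : (_ \- _)%R = fun x => (bPhi1 al be mu y th' x - bPhi1 al' be mu y (th' + et * y) x) +
  (bkink al be mu y th' x - bkink al' be mu y (th' + et * y) x)); last first.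
  by apply/funext => x; rewrite /= /breather_at; ring.
apply: le_trans e5 _; rewrite lee_fin.
have -> : 2 * (2 * (K / al) + 2 * (K / al)) = 8 * (K / al) by ring.
rewrite lerD2r ler_wpM2l // exprMn (mulrA 768) -/Ka -mulrA ler_wpM2r //.
exact: mulr_ge0 (sqr_ge0 _) (mulr_ge0 (powR_ge0 _ _) (ltW be0)).
Qed.

Lemma Hs_norm_fin s f B : tame f -> 0 <= B -> (energy s f <= B%:E)%E -> (Hs_norm s f <= (1 + B)%:E)%E.
Proof.
move=> tf B0 h; apply: Hs_norm_le => //; first by rewrite addr_ge0.
by apply: le_trans h _; rewrite lee_fin; have := sqr_ge0 B; rewrite !expr2; lra.
Qed.

Lemma breather_atE al be y0 th0 t : resolved al be ->
  breather mu al be y0 th0 t = breather_at al be mu (freq_re mu al be * t + y0) (freq_im mu al be * t + th0).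
Proof. by move=> hr; have al0 := resolved_gt0 hr; case: hr => *; rewrite breatherE. Qed.

Lemma tame_breather_at al be y th' : resolved al be -> tame (breather_at al be mu y th').
Proof. by move=> hr; have [t1 t2] := breather_at_parts y th' hr; exact: tameD. Qed.

Lemma breather_solution s al be y0 th0 : resolved al be -> -1 <= s <= 1 -> (0 < s -> be <= 1) ->
  gardner5_solution mu s (breather mu al be y0 th0).
Proof.
move=> hr s1 hs; have al0 := resolved_gt0 hr; case: (hr) => al1 be0 hbe hmu; split.
- exact: breather_smooth2.
- exact: breather_gardner.
move=> t; rewrite breather_atE //; apply: le_lt_trans (ltry _).
apply: Hs_norm_fin (energy_breather_at _ _ hr s1 hs); first exact: tame_breather_at.
have h1 : 0 <= al `^ (2 * s) * be by exact: mulr_ge0 (powR_ge0 _ _) (ltW be0).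
by apply: addr_ge0; apply: mulr_ge0 => //; apply: mulr_ge0 => //; rewrite invr_ge0 ltW.
Qed.

(** The envelope variable moves by the change of [freq_re] times t. That change is -be (al'^2 -
    al^2) Z, where the leading part of Z comes from the term 5 be al^4 of the dispersion relation.
    Resolution makes the terms in be and mu small against al^2. *)
Lemma breather_drift al be et t : resolved al be -> 0 <= et -> 0 < t ->
  t * (et * be ^+ 2 * al ^+ 3) <= `|(freq_re mu (al + et * be) be - freq_re mu al be) * t|.
Proof.
move=> hr et0 t0; have al0 := resolved_gt0 hr; case: hr => al1 be0 hbe hmu.
set al' := al + et * be; have hal : al <= al' by rewrite lerDl mulr_ge0 // ltW.
pose Z := 5 * (al' ^+ 2 + al ^+ 2) - 10 * be ^+ 2 - 30 * mu ^+ 2.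
have -> : (freq_re mu al' be - freq_re mu al be) * t = - (t * (et * be ^+ 2 * (al' + al) * Z)).
  by rewrite /freq_re /Z /al'; ring.
have hZ : al ^+ 2 <= Z.
  have h1 : al ^+ 2 <= al' ^+ 2 by rewrite lerXn2r ?nnegrE // ltW // (lt_le_trans al0).
  have h2 : be ^+ 2 <= (16^-1 * al) ^+ 2.
    by rewrite lerXn2r ?nnegrE ?(ltW be0) // ?mulr_ge0 ?(ltW al0) //; lra.
  have h3 : mu ^+ 2 <= (16^-1 * al) ^+ 2.
    rewrite -(real_normK (num_real mu)) lerXn2r ?nnegrE // ?mulr_ge0 ?(ltW al0) //; lra.
  move: h1 h2 h3; rewrite /Z exprMn; move: (al' ^+ 2) (be ^+ 2) (mu ^+ 2) (al ^+ 2) (sqr_ge0 al) => a b c d d0.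
  rewrite !expr2; lra.
have Z0 : 0 <= Z by exact: le_trans (sqr_ge0 _) hZ.
have c0 : 0 <= et * be ^+ 2 by exact: mulr_ge0 et0 (sqr_ge0 _).
have s0 : al <= al' + al by rewrite lerDr (le_trans (ltW al0)).
rewrite normrN normrM (gtr0_norm t0) ler_wpM2l ?(ltW t0) //.
rewrite ger0_norm; last exact: mulr_ge0 (mulr_ge0 c0 (le_trans (ltW al0) s0)) Z0.
rewrite -[leRHS]mulrA ler_wpM2l // exprS; exact: ler_pM (ltW al0) (sqr_ge0 _) s0 hZ.
Qed.

Lemma norm_lor_le1 y : `|y| * lor y <= 1.
Proof.
rewrite /lor ler_pdivrMr ?sqr1_gt0 // mul1r -(real_normK (num_real y)).
by move: `|y| (normr_ge0 y) => z z0; have := sqr_ge0 (1 - z); rewrite !expr2; lra.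
Qed.

Lemma powR_double s al al' : -1 <= s <= 1 -> 1 <= al -> al <= al' <= 2 * al ->
  al' `^ (2 * s) <= 4 * al `^ (2 * s).
Proof.
move=> /andP[sl sr] al1 /andP[h1 h2]; have al0 : 0 < al by exact: lt_le_trans al1.
have al'0 : 0 < al' by exact: lt_le_trans h1.
case: (lerP 0 s) => s0.
  apply: le_trans (_ : (2 * al) `^ (2 * s) <= _).
    by apply: ge0_ler_powR; rewrite ?nnegrE ?mulr_ge0 // ltW.
  rewrite powRM // ?(ltW al0) //; apply: ler_wpM2r; first exact: powR_ge0.
  have -> : 4 = 2 `^ 2 :> R by rewrite (powR_mulrn 2) // expr2; ring.
  by apply: ler_powR; lra.
apply: (@le_trans _ _ (al `^ (2 * s))); last by have := powR_ge0 al (2 * s); lra.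
have e x : x `^ (2 * s) = (x `^ (2 * - s))^-1 by rewrite -powRN mulrN opprK.
rewrite !e lef_pV2 ?posrE ?powR_gt0 //.
by apply: ge0_ler_powR; rewrite ?nnegrE // ?ltW //; lra.
Qed.

Let le_sum4 (a b u w : R) : 0 <= a -> 0 <= b -> 0 <= u -> 0 <= w ->
  [/\ a <= a + b + u + w, b <= a + b + u + w, u <= a + b + u + w & w <= a + b + u + w].
Proof. by move=> *; split; lra. Qed.

Lemma breather_not_unif_continuous s t : - 2^-1 <= s -> s < 3 / 4 -> 0 < t ->
  ~ data_solution_map_unif_continuous mu s t.
Proof.
move=> sl sr t0 U.
have s1 : -1 <= s <= 1 by lra.
have E1 := energy_breather_at; have E2 := energy_breather_diff; have E3 := breather_solution.
clear KaK KbK; clearbody K; clear Ka0 Kb0 Ka Kb.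
have hK0 := K0.
have [C1 [W [C10 W0 hsep]]] : exists C1 W, [/\ 0 < C1, 0 < W & forall al al' be y th' N,
    resolved al be -> al <= al' -> (0 < s -> be <= 1) ->
    let P := @sech1 R / 2 - C1 * (be / al + `|mu| / al) - W * lor y in 0 <= P ->
    (Hs_norm s (breather_at al be mu 0 0 \- breather_at al' be mu y th')%R < N%:E)%E ->
    P ^+ 2 * (al `^ (2 * s) * be) <= 972 * N ^+ 2].
  exists (100 * C), (320 * 320 * C); split.
  - exact: mulr_gt0 (ltr0Sn _ _) C0.
  - exact: mulr_gt0 (mulr_gt0 (ltr0Sn _ _) (ltr0Sn _ _)) C0.
  - by move=> al al' be y th' N [al1 be0 hbe hmu] hal hs; exact: (breather_separation C0 hN1 hX al1 hal be0 hbe hmu s1 hs).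
set sig := @sech1 R in hsep *.
have sig0 : 0 < sig by rewrite invr_gt0 expR_sqr1_gt0.
have sig1 : sig <= 1 by rewrite invf_le1 ?expR_sqr1_gt0 // sqr1_ge1.
(* With kap = sig / c both 16 kap <= 1 and 16 C1 kap <= sig hold. The first yields 16 be <= al, the
   second makes the error C1 be / al of the near pairing at most sig / 16. *)
clearbody sig; pose c := 16 * C1 + 16; have c16 : 16 <= c by rewrite lerDr; exact: mulr_ge0 (ler0n _ _) (ltW C10).
have c0 : 0 < c by exact: lt_le_trans c16.
pose kap := sig / c; have kap0 : 0 < kap by exact: divr_gt0.
have kapc : kap * c = sig by rewrite divfK // gt_eqF.
clearbody kap; have kap16 : 16 * kap <= 1.
  apply: le_trans sig1; rewrite -kapc mulrC ler_wpM2l // ltW //.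
have kapC : 16 * (C1 * kap) <= sig.
  by rewrite -kapc /c; have := ltW kap0; lra.
(* The drift is at least t et be^2 al^3 = t et kap^2 al^(3-4s) = t et kap^2 al^(2q). Taking half of
   this exponent, et = al^(-q), makes the data gap vanish while the drift still grows like al^q.
   Here s < 3/4 is used. *)
pose q := (3 - 4 * s) / 2; have q0 : 0 < q by rewrite /q; lra.
(* Small enough for a contradiction with [hsep], which would give (sig / 4)^2 kap <= 972 eps^2. *)
pose eps := sig * kap / 200; have eps0 : 0 < eps by rewrite divr_gt0 // mulr_gt0.
pose M := 1 + (8 * K + 2 * K); have M0 : 0 < M by rewrite /M; lra.
have [del del0 H] := U eps M eps0 M0.
(* The squared distance of the data may be (del / 2)^2 = 4 d; the packets use at most d and so do
   the kinks. Once |y| reaches [D0], the far pairing W [lor y] is at most sig / 16, because |y|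
   [lor y] <= 1. *)
pose d := del ^+ 2 / 16; have d0 : 0 < d by rewrite divr_gt0 // exprn_gt0.
pose D0 := W * 16 / sig.
have D00 : 0 < D0 by exact: divr_gt0 (mulr_gt0 W0 (ltr0Sn _ _)) sig0.
have tk0 : 0 < t * kap ^+ 2 by rewrite mulr_gt0 // exprn_gt0.
have [A A1 hA] := powR_unbounded (1 + 2 * K / d + D0 / (t * kap ^+ 2)) q0.
have n1 : 0 <= 2 * K / d by apply: divr_ge0 (ltW d0); exact: mulr_ge0 (ler0n _ _) K0.
have n2 : 0 <= D0 / (t * kap ^+ 2) by exact: divr_ge0 (ltW D00) (ltW tk0).
have n3 : 0 <= 16 * C1 * `|mu| / sig.
  by apply: divr_ge0 (ltW sig0); apply: mulr_ge0 (normr_ge0 _); exact: mulr_ge0 (ler0n _ _) (ltW C10).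
have n4 : 0 <= 8 * K / d by apply: divr_ge0 (ltW d0); exact: mulr_ge0 (ler0n _ _) K0.
have n5 := normr_ge0 mu.
pose al := A + 16 * `|mu| + 16 * C1 * `|mu| / sig + 8 * K / d.
have [alA alm alc ald] : [/\ A <= al, 16 * `|mu| <= al, 16 * C1 * `|mu| / sig <= al & 8 * K / d <= al].
  move: n3 n4; rewrite /al; move: (_ / sig) (_ / d) => u w u0 w0.
  by apply: le_sum4 => //; exact: le_trans A1.
clearbody al; have al1 : 1 <= al by exact: le_trans alA.
have al0 : 0 < al by exact: lt_le_trans al1.
have := hA al alA; set Q := al `^ q => hQ.
have [Q1 QK QD] : [/\ 1 <= Q, 2 * K / d <= Q & D0 / (t * kap ^+ 2) <= Q].
  move: hQ n1 n2; move: (_ / d) (D0 / _) => u w hQ u0 w0.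
  by case: (le_sum4 ler01 (lexx 0) u0 w0) => h1 _ h2 h3; move: h1 h2 h3; rewrite addr0; split; exact: le_trans hQ.
have Q0 : 0 < Q by exact: lt_le_trans Q1.
clear hA hQ n1 n2 n3 n4.
(* With this envelope width the H^s norm stays of order 1 as al grows. *)
pose be := kap * al `^ (- (2 * s)).
have al2s : al `^ (- (2 * s)) <= al by rewrite -[leRHS](powRr1 (ltW al0)); apply: ler_powR => //; lra.
have a2s0 : 0 < al `^ (- (2 * s)) by rewrite powR_gt0.
have be0 : 0 < be by exact: mulr_gt0.
have hbe : 16 * be <= al.
  rewrite /be mulrA; apply: le_trans al2s; rewrite ler_piMl // ltW //.
have hs : 0 < s -> be <= 1.
  move=> s0; have : al `^ (- (2 * s)) <= 1.
    by rewrite -[leRHS](powRr0 al); apply: ler_powR => //; lra.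
  move=> h; have k1 : kap <= 1 by lra.
  by rewrite -[leRHS]mulr1; exact: ler_pM (ltW kap0) (ltW a2s0) k1 h.
have hr : resolved al be by [].
have kapE : al `^ (2 * s) * be = kap.
  by rewrite /be mulrCA powRN mulfV ?mulr1 // gt_eqF // powR_gt0.
(* The data differ by O(et), while the envelopes drift apart by about 1 / et. *)
pose et := Q^-1; have et0 : 0 < et by rewrite invr_gt0.
have et1 : et <= 1 by rewrite invf_le1.
pose al' := al + et * be; have hal : al <= al' by rewrite lerDl ltW // mulr_gt0.
have hal2 : al' <= 2 * al.
  rewrite /al' mulr2n mulrDl mul1r lerD2l; apply: le_trans (_ : be <= al); first by rewrite ler_piMl // ltW.
  by apply: le_trans hbe; rewrite ler_peMl ?ltW // ltr1n.
have hr' : resolved al' be by split => //; apply: le_trans hal.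
(* These shifts bring the first breather to the origin with phase zero at time t, as
   [breather_pairing_near] requires. The second one shares its envelope at time 0 and gets the phase
   correction of [nearby_env]. *)
pose y0 := - (freq_re mu al be * t); pose th0 := - (freq_im mu al be * t).
pose v1 := breather mu al be y0 th0; pose v2 := breather mu al' be y0 (th0 + et * y0).
have sol1 : gardner5_solution mu s v1 by exact: E3.
have sol2 : gardner5_solution mu s v2 by exact: E3.
have v10 : v1 0 = breather_at al be mu y0 th0 by rewrite /v1 breather_atE // !mulr0 !add0r.
have v20 : v2 0 = breather_at al' be mu y0 (th0 + et * y0) by rewrite /v2 breather_atE // !mulr0 !add0r.
have KaM b : 1 <= b -> K / b <= K.
  by move=> b1; rewrite ler_piMr // invf_le1 // (lt_le_trans ltr01).
have b1 : (Hs_norm s (v1 0%R) <= M%:E)%E.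
  rewrite v10; apply: le_trans (Hs_norm_fin (tame_breather_at _ _ hr) _ (E1 _ _ _ _ _ hr s1 hs)) _.
    rewrite kapE; have := mulr_ge0 K0 (ltW kap0); have := divr_ge0 K0 (ltW al0); lra.
  rewrite lee_fin /M kapE; have := KaM _ al1; have := ler_wpM2l K0 kap16; have := mulr_ge0 K0 (ltW kap0); lra.
have b2 : (Hs_norm s (v2 0%R) <= M%:E)%E.
  have h1 : al' `^ (2 * s) * be <= 4 * kap.
    by rewrite -kapE mulrA ler_wpM2r ?(ltW be0) // powR_double // hal.
  have h0 : 0 <= al' `^ (2 * s) * be by exact: mulr_ge0 (powR_ge0 _ _) (ltW be0).
  rewrite v20; apply: le_trans (Hs_norm_fin (tame_breather_at _ _ hr') _ (E1 _ _ _ _ _ hr' s1 hs)) _.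
    have := mulr_ge0 K0 h0; have := divr_ge0 K0 (ltW (resolved_gt0 hr')); lra.
  rewrite lee_fin /M; have := KaM _ (le_trans al1 hal); have := ler_wpM2l K0 h1.
  have := ler_wpM2l K0 kap16; have := mulr_ge0 K0 h0; have := mulr_ge0 K0 (ltW kap0); lra.
have b3 : (Hs_norm s (v1 0 \- v2 0)%R < del%:E)%E.
  apply: (@le_lt_trans _ _ (del / 2)%:E); last by rewrite lte_fin; lra.
  rewrite v10 v20; apply: Hs_norm_le; first by apply: tameB; exact: tame_breather_at.
    by rewrite divr_ge0 // ltW.
  apply: le_trans (E2 _ _ _ _ _ _ hr (ltW et0) s1 hs) _; rewrite kapE lee_fin.
  have -> : (del / 2) ^+ 2 = 4 * d by rewrite /d; field.
  have h1 : 8 * (K / al) <= d.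
    by rewrite mulrA ler_pdivrMr // [leRHS]mulrC -ler_pdivrMr.
  have h2 : 2 * K * et <= d by rewrite /et ler_pdivrMr // [leRHS]mulrC -ler_pdivrMr.
  have h3 : et ^+ 2 * kap <= et.
    rewrite expr2 -mulrA ler_piMr ?(ltW et0) //.
    by rewrite -[leRHS]mulr1; apply: ler_pM et1 _; rewrite ?ltW //; lra.
  by have := ler_wpM2l K0 h3; lra.
have := H v1 v2 sol1 sol2 b1 b2 b3.
pose y := freq_re mu al' be * t + y0.
rewrite /v1 /v2 !breather_atE // !subrr => fin.
have yE : y = (freq_re mu al' be - freq_re mu al be) * t by rewrite /y /y0; ring.
have hy : D0 <= `|y|.
  rewrite yE; apply: le_trans (breather_drift hr (ltW et0) t0).
  have eQ : et * be ^+ 2 * al ^+ 3 = kap ^+ 2 * Q.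
    have e3 : al ^+ 3 = Q ^+ 2 * al `^ (2 * s) ^+ 2.
      rewrite -!powR_mulrn ?powR_ge0 ?(ltW al0) // -!powRrM -powRD ?(gt_eqF al0) ?implybT //.
      by congr (_ `^ _); rewrite /q; field.
    rewrite e3 -kapE /et; field; rewrite gt_eqF //.
  by rewrite eQ mulrA -ler_pdivrMl // mulrC.
pose P := sig / 2 - C1 * (be / al + `|mu| / al) - W * lor y.
have hP : sig / 4 <= P.
  have p1 : C1 * (be / al + `|mu| / al) <= sig / 8.
    have k1 : be / al <= kap.
      by rewrite ler_pdivrMr // /be ler_wpM2l // ltW.
    have k2 : 16 * C1 * (`|mu| / al) <= sig.
      by rewrite mulrA ler_pdivrMr // [leRHS]mulrC -ler_pdivrMr.
    have := ler_wpM2l (ltW C10) k1; lra.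
  have p2 : W * lor y <= sig / 8.
    have l0 := lor_ge0 y.
    have : D0 * lor y <= 1 by apply: le_trans (norm_lor_le1 y); apply: ler_wpM2r.
    rewrite /D0 mulrAC ler_pdivrMr // mul1r; lra.
  by rewrite /P; lra.
have P0 : 0 <= P by apply: le_trans hP; rewrite divr_ge0 // ltW.
have fin' : (Hs_norm s (breather_at al be mu 0 0 \- breather_at al' be mu y (freq_im mu al' be * t + (th0 + et * y0)))%R < eps%:E)%E by [].
have := hsep _ _ _ _ _ _ hr hal hs P0 fin'.
rewrite kapE leNgt => /negP; apply.
have h1 : (sig / 4) ^+ 2 * kap <= P ^+ 2 * kap.
  by rewrite ler_wpM2r ?(ltW kap0) // lerXn2r ?nnegrE // divr_ge0 // ltW.
apply: lt_le_trans h1.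
have -> : 972 * eps ^+ 2 = sig ^+ 2 * kap * (972 / 200 / 200 * kap) by rewrite /eps; field.
have -> : (sig / 4) ^+ 2 * kap = sig ^+ 2 * kap * 16^-1 by field.
by rewrite ltr_pM2l ?mulr_gt0 ?exprn_gt0 //; lra.
Qed.

End BreatherSolutions.

(** * Solitons *)

Section Solitons.
Context {R : realType}.
Implicit Types (s t x y m k mu E : R).
Notation leb := (@lebesgue_measure R).

(** The squared modulus of the soliton tau function 1 + (2m + i) E, where m = mu / k and E is the
    exponential of the phase. *)
Definition soliton_den m E : R := (1 + 2 * m * E) ^+ 2 + E ^+ 2.
Definition soliton_at m k y x : R := 2 * k * (expR (k * x + y) / soliton_den m (expR (k * x + y))).
Definition soliton_freq mu k : R := - (k ^+ 5 + 10 * mu ^+ 2 * k ^+ 3).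
Definition soliton mu k y0 t x : R := soliton_at (mu / k) k (soliton_freq mu k * t + y0) x.

Lemma soliton_den_ge m E : 8 * `|m| <= 1 -> 0 <= E -> 2^-1 * (1 + E ^+ 2) <= soliton_den m E.
Proof.
move=> hm E0; have [h1 h2] : - 8^-1 <= m /\ m <= 8^-1.
  by apply/andP; rewrite -ler_norml; lra.
have h3 : 0 <= (m + 8^-1) * E by apply: mulr_ge0 => //; lra.
by rewrite /soliton_den; have := sqr_ge0 (2 * m * E); have := sqr_ge0 (E - 2^-1); rewrite !expr2; lra.
Qed.

Lemma soliton_den_gt0 m E : 8 * `|m| <= 1 -> 0 <= E -> 0 < soliton_den m E.
Proof.
by move=> hm E0; apply: lt_le_trans (soliton_den_ge hm E0); rewrite mulr_gt0 ?invr_gt0 // sqr1_gt0.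
Qed.

Lemma soliton_at_ge0 m k y x : 8 * `|m| <= 1 -> 0 < k -> 0 <= soliton_at m k y x.
Proof.
move=> hm k0; apply: mulr_ge0; first exact: mulr_ge0 (ler0n _ _) (ltW k0).
by apply: divr_ge0; [exact: expR_ge0|apply: ltW; apply: soliton_den_gt0 => //; exact: expR_ge0].
Qed.

Lemma soliton_at_le m k y x : 8 * `|m| <= 1 -> 0 < k ->
  soliton_at m k y x <= 4 * k * sech (k * x + y).
Proof.
move=> hm k0; rewrite /soliton_at /sech; have E0 := expR_gt0 (k * x + y).
move: (expR _) E0 => E E0.
have -> : 4 * k * (E / (1 + E ^+ 2)) = 2 * k * (E / (2^-1 * (1 + E ^+ 2))).
  by field; rewrite gt_eqF // sqr1_gt0.
apply: ler_wpM2l; first exact: mulr_ge0 (ler0n _ _) (ltW k0).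
apply: ler_wpM2l; first exact: ltW.
rewrite lef_pV2 ?posrE ?soliton_den_gt0 ?(ltW E0) ?soliton_den_ge ?(ltW E0) //.
by rewrite mulr_gt0 ?invr_gt0 // sqr1_gt0.
Qed.

Lemma has_deriv_exp_affine k y : has_deriv (fun x => expR (k * x + y)) (fun x => k * expR (k * x + y)).
Proof.
apply: (has_deriv_ext (has_deriv_expR (has_deriv_affine k y))) => // x.
Qed.

Lemma soliton_gardner mu k y0 : 0 < k -> 8 * `|mu / k| <= 1 -> gardner5 mu (soliton mu k y0).
Proof.
move=> k0 hm; set Om := soliton_freq mu k.
pose E t x := expR (k * x + (Om * t + y0)).
have dEx t : has_deriv (E t) (fun x => k * E t x) by exact: has_deriv_exp_affine.
have dEt x : has_deriv (E ^~ x) (fun t => Om * E t x).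
  apply: (has_deriv_ext (has_deriv_exp_affine Om (y0 + k * x))) => t; rewrite /E; first by congr expR; ring.
  by congr (_ * expR _); ring.
pose F n t x := (if n is 0%N then k else 0) + 2 * mu * k ^+ n * E t x.
pose G n t x := k ^+ n.+1 * E t x.
have -> : soliton mu k y0 = tau_v F G.
  apply/funext => t; apply/funext => x; rewrite /soliton /soliton_at /tau_v /F /G /soliton_den -/(E t x).
  have E0 : 0 < E t x by exact: expR_gt0.
  have := soliton_den_gt0 hm (ltW E0); rewrite /soliton_den.
  move: (E t x) E0 => e e0 d0.
  have -> : (k + 2 * mu * k ^+ 0 * e) ^+ 2 + (k ^+ 1 * e) ^+ 2 =
     k ^+ 2 * ((1 + 2 * (mu / k) * e) ^+ 2 + e ^+ 2) by field; rewrite gt_eqF.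
  move: d0; move: (_ + e ^+ 2) => d d0; field; rewrite !gt_eqF //.
apply: (@tau_gardner R mu F G (fun t x => 2 * mu * Om * E t x) (fun t x => k * Om * E t x)
  (fun t x => 2 * mu * k * Om * E t x) (fun t x => k ^+ 2 * Om * E t x)).
- move=> n t; apply: (has_deriv_ext (has_derivD (has_deriv_cst (if n is 0%N then k else 0)) (has_derivZ (2 * mu * k ^+ n) (dEx t)))) => // x.
  by rewrite /F exprS; ring.
- by move=> n t; apply: (has_deriv_ext (has_derivZ (k ^+ n.+1) (dEx t))) => // x; rewrite /G [k ^+ n.+2]exprS; ring.
- move=> x; apply: (has_deriv_ext (has_derivD (has_deriv_cst k) (has_derivZ (2 * mu) (dEt x)))) => t; rewrite /F ?expr0; ring.
- move=> x; apply: (has_deriv_ext (has_derivZ k (dEt x))) => t; rewrite /G ?expr1; ring.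
- move=> x; apply: (has_deriv_ext (has_derivZ (2 * mu * k) (dEt x))) => t; rewrite /F ?expr1; ring.
- move=> x; apply: (has_deriv_ext (has_derivZ (k ^+ 2) (dEt x))) => t; rewrite /G; ring.
- move=> t; apply: (has_deriv_ext (has_derivZ (2 * mu * Om) (dEx t))) => x; ring.
- move=> t; apply: (has_deriv_ext (has_derivZ (k * Om) (dEx t))) => x; ring.
- move=> t x; rewrite /F /G gt_eqF //; have E0 : 0 < E t x by exact: expR_gt0.
  rewrite ltr_wpDl ?sqr_ge0 // exprn_gt0 // mulr_gt0 //.
- by move=> t x; rewrite /F /G; ring.
- by move=> t x; rewrite /F /G /Om /soliton_freq; ring.
Qed.

Lemma soliton_smooth2 mu k y0 : 0 < k -> 8 * `|mu / k| <= 1 -> smooth2 (soliton mu k y0).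
Proof.
move=> k0 hm; set Om := soliton_freq mu k; set m := mu / k.
pose rho t x (n : nat) := expR (k * x + (Om * t + y0)).
pose a : expr R := EAdd (ECst 1) (EMul (ECst (2 * m)) (EVar 0)).
pose den : expr R := EAdd (EMul a a) (EMul (EVar 0) (EVar 0)).
pose e : expr R := EMul (ECst (2 * k)) (EMul (EVar 0) (EInv den)).
have -> : soliton mu k y0 = fun t x => eeval (rho t x) e by [].
apply: (@eval_smooth2 R (fun r => 0 <= r 0%N) rho (fun n => EMul (ECst Om) (EVar n)) (fun n => EMul (ECst k) (EVar n))).
- by move=> t x; exact: expR_ge0.
- move=> n z; apply: (@continuous_comp _ _ _ (fun z : R * R => k * z.2 + (Om * z.1 + y0)) expR); last exact: continuous_expR.
  apply: cvgD; first by apply: cvgM; [exact: cvg_cst|exact: cvg_snd].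
  by apply: cvgD; [apply: cvgM; [exact: cvg_cst|exact: cvg_fst]|exact: cvg_cst].
- by [].
- by [].
- move=> n x; apply: (has_deriv_ext (has_deriv_exp_affine Om (y0 + k * x))) => t; rewrite /rho /=; first by congr expR; ring.
  by congr (_ * expR _); ring.
- by move=> n t; exact: has_deriv_exp_affine.
- do !split => //; move=> r r0; apply: ler_norm_r.
  have := soliton_den_ge hm r0; rewrite /soliton_den /= !expr2 -/m.
  by have := sqr_ge0 (r 0%N); rewrite expr2; move: (_ * _ + _ * _) => z; lra.
Qed.

End Solitons.

(** * Solitons as approximate Dirac masses *)

Section SolitonMass.
Context {R : realType}.
Implicit Types (x y m k E : R) (h : R -> R).
Notation leb := (@lebesgue_measure R).

(** Twice the growth of the argument of 1 + (2m + i) E as E runs from 0 to infinity. The argument is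
    measured after a rotation by -pi/4. The real part is then proportional to 1 + (1 + 2m) E and
    stays positive for either sign of m, so one branch of [atan] suffices. *)
Definition soliton_mass m : R := 2 * (atan ((1 - 2 * m) / (1 + 2 * m)) - atan (-1)).

Lemma expN_le_lor (z : R) : 0 <= z -> expR (- z) <= 512 * lor z.
Proof.
move=> z0; apply: le_trans (_ : 2 * sech z <= _); last by have := sech_le_lor z; lra.
rewrite /sech expRN mulrA ler_pdivlMr ?expR_sqr1_gt0 // ler_pdivrMl ?expR_gt0 //.
have : 1 <= expR z by rewrite -expR0 ler_expR.
by move: (expR z) => E E1; rewrite expr2; nra.
Qed.

Section Fixed.
Variables (m k y : R).
Hypotheses (hm : 8 * `|m| <= 1) (k1 : 1 <= k).
Let k0 : 0 < k. Proof. exact: lt_le_trans k1. Qed.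
Let m12 : - 8^-1 <= m <= 8^-1. Proof. by rewrite -ler_norml; have := hm; lra. Qed.
Let E x := expR (k * x + y).
Let E0 x : 0 < E x. Proof. exact: expR_gt0. Qed.
Let q x := (1 + 2 * m) * E x + 1.
Let q0 x : 1 < q x.
Proof. by rewrite ltrDr mulr_gt0 //; have /andP[h _] := m12; lra. Qed.
Let q0' x : q x != 0. Proof. by rewrite gt_eqF // (lt_trans ltr01). Qed.
Let cE : continuous E. Proof. exact: has_deriv_cont (has_deriv_exp_affine k y). Qed.

Lemma soliton_at_cont : continuous (soliton_at m k y).
Proof.
have dE := has_deriv_exp_affine k y.
have dd : has_deriv (fun x => soliton_den m (E x))
    (fun x => 4 * m * (1 + 2 * m * E x) * (k * E x) + 2 * E x * (k * E x)).
  have da := has_derivD (has_deriv_cst 1) (has_derivZ (2 * m) dE).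
  apply: (has_deriv_ext (has_derivD (has_derivM da da) (has_derivM dE dE))) => x; rewrite /soliton_den ?expr2 //.
  by rewrite -/(E x); ring.
have d0 x : soliton_den m (E x) != 0 by rewrite gt_eqF // soliton_den_gt0 // ltW.
apply: contM; first exact: contC.
by apply: contM => //; exact: has_deriv_cont (has_derivV d0 dd).
Qed.

Lemma soliton_at_lor x : `|soliton_at m k y x| <= 1024 * k * lor (k * x + y).
Proof.
rewrite (ger0_norm (soliton_at_ge0 _ _ hm k0)); apply: le_trans (soliton_at_le _ _ hm k0) _.
have := ler_wpM2l (ltW k0) (sech_le_lor (k * x + y)); move: (lor _) (sech _) => a b; lra.
Qed.

Lemma soliton_at_tame : tame (soliton_at m k y).
Proof.
apply: (tame_lor_scaled k0 _ soliton_at_cont soliton_at_lor).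
exact: mulr_ge0 (ler0n _ _) (ltW k0).
Qed.

Lemma soliton_at_mass : \int[leb]_x soliton_at m k y x = soliton_mass m.
Proof.
(* The tangent of the rotated argument. Its denominator [q] exceeds 1, and its limits at the two
   ends give the two arctangents of [soliton_mass]. *)
pose r x := ((1 - 2 * m) * E x - 1) / q x; pose H x := 2 * atan (r x).
have dE := has_deriv_exp_affine k y.
have dq : has_deriv q (fun x => (1 + 2 * m) * (k * E x)).
  apply: (has_deriv_ext (has_derivD (has_derivZ (1 + 2 * m) dE) (has_deriv_cst 1))) => // x.
  by rewrite addr0.
have dn : has_deriv (fun x => (1 - 2 * m) * E x - 1) (fun x => (1 - 2 * m) * (k * E x)).
  apply: (has_deriv_ext (has_derivD (has_derivZ (1 - 2 * m) dE) (has_deriv_cst (-1)))) => // x.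
  by rewrite addr0.
have dH : has_deriv H (soliton_at m k y).
  apply: (has_deriv_ext (has_derivZ 2 (has_deriv_atan (has_derivM dn (has_derivV q0' dq))))) => // x.
  rewrite /soliton_at -/(E x); have d0 := soliton_den_gt0 hm (ltW (E0 x)).
  have := q0' x; move: d0; rewrite /q /soliton_den; move: (E x) => e d0 qx.
  move: qx; set Q := (1 + 2 * m) * e + 1 => qx; set N := (1 - 2 * m) * e - 1.
  have NQ : Q ^+ 2 + N ^+ 2 = 2 * ((1 + 2 * m * e) ^+ 2 + e ^+ 2) by rewrite /Q /N; ring.
  have NE : (1 - 2 * m) * (k * e) * Q - N * ((1 + 2 * m) * (k * e)) = 2 * k * e by rewrite /Q /N; ring.
  have S0 : 0 < Q ^+ 2 + N ^+ 2 by rewrite NQ mulr_gt0.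
  have -> : 2 * (((1 - 2 * m) * (k * e) * Q^-1 + N * (- ((1 + 2 * m) * (k * e)) / Q ^+ 2)) / (1 + (N / Q) ^+ 2)) =
    2 * (((1 - 2 * m) * (k * e) * Q - N * ((1 + 2 * m) * (k * e))) / (Q ^+ 2 + N ^+ 2)).
    field; rewrite qx ?gt_eqF //=.
  rewrite NE NQ; move: d0; move: (_ + e ^+ 2) => d d0; field; rewrite gt_eqF //.
apply/eqP; rewrite -subr_eq0 -normr_le0.
apply: (int_approx_antideriv (C := 512 * (8 * expR (- y) + 4 * expR y)) soliton_at_cont _ dH (tame_integ soliton_at_tame)).
  by move=> x; exact: soliton_at_ge0.
move=> n; rewrite add0r.
have r1 x : `|r x - (1 - 2 * m) / (1 + 2 * m)| <= 4 * (E x)^-1.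
  have /andP[m1 m2] := m12.
  have a0 : 3 / 4 <= 1 + 2 * m by lra.
  have -> : r x - (1 - 2 * m) / (1 + 2 * m) = - (2 / ((1 + 2 * m) * q x)).
    rewrite /r; have := q0' x; rewrite /q => qx; field; rewrite qx gt_eqF //=; lra.
  have b0 : 2^-1 * E x <= (1 + 2 * m) * q x.
    have := E0 x; rewrite /q; move: (E x) => e e0.
    have h1 := ler_wpM2r (ltW e0) a0.
    have h2 : 0 <= (1 + 2 * m) * e + 1 by lra.
    by have h3 := ler_wpM2r h2 a0; lra.
  have p0 : 0 < (1 + 2 * m) * q x by apply: lt_le_trans b0; rewrite mulr_gt0 ?invr_gt0.
  rewrite normrN gtr0_norm ?divr_gt0 // ler_pdivrMr // mulrAC ler_pdivlMr //; lra.
have r2 x : `|r x - -1| <= 2 * E x.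
  have -> : r x - -1 = 2 * E x / q x.
    rewrite /r; have := q0' x; rewrite /q => qx; field; exact: qx.
  have e2 : 0 <= 2 * E x by exact: mulr_ge0 (ler0n _ _) (ltW (E0 x)).
  have qq : 0 < q x := lt_trans ltr01 (q0 x).
  by rewrite ger0_norm ?divr_ge0 ?(ltW qq) // ler_pdivrMr // ler_peMr // ltW.
pose A := (1 - 2 * m) / (1 + 2 * m).
have -> : H n%:R - H (- n%:R) - soliton_mass m = 2 * (atan (r n%:R) - atan A) - 2 * (atan (r (- n%:R)) - atan (-1)).
  by rewrite /H /soliton_mass -/A; ring.
have t1 := le_trans (atan_lipschitz _ _) (r1 n%:R).
have t2 := le_trans (atan_lipschitz _ _) (r2 (- n%:R)).
have n0 : 0 <= n%:R :> R by exact: ler0n.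
have kn0 : 0 <= k * n%:R by exact: mulr_ge0 (ltW k0) n0.
have l1 : expR (- (k * n%:R)) <= 512 * lor n%:R.
  apply: le_trans (expN_le_lor kn0) _; apply: ler_wpM2l; first exact: ler0n.
  rewrite lef_pV2 ?posrE ?sqr1_gt0 // lerD2l lerXn2r ?nnegrE //; exact: ler_peMl.
have e1 : (E n%:R)^-1 = expR (- y) * expR (- (k * n%:R)).
  by rewrite /E -expRN opprD addrC expRD.
have e2 : E (- n%:R) = expR y * expR (- (k * n%:R)).
  by rewrite /E mulrN addrC expRD.
rewrite e1 in t1; rewrite e2 in t2.
apply: le_trans (ler_normB _ _) _; rewrite !normrM (ger0_norm (ler0n _ 2)).
have f1 := ler_wpM2l (expR_ge0 (- y)) l1; have f2 := ler_wpM2l (expR_ge0 y) l1.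
have -> : 512 * (8 * expR (- y) + 4 * expR y) * lor n%:R = 8 * (expR (- y) * (512 * lor n%:R)) + 4 * (expR y * (512 * lor n%:R)).
  by ring.
move: (expR (- y) * (512 * _)) (expR y * (512 * _)) f1 f2 => u w f1 f2; lra.
Qed.

(** The soliton concentrates at -y / k with width 1 / k. Replacing [h] by its value there costs L
    times the distance, and [sech_lor] absorbs this linear factor; 64 * 64 is 1024 times the 4 of
    the Lorentzian integral. *)
Lemma soliton_moment h (L : R) : continuous h -> (forall x, `|h x| <= 1) ->
  (forall x z, `|h x - h z| <= L * `|x - z|) -> 0 <= L ->
  `|(\int[leb]_x (h x * soliton_at m k y x)) - h (- y / k) * soliton_mass m| <= 64 * 64 * L / k.
Proof.
move=> ch h1 hL L0; pose X := - y / k.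
have ti := tame_integ soliton_at_tame.
have i1 : integ (fun x => h x * soliton_at m k y x) by exact: integ_mul_bounded ti (cont_meas ch) h1.
have i2 : integ (fun x => h X * soliton_at m k y x) by exact: integZ.
rewrite -soliton_at_mass -RintegralZl // -RintegralB //.
have [j1 j2] := int_lor_scaled y k0.
have hb x : `|h x * soliton_at m k y x - h X * soliton_at m k y x| <= 1024 * L * lor (k * x + y).
  rewrite -mulrBl normrM (ger0_norm (soliton_at_ge0 _ _ hm k0)).
  apply: le_trans (ler_pM (normr_ge0 _) (soliton_at_ge0 _ _ hm k0) (hL x X) (soliton_at_le y x hm k0)) _.
  have -> : `|x - X| = `|k * x + y| / k.
    by rewrite -{2}(gtr0_norm k0) -normf_div; congr `|_|; rewrite /X; field; rewrite gt_eqF.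
  have -> : L * (`|k * x + y| / k) * (4 * k * sech (k * x + y)) = 4 * L * (sech (k * x + y) * `|k * x + y|).
    by field; rewrite gt_eqF.
  have -> : 1024 * L * lor (k * x + y) = 4 * L * (256 * lor (k * x + y)) by ring.
  apply: ler_wpM2l; first exact: mulr_ge0 (ler0n _ _) L0.
  apply: le_trans (sech_lor _); apply: ler_wpM2l; first exact: sech_ge0.
  by rewrite lerDr.
apply: le_trans (int_norm_le (integB i1 i2) (integZ (1024 * L) j1) hb) _.
rewrite RintegralZl //.
have c0 : 0 <= 1024 * L by exact: mulr_ge0 (ler0n _ _) L0.
by apply: le_trans (ler_wpM2l c0 j2) _; rewrite le_eqVlt; apply/orP; left; apply/eqP; ring.
Qed.

Lemma soliton_L1 h : continuous h -> (forall x, `|h x| <= 1) ->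
  `|\int[leb]_x (h x * soliton_at m k y x)| <= 64 * 64.
Proof.
move=> ch h1; have [j1 j2] := int_lor_scaled y k0.
have i1 : integ (fun x => h x * soliton_at m k y x).
  exact: integ_mul_bounded (tame_integ soliton_at_tame) (cont_meas ch) h1.
apply: le_trans (int_norm_le i1 (integZ (1024 * k) j1) _) _.
  move=> x; rewrite normrM; apply: le_trans (soliton_at_lor x); exact: ler_piMl (normr_ge0 _) (h1 x).
rewrite RintegralZl //.
have c0 : 0 <= 1024 * k by exact: mulr_ge0 (ler0n _ _) (ltW k0).
apply: le_trans (ler_wpM2l c0 j2) _; rewrite le_eqVlt; apply/orP; left; apply/eqP; field.
by rewrite gt_eqF.
Qed.
End Fixed.

Lemma soliton_mass_diff m m' : 8 * `|m| <= 1 -> 8 * `|m'| <= 1 ->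
  `|soliton_mass m - soliton_mass m'| <= 16 * `|m - m'|.
Proof.
move=> hm hm'; rewrite /soliton_mass -mulrBr normrM (ger0_norm (ler0n _ 2)).
rewrite (_ : 16 * _ = 2 * (8 * `|m - m'|)) ?ler_wpM2l //; last by ring.
have -> : atan ((1 - 2 * m) / (1 + 2 * m)) - atan (-1) - (atan ((1 - 2 * m') / (1 + 2 * m')) - atan (-1)) =
  atan ((1 - 2 * m) / (1 + 2 * m)) - atan ((1 - 2 * m') / (1 + 2 * m')) by ring.
apply: le_trans (atan_lipschitz _ _) _.
have p x : 8 * `|x| <= 1 -> 3 / 4 <= 1 + 2 * x.
  by move=> hx; have : - 8^-1 <= x <= 8^-1 by [rewrite -ler_norml; lra|]; lra.
have p1 := p _ hm; have p2 := p _ hm'.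
have pp : 2^-1 <= (1 + 2 * m) * (1 + 2 * m').
  apply: le_trans (_ : 3 / 4 * (3 / 4) <= _); first lra.
  by apply: ler_pM => //; lra.
have -> : (1 - 2 * m) / (1 + 2 * m) - (1 - 2 * m') / (1 + 2 * m') =
  - (4 * (m - m')) / ((1 + 2 * m) * (1 + 2 * m')).
  by field; rewrite !gt_eqF //; lra.
have p0 : 0 < (1 + 2 * m) * (1 + 2 * m') by apply: lt_le_trans pp; rewrite invr_gt0.
rewrite normrM normfV normrN normrM (ger0_norm (ler0n _ 4)) (gtr0_norm p0) ler_pdivrMr //.
by have := ler_wpM2l (normr_ge0 (m - m')) pp; lra.
Qed.

Lemma soliton_mass_ge1 m : 8 * `|m| <= 1 -> 1 <= soliton_mass m.
Proof.
move=> hm; have /andP[m1 m2] : - 8^-1 <= m <= 8^-1 by rewrite -ler_norml; lra.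
rewrite /soliton_mass atanN atan1 opprK.
have : 0 <= atan ((1 - 2 * m) / (1 + 2 * m)).
  by rewrite -[leLHS]atan0; apply: le_atan; apply: divr_ge0; lra.
by have := @pi_ge2 R; lra.
Qed.

End SolitonMass.

(** * Sobolev norms below the exponent -1/2 *)

Section NegativeSobolev.
Context {R : realType}.
Implicit Types (s p x xi : R) (f : R -> R).
Notation leb := (@lebesgue_measure R).

Lemma has_deriv_weight p : has_deriv (@weight R p) (fun x => 2 * p * x * weight p x * lor x).
Proof.
move=> x; have d1 : is_derive x 1 (fun x : R => 1 + x ^+ 2) (2 * x).
  have := has_derivD (has_deriv_cst 1) (has_derivM (@has_deriv_id R) (@has_deriv_id R)).
  by move=> /has_deriv_ext/(_ (fun x => _) (fun x => _)) h; apply: h => z; rewrite ?expr2 //; ring.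
have d2 := is_derive1_powR p (sqr1_gt0 x).
have := @is_derive1_comp R (@powR R ^~ p) (fun x : R => 1 + x ^+ 2) x _ _ d2 d1.
rewrite /weight /lor => h; apply: is_derive_eq h _.
have h0 := sqr1_gt0 x.
by rewrite powRD ?powRN ?powRr1 ?(ltW h0) ?(gt_eqF h0) ?implybT //=; ring.
Qed.

(** With p = -1/2 - d, the derivative of x (1 + x^2)^p is -2d (1 + x^2)^p + (1 + 2d) (1 + x^2)^p
    [lor x]. So the weight equals a bounded total derivative plus a term dominated by a multiple of
    [lor]. The majorant [h] fills that term up to the full multiple, which has an explicit
    primitive. *)
Lemma integ_weight p : p < - 2^-1 -> integ (@weight R p).
Proof.
move=> hp; pose d := - 2^-1 - p; have d0 : 0 < d by rewrite /d; lra.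
have w0 x := weight_gt0 p x.
have w1 x : weight p x <= 1 by apply: weight_le1; lra.
pose h x := weight p x + (1 + 2 * d) / (2 * d) * (lor x * (1 - weight p x)).
pose H x := (2 * d)^-1 * ((1 + 2 * d) * atan x - x * weight p x).
have dd0 : 0 < 2 * d by rewrite mulr_gt0.
have c0 : 0 <= (1 + 2 * d) / (2 * d) by apply: divr_ge0; lra.
have ch : continuous h.
  apply: contD; first exact: weight_cont.
  apply: contM; [exact: contC|apply: contM; first exact: cont_lor].
  by apply: contD; [exact: contC|apply: contN; exact: weight_cont].
have hw x : weight p x <= h x.
  by rewrite lerDl mulr_ge0 // mulr_ge0 ?lor_ge0 // subr_ge0.
have dH : has_deriv H h.
  have dx := has_derivM (@has_deriv_id R) (has_deriv_weight p).
  apply: (has_deriv_ext (has_derivZ (2 * d)^-1 (has_derivB (has_derivZ (1 + 2 * d) has_deriv_atan_lor) dx))) => // x.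
  have lx : x * x * lor x = 1 - lor x.
    by rewrite /lor; have := lt0r_neq0 (sqr1_gt0 x); rewrite expr2 => q; field.
  have -> : x * (2 * p * x * weight p x * lor x) = 2 * p * weight p x * (x * x * lor x) by ring.
  by rewrite lx /h; have -> : p = - 2^-1 - d by [rewrite /d; ring|]; field; rewrite gt_eqF.
have hH x : `|H x| <= (2 * d)^-1 * ((1 + 2 * d) * 2 + 1).
  rewrite normrM ger0_norm ?invr_ge0 ?(ltW dd0) // ler_wpM2l ?invr_ge0 ?(ltW dd0) //.
  apply: le_trans (ler_normB _ _) _; apply: lerD.
    rewrite normrM ger0_norm; last lra.
    by apply: ler_wpM2l; [lra|exact: atan_bound].
  rewrite -(@expr_le1 _ 2) // normrM exprMn !real_normK ?num_real //.
  have -> : weight p x ^+ 2 = weight (p * 2%:R) x by rewrite /weight powRrM powR_mulrn ?powR_ge0.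
  apply: le_trans (_ : x ^+ 2 * lor x <= _).
    apply: (ler_wpM2l (sqr_ge0 x)).
    have -> : lor x = weight (- 1) x by rewrite /weight powRN powRr1 // ltW // sqr1_gt0.
    by apply: ler_powR; [exact: sqr1_ge1|lra].
  by rewrite /lor ler_pdivrMr ?sqr1_gt0 // mul1r lerDr.
have [ih _] := integ_antideriv ch (fun x => le_trans (ltW (w0 x)) (hw x)) dH hH.
apply: integ_dom ih; first exact: weight_meas.
by move=> x; rewrite gtr0_norm.
Qed.

(** Interpolation between a uniform bound on the transform and a bound near frequency zero. With z =
    |xi| b the former is used for z >= 1 and the latter for z < 1, where z^2 <= z^(2 ga) because ga
    <= 1. Both cost a factor (1 + xi^2)^ga, and the weight of exponent s + ga is still
    integrable. *)
Lemma energy_low s (ga A e b : R) f : integ f -> 0 < ga <= 1 -> s + ga < - 2^-1 ->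
  0 <= A -> 0 <= e -> 0 <= b ->
  (forall xi, `|fourier_cos f xi| <= A /\ `|fourier_sin f xi| <= A) ->
  (forall xi, `|fourier_cos f xi| <= e + `|xi| * b /\ `|fourier_sin f xi| <= e + `|xi| * b) ->
  (energy s f <= (2 * (2 * e ^+ 2 + (A ^+ 2 + 2) * b `^ (2 * ga)) * \int[leb]_xi weight (s + ga) xi)%:E)%E.
Proof.
move=> hf /andP[g0 g1] hs A0 e0 b0 hA hB.
set c := 2 * e ^+ 2 + _.
have p0 := powR_ge0 b (2 * ga).
have c0 : 0 <= c by apply: addr_ge0; apply: mulr_ge0 => //; [exact: sqr_ge0|apply: addr_ge0 => //; exact: sqr_ge0].
have iw := integ_weight hs.
have key (a xi : R) : 0 <= a -> a <= A -> a <= e + `|xi| * b -> a ^+ 2 <= c * (1 + xi ^+ 2) `^ ga.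
  move=> a0 aA aB.
  have x1 : 1 <= (1 + xi ^+ 2) `^ ga.
    by rewrite -[leLHS](powRr0 (1 + xi ^+ 2)); apply: ler_powR; [exact: sqr1_ge1|exact: ltW].
  have xb : (`|xi| * b) `^ (2 * ga) <= (1 + xi ^+ 2) `^ ga * b `^ (2 * ga).
    rewrite powRM // ler_wpM2r // powRrM powR_mulrn // real_normK ?num_real //.
    by apply: ge0_ler_powR; rewrite ?nnegrE ?(ltW g0) ?sqr_ge0 ?(ltW (sqr1_gt0 _)) // lerDr.
  set z := `|xi| * b in aB xb; have z0 : 0 <= z by exact: mulr_ge0.
  set P := (1 + xi ^+ 2) `^ ga in x1 xb *.
  have P0 : 0 <= P by exact: le_trans x1.
  have eP : e ^+ 2 <= e ^+ 2 * P by rewrite ler_peMr // sqr_ge0.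
  have AP : 0 <= A ^+ 2 * (P * b `^ (2 * ga)) by rewrite mulr_ge0 ?sqr_ge0 // mulr_ge0.
  have bP : 0 <= P * b `^ (2 * ga) by rewrite mulr_ge0.
  have eP0 := mulr_ge0 (sqr_ge0 e) P0.
  have cE : c * P = 2 * (e ^+ 2 * P) + A ^+ 2 * (P * b `^ (2 * ga)) + 2 * (P * b `^ (2 * ga)).
    by rewrite /c; ring.
  rewrite cE; case: (lerP 1 z) => z1.
    have h1 : 1 <= z `^ (2 * ga).
      by rewrite -[leLHS](powRr0 z); apply: ler_powR => //; rewrite mulr_ge0 // ltW.
    have h2 : a ^+ 2 <= A ^+ 2 by rewrite lerXn2r ?nnegrE.
    have h3 := ler_wpM2l (sqr_ge0 A) (le_trans h1 xb); rewrite mulr1 in h3; lra.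
  have h1 : z ^+ 2 <= z `^ (2 * ga).
    (* A power with base 0 is a separate case of the definition and not the exponential of a
       logarithm. *)
    have [->|zn] := eqVneq z 0; first by rewrite expr0n /= powR_ge0.
    rewrite -powR_mulrn // !(mulrC 2 ga) ; rewrite [leRHS]/powR [leLHS]/powR (negbTE zn) ler_expR.
    have : ln z <= 0 by rewrite -ln1 ler_ln ?posrE // ?lt_neqAle ?z0 1?eq_sym ?zn // ltW.
    by move: (ln z) => l l0; have := mulr_le0_ge0 l0 (ltW g0); nra.
  have h2 : a ^+ 2 <= (e + z) ^+ 2 by rewrite lerXn2r ?nnegrE // addr_ge0.
  have h3 := sqr_ge0 (e - z).
  move: h2 h3; rewrite sqrrD sqrrB => h2 h3; have h4 := le_trans h1 xb; lra.
apply: (energy_dom hf (w := fun xi => 2 * c * weight (s + ga) xi)).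
- by apply: measurable_funM => //; exact: weight_meas.
- move=> xi; have [a1 a2] := hA xi; have [b1 b2] := hB xi.
  have k1 := key _ _ (normr_ge0 _) a1 b1; have k2 := key _ _ (normr_ge0 _) a2 b2.
  rewrite !real_normK ?num_real // in k1 k2.
  rewrite /weight powRD ?(gt_eqF (sqr1_gt0 _)) ?implybT // /spectrum.
  have := ler_wpM2l (powR_ge0 (1 + xi ^+ 2) s) (lerD k1 k2).
  move: (_ `^ s) (_ `^ ga) => u w; lra.
- by rewrite int_EFin ?lee_fin ?RintegralZl //; exact: integZ.
Qed.

End NegativeSobolev.

(** * Nonuniform continuity by solitons *)

Section SolitonNonuniform.
Context {R : realType}.
Implicit Types (s t x y xi m k mu : R) (f : R -> R).
Notation leb := (@lebesgue_measure R).

Lemma gauss_weight_integral s : exists2 B : R, 0 <= B &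
  (\int[leb]_xi (weight s xi * gauss 2^-1 0 xi ^+ 2)%:E <= (B ^+ 2)%:E)%E.
Proof.
have i2 : 0 < 2^-1 :> R by rewrite invr_gt0.
pose n := Num.bound `|s|; have hn : s <= n%:R.
  by apply: le_trans (ler_norm _) (ltW _); exact: archi_boundP.
have [C C0 hC] := gauss_poly_bound 0 n.+1 (@ltr01 R).
have [j1 j2] := int_lor_scaled (0 : R) ltr01.
have hb xi : `|weight s xi * gauss 2^-1 0 xi ^+ 2| <= C * lor (1 * xi + 0).
  rewrite (ger0_norm (mulr_ge0 (ltW (weight_gt0 _ _)) (sqr_ge0 _))) mul1r addr0.
  have -> : gauss 2^-1 0 xi ^+ 2 = gauss 1 0 xi.
    by rewrite /gauss -expRM_natl; congr expR; field.
  rewrite /lor ler_pdivlMr ?sqr1_gt0 //; apply: le_trans (hC xi).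
  rewrite mulrAC (exprSr (1 + xi ^+ 2)); apply: ler_wpM2r; first exact: ltW (gauss_gt0 _ _ _).
  apply: ler_wpM2r; first exact: ltW (sqr1_gt0 _).
  rewrite -powR_mulrn; last exact: ltW (sqr1_gt0 _).
  by apply: ler_powR => //; exact: sqr1_ge1.
have im : integ (fun xi => weight s xi * gauss 2^-1 0 xi ^+ 2).
  apply: integ_dom hb (integZ C j1); apply: cont_meas; apply: contM; first exact: weight_cont.
  rewrite (_ : (fun xi => gauss 2^-1 0 xi ^+ 2) = (fun xi => gauss 2^-1 0 xi * gauss 2^-1 0 xi)) //.
  by apply: contM; exact: cont_gauss.
exists (1 + 4 * C); first by rewrite addr_ge0 // mulr_ge0.
rewrite int_EFin // lee_fin; apply: le_trans (int_le im (integZ C j1) _) _.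
  by move=> xi; apply: le_trans (ler_norm _) (hb xi).
rewrite RintegralZl //; have := ler_wpM2l C0 j2; rewrite divr1.
by have := sqr_ge0 (4 * C); rewrite !expr2; lra.
Qed.

Lemma gauss_half_bound x : `|x| * gauss 2^-1 0 x <= 1.
Proof.
rewrite /gauss subr0 expRN ler_pdivrMr ?expR_gt0 // mul1r.
apply: le_trans (expR_ge1Dx _); rewrite -(real_normK (num_real x)).
by have := sqr_ge0 (1 - `|x|); rewrite !expr2; lra.
Qed.

Lemma gauss_half_lipschitz x y : `|gauss 2^-1 0 x - gauss 2^-1 0 y| <= 1 * `|x - y|.
Proof.
have d : has_deriv (fun x : R => - (2^-1 * (x - 0) ^+ 2)) (fun x => - x).
  have := has_derivZ (- 2^-1) (has_derivM (@has_deriv_id R) (@has_deriv_id R)).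
  by move=> h; apply: (has_deriv_ext h) => z; rewrite ?subr0 ?expr2; [ring|field].
apply: (lipschitz_of_deriv (has_deriv_expR d)) => z.
by have := gauss_half_bound z; rewrite /gauss normrM normrN (ger0_norm (expR_ge0 _)).
Qed.

Lemma gauss_le1 (a c x : R) : 0 <= a -> `|gauss a c x| <= 1.
Proof.
move=> a0; rewrite gtr0_norm ?gauss_gt0 // -expR0 ler_expR oppr_le0.
exact: mulr_ge0 a0 (sqr_ge0 _).
Qed.

Let cos_h xi : [/\ continuous (fun x => cos (xi * x)), forall x, `|cos (xi * x)| <= 1 &
  forall x z, `|cos (xi * x) - cos (xi * z)| <= `|xi| * `|x - z|].
Proof.
split; [exact: has_deriv_cont (has_deriv_cosl xi)|by move=> x; exact: norm_cos|].
by move=> x z; apply: le_trans (cos_lipschitz _ _) _; rewrite -mulrBr normrM.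
Qed.

Let sin_h xi : [/\ continuous (fun x => sin (xi * x)), forall x, `|sin (xi * x)| <= 1 &
  forall x z, `|sin (xi * x) - sin (xi * z)| <= `|xi| * `|x - z|].
Proof.
split; [exact: has_deriv_cont (has_deriv_sinl xi)|by move=> x; exact: norm_sin|].
by move=> x z; apply: le_trans (sin_lipschitz _ _) _; rewrite -mulrBr normrM.
Qed.

Let Z : R := 64 * 64.
Let Z0 : 0 < Z. Proof. exact: mulr_gt0 (ltr0Sn _ _) (ltr0Sn _ _). Qed.
Let Wt s := \int[leb]_xi weight s xi.

Section Energy.
Variables (s ga : R).
Hypotheses (g01 : 0 < ga <= 1) (hs : s + ga < - 2^-1).

(** The L1 bound serves as both bounds of [energy_low], with b = 0. The power of 0 in the result
    vanishes because ga > 0. The bound is uniform in k. *)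
Lemma energy_soliton m k y : 8 * `|m| <= 1 -> 1 <= k ->
  (energy s (soliton_at m k y) <= (2 * (2 * Z ^+ 2 + (Z ^+ 2 + 2) * 0 `^ (2 * ga)) * Wt (s + ga))%:E)%E.
Proof.
move=> hm k1; apply: energy_low => //; rewrite ?ltW //.
- exact: tame_integ (soliton_at_tame _ hm k1).
- by move=> xi; have [? ? _] := cos_h xi; have [? ? _] := sin_h xi; split; exact: soliton_L1.
- by move=> xi; rewrite mulr0 addr0; have [? ? _] := cos_h xi; have [? ? _] := sin_h xi; split; exact: soliton_L1.
Qed.

(* Both solitons are close to multiples of the Dirac mass at X. *)
Lemma energy_soliton_diff m m' k k' X : 8 * `|m| <= 1 -> 8 * `|m'| <= 1 -> 1 <= k -> k <= k' ->
  (energy s (soliton_at m k (- (k * X)) \- soliton_at m' k' (- (k' * X)))%R <=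
    (2 * (2 * (16 * `|m - m'|) ^+ 2 + ((2 * Z) ^+ 2 + 2) * (2 * Z / k) `^ (2 * ga)) * Wt (s + ga))%:E)%E.
Proof.
move=> hm hm' k1 kk; have k1' := le_trans k1 kk.
have k0 : 0 < k by exact: lt_le_trans k1.
have k0' : 0 < k' by exact: lt_le_trans k1'.
have t1 := soliton_at_tame (- (k * X)) hm k1; have t2 := soliton_at_tame (- (k' * X)) hm' k1'.
have i1 (h : R -> R) : continuous h -> (forall x, `|h x| <= 1) -> integ (fun x => h x * soliton_at m k (- (k * X)) x).
  by move=> ch h1; exact: integ_mul_bounded (tame_integ t1) (cont_meas ch) h1.
have i2 (h : R -> R) : continuous h -> (forall x, `|h x| <= 1) -> integ (fun x => h x * soliton_at m' k' (- (k' * X)) x).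
  by move=> ch h1; exact: integ_mul_bounded (tame_integ t2) (cont_meas ch) h1.
have sp (h : R -> R) : continuous h -> (forall x, `|h x| <= 1) ->
   \int[leb]_x (h x * (soliton_at m k (- (k * X)) x - soliton_at m' k' (- (k' * X)) x)) =
   (\int[leb]_x (h x * soliton_at m k (- (k * X)) x)) - (\int[leb]_x (h x * soliton_at m' k' (- (k' * X)) x)).
  move=> ch h1; rewrite -RintegralB //; [|exact: i1|exact: i2].
  by apply: eq_Rintegral => x _; rewrite mulrBr.
have hA (h : R -> R) : continuous h -> (forall x, `|h x| <= 1) ->
   `|\int[leb]_x (h x * (soliton_at m k (- (k * X)) x - soliton_at m' k' (- (k' * X)) x))| <= 2 * Z.
  move=> ch h1; rewrite sp //; apply: le_trans (ler_normB _ _) _.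
  by rewrite mulr2n mulrDl mul1r; apply: lerD; exact: soliton_L1.
have hB (h : R -> R) xi : continuous h -> (forall x, `|h x| <= 1) -> (forall x z, `|h x - h z| <= `|xi| * `|x - z|) ->
   `|\int[leb]_x (h x * (soliton_at m k (- (k * X)) x - soliton_at m' k' (- (k' * X)) x))| <=
     16 * `|m - m'| + `|xi| * (2 * Z / k).
  move=> ch h1 hL; rewrite sp //.
  have m1 := soliton_moment (- (k * X)) hm k1 ch h1 hL (normr_ge0 _).
  have m2 := soliton_moment (- (k' * X)) hm' k1' ch h1 hL (normr_ge0 _).
  have e1 : - - (k * X) / k = X by rewrite opprK mulrC mulKf // gt_eqF.
  have e2 : - - (k' * X) / k' = X by rewrite opprK mulrC mulKf // gt_eqF.
  rewrite e1 -/Z in m1; rewrite e2 -/Z in m2.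
  have m3 : Z * `|xi| / k' <= Z * `|xi| / k.
    by apply: ler_wpM2l; [exact: mulr_ge0 (ltW Z0) (normr_ge0 _)|rewrite lef_pV2].
  have m4 : `|h X * (soliton_mass m - soliton_mass m')| <= 16 * `|m - m'|.
    by rewrite normrM; apply: le_trans (soliton_mass_diff hm hm'); exact: ler_piMl (normr_ge0 _) (h1 X).
  have -> : `|xi| * (2 * Z / k) = Z * `|xi| / k + Z * `|xi| / k by ring.
  move: m1 m2 m4; set a := \int[leb]_x _; set b := \int[leb]_x _.
  have -> : a - b = h X * (soliton_mass m - soliton_mass m') +
     ((a - h X * soliton_mass m) - (b - h X * soliton_mass m')) by ring.
  move=> m1 m2 m4; apply: le_trans (ler_normD _ _) _; apply: lerD m4 _.
  by apply: le_trans (ler_normB _ _) _; apply: lerD m1 _; exact: le_trans m2 m3.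
apply: energy_low => //.
- by apply: tame_integ; exact: tameB.
- exact: mulr_ge0 (ler0n _ _) (ltW Z0).
- by apply: divr_ge0 (ltW k0); exact: mulr_ge0 (ler0n _ _) (ltW Z0).
- by move=> xi; have [? ? _] := cos_h xi; have [? ? _] := sin_h xi; split; exact: hA.
- by move=> xi; have [? ? ?] := cos_h xi; have [? ? ?] := sin_h xi; split; exact: hB.
Qed.
End Energy.

Lemma soliton_solution mu s k y0 : s < - 2^-1 -> 1 <= k -> 8 * `|mu / k| <= 1 ->
  gardner5_solution mu s (soliton mu k y0).
Proof.
move=> hs k1 hm; have k0 : 0 < k by exact: lt_le_trans k1.
split; [exact: soliton_smooth2|exact: soliton_gardner|move=> t; apply: le_lt_trans (ltry _)].
(* Half the gap between s and -1/2, capped at 1 as [energy_low] requires. *)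
pose ga := Num.min 1 ((- 2^-1 - s) / 2).
have g01 : 0 < ga <= 1 by rewrite lt_min ge_min lexx ltr01 /= andbT divr_gt0 //; lra.
have hg : s + ga < - 2^-1.
  by have : ga <= (- 2^-1 - s) / 2 by [rewrite ge_min lexx orbT|]; lra.
apply: Hs_norm_fin (energy_soliton g01 hg _ hm k1); first exact: soliton_at_tame.
apply: mulr_ge0; last by apply: Rintegral_ge0 => x _; exact: ltW (weight_gt0 _ _).
apply: mulr_ge0 => //; apply: addr_ge0; apply: mulr_ge0 => //; first exact: sqr_ge0.
  by apply: addr_ge0 => //; exact: sqr_ge0.
Qed.

(** At time t the solitons sit at 0 and at D, and D >= t k because the speed is a quartic polynomial
    in k. The Gaussian is 1 at 0 and at most 1 / D at D; since the masses lie between 1 and 8, only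
    the first contribution survives. With parameter 1/2 the Gaussian is proportional to its own
    transform. *)
Lemma soliton_separation mu k t D : 0 < t -> 1 <= k -> 8 * `|mu| <= k ->
  D = (soliton_freq mu k / k - soliton_freq mu (k + 1) / (k + 1)) * t ->
  1 - (2 * Z / k + 8 / (t * k)) <=
  \int[leb]_x ((soliton_at (mu / k) k 0 x - soliton_at (mu / (k + 1)) (k + 1) (- ((k + 1) * D)) x) * gauss (4 * 2^-1)^-1 0 x).
Proof.
move=> t0 k1 hmu; set k' := k + 1 => D_def.
have -> : (4 * 2^-1)^-1 = 2^-1 :> R by field.
set g := gauss 2^-1 0.
have k0 : 0 < k by exact: lt_le_trans k1.
have kk : k <= k' by rewrite lerDl.
have k0' : 0 < k' by exact: lt_le_trans kk.
have k1' : 1 <= k' by exact: le_trans kk.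
have hm : 8 * `|mu / k| <= 1 by rewrite normrM normfV (gtr0_norm k0) mulrA ler_pdivrMr // mul1r.
have hm' : 8 * `|mu / k'| <= 1.
  by rewrite normrM normfV (gtr0_norm k0') mulrA ler_pdivrMr // mul1r; exact: le_trans kk.
have cg : continuous g by exact: cont_gauss.
have g1 x : `|g x| <= 1 by apply: gauss_le1; rewrite invr_ge0.
have m1 := soliton_moment 0 hm k1 cg g1 gauss_half_lipschitz ler01.
have m2 := soliton_moment (- (k' * D)) hm' k1' cg g1 gauss_half_lipschitz ler01.
rewrite oppr0 mul0r mulr1 -/Z in m1.
have eD : - - (k' * D) / k' = D by rewrite opprK mulrC mulKf // gt_eqF.
rewrite eD mulr1 -/Z in m2.
have g0E : g 0 = 1 by rewrite /g /gauss subr0 expr0n /= mulr0 oppr0 expR0.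
rewrite g0E mul1r in m1.
have i1 := integ_mul_bounded (tame_integ (soliton_at_tame 0 hm k1)) (cont_meas cg) g1.
have i2 := integ_mul_bounded (tame_integ (soliton_at_tame (- (k' * D)) hm' k1')) (cont_meas cg) g1.
have -> : \int[leb]_x ((soliton_at (mu / k) k 0 x - soliton_at (mu / k') k' (- (k' * D)) x) * g x) =
  (\int[leb]_x (g x * soliton_at (mu / k) k 0 x)) - (\int[leb]_x (g x * soliton_at (mu / k') k' (- (k' * D)) x)).
  by rewrite -RintegralB //; apply: eq_Rintegral => x _; ring.
have DE : D = ((k' ^+ 4 - k ^+ 4) + 10 * mu ^+ 2 * (k' ^+ 2 - k ^+ 2)) * t.
  by rewrite D_def /soliton_freq; field; rewrite !gt_eqF.
have Dk : t * k <= D.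
  rewrite DE mulrC ler_wpM2r ?(ltW t0) //.
  have -> : k' ^+ 4 - k ^+ 4 = k + (4 * k ^+ 3 + 6 * k ^+ 2 + 3 * k + 1) by rewrite /k'; ring.
  have -> : k' ^+ 2 - k ^+ 2 = 2 * k + 1 by rewrite /k'; ring.
  have h3 := exprn_ge0 3 (ltW k0); have h2 := exprn_ge0 2 (ltW k0).
  have h4 : 0 <= 10 * mu ^+ 2 * (2 * k + 1).
    by apply: mulr_ge0; [exact: mulr_ge0 (ler0n _ _) (sqr_ge0 _)|lra].
  by lra.
have tk : 0 < t * k by exact: mulr_gt0.
have D0 : 0 < D by exact: lt_le_trans Dk.
have gD : g D <= (t * k)^-1.
  apply: (@le_trans _ _ D^-1); last by rewrite lef_pV2.
  by rewrite -[leRHS]mul1r ler_pdivlMr // mulrC -{1}(gtr0_norm D0); exact: gauss_half_bound.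
have mass8 : soliton_mass (mu / k') <= 8.
  apply: le_trans (ler_norm _) _; rewrite /soliton_mass normrM (ger0_norm (ler0n _ 2)).
  have := ler_normB (atan ((1 - 2 * (mu / k')) / (1 + 2 * (mu / k')))) (atan (-1)).
  have := atan_bound ((1 - 2 * (mu / k')) / (1 + 2 * (mu / k'))); have := @atan_bound R (-1); lra.
have gm : g D * soliton_mass (mu / k') <= (t * k)^-1 * 8.
  apply: ler_pM gD mass8; first exact: ltW (gauss_gt0 _ _ _).
  exact: le_trans ler01 (soliton_mass_ge1 hm').
have mass1 := soliton_mass_ge1 hm.
have Zk : Z / k' <= Z / k by apply: ler_wpM2l; [exact: ltW Z0|rewrite lef_pV2].
rewrite -(mulrA 2 Z) (mulrC 8); move: gm; move: (g D * _) ((t * k)^-1 * 8) Zk m1 m2 mass1.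
move: (soliton_mass _) (Z / k) (Z / k') (\int[leb]_x _) (\int[leb]_x _) => M a b I2 I1 p w ab.
by rewrite !ler_norml => /andP[h1 h2] /andP[h3 h4] h5 h6; lra.
Qed.

Lemma soliton_not_unif_continuous mu s t : s < - 2^-1 -> 0 < t ->
  ~ data_solution_map_unif_continuous mu s t.
Proof.
move=> hs t0 U.
pose ga := Num.min 1 ((- 2^-1 - s) / 2).
have g01 : 0 < ga <= 1 by rewrite lt_min ge_min lexx ltr01 /= andbT divr_gt0 //; lra.
have hg : s + ga < - 2^-1.
  by have : ga <= (- 2^-1 - s) / 2 by [rewrite ge_min lexx orbT|]; lra.
have ga2 : 0 < 2 * ga by case/andP: g01 => g0 _; rewrite mulr_gt0.
have E1 m k y := @energy_soliton s ga g01 hg m k y.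
have E2 m m' k k' X := @energy_soliton_diff s ga g01 hg m m' k k' X.
have E3 k D := @soliton_separation mu k t D t0.
have E4 := soliton_solution; have hZ := Z0; clearbody Z; clear Z0.
have W0 : 0 <= Wt (s + ga) by apply: Rintegral_ge0 => x _; exact: ltW (weight_gt0 _ _).
set W := Wt (s + ga) in E1 E2 W0.
have [B B0 hB] := gauss_weight_integral (- s).
set psi := gauss 2^-1 0 in hB.
have i2 : 0 < 2^-1 :> R by rewrite invr_gt0.
pose K := \int[leb]_x psi x.
have K0 : 0 < K.
  by apply: lt_le_trans (int_gauss_ge 0 i2); rewrite invr_gt0 mulr_gt0 // sqrtr_gt0.
(* At time t the pairing with [psi] is at least K / 2, whereas a distance below eps would bound it
   by eps B < K / 4. *)
pose eps := K / (4 * (B + 1)); have eps0 : 0 < eps by rewrite divr_gt0 // mulr_gt0 // ltr_wpDl.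
set M0 := 2 * (2 * Z ^+ 2 + (Z ^+ 2 + 2) * 0 `^ (2 * ga)) * W in E1.
have M00 : 0 <= M0.
  apply: mulr_ge0 => //; apply: mulr_ge0 => //; apply: addr_ge0; apply: mulr_ge0 => //; first exact: sqr_ge0.
  by apply: addr_ge0 => //; exact: sqr_ge0.
have M1 : 0 < 1 + M0 by rewrite ltr_wpDr.
have [del del0 H] := U eps (1 + M0) eps0 M1.
(* If e^2 and b are at most tau, then 2 e^2 + (4 Z^2 + 2) b <= (4 + 4 Z^2) tau; tau is chosen so
   that c tau = (del / 2)^2. The summand 1 in W + 1 makes c positive. *)
pose c := 2 * (4 + 4 * Z ^+ 2) * (W + 1).
have c0 : 0 < c by have := sqr_ge0 Z => z2; rewrite /c mulr_gt0 ?mulr_gt0 //; lra.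
pose tau := (del / 2) ^+ 2 / c; have tau0 : 0 < tau by rewrite divr_gt0 // exprn_gt0 // divr_gt0.
have [A A1 hA] := powR_unbounded tau^-1 ga2.
have n0 := normr_ge0 mu.
have n1 : 0 <= 32 * `|mu| / tau by apply: divr_ge0 (ltW tau0); exact: mulr_ge0 (ler0n _ _) n0.
have n2 : 0 <= 32 / t by apply: divr_ge0 (ltW t0).
have n3 : 0 <= A * (2 * Z) by apply: mulr_ge0 (le_trans ler01 A1) _; exact: mulr_ge0 (ler0n _ _) (ltW hZ).
(* Each summand is one lower bound for k: those with mu make m small and the masses close, the one
   with [A] makes both solitons narrow enough at time 0, and 32 / t and 8 Z serve the separation at
   time t. *)
pose k := 1 + 32 * `|mu| + 32 * `|mu| / tau + 32 / t + A * (2 * Z) + 8 * Z.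
have [k1 kmu ktau [kt kA kZ]] : [/\ 1 <= k, 32 * `|mu| <= k, 32 * `|mu| / tau <= k & [/\ 32 / t <= k, A * (2 * Z) <= k & 8 * Z <= k]].
  rewrite /k; move: n1 n2 n3; move: (_ / tau) (_ / t) (A * _) => a b d a0 b0 d0.
  by split; [lra|lra|lra|split; lra].
clearbody k; have k0 : 0 < k by exact: lt_le_trans k1.
pose k' := k + 1; have kk : k <= k' by rewrite lerDl.
have k0' : 0 < k' by exact: lt_le_trans kk.
have k1' : 1 <= k' by exact: le_trans kk.
have kmu8 : 8 * `|mu| <= k by lra.
have hm : 8 * `|mu / k| <= 1 by rewrite normrM normfV (gtr0_norm k0) mulrA ler_pdivrMr // mul1r.
have hm' : 8 * `|mu / k'| <= 1.
  by rewrite normrM normfV (gtr0_norm k0') mulrA ler_pdivrMr // mul1r; exact: le_trans kk.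
(* Both solitons start at the point X, from which the first one reaches the origin at time t. *)
pose X := soliton_freq mu k / k * t.
pose v1 := soliton mu k (- (k * X)); pose v2 := soliton mu k' (- (k' * X)).
have v10 : v1 0 = soliton_at (mu / k) k (- (k * X)) by apply/funext => x; rewrite /v1 /soliton mulr0 add0r.
have v20 : v2 0 = soliton_at (mu / k') k' (- (k' * X)) by apply/funext => x; rewrite /v2 /soliton mulr0 add0r.
have b1 : (Hs_norm s (v1 0%R) <= (1 + M0)%:E)%E.
  by rewrite v10; apply: Hs_norm_fin M00 (E1 _ _ _ hm k1); exact: soliton_at_tame.
have b2 : (Hs_norm s (v2 0%R) <= (1 + M0)%:E)%E.
  by rewrite v20; apply: Hs_norm_fin M00 (E1 _ _ _ hm' k1'); exact: soliton_at_tame.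
have b3 : (Hs_norm s (v1 0 \- v2 0)%R < del%:E)%E.
  apply: (@le_lt_trans _ _ (del / 2)%:E); last by rewrite lte_fin ltr_pdivrMr // ltr_pMr // ltr1n.
  rewrite v10 v20; apply: Hs_norm_le; first by apply: tameB; exact: soliton_at_tame.
    by rewrite divr_ge0 // ltW.
  apply: le_trans (E2 _ _ _ _ X hm hm' k1 kk) _; rewrite lee_fin.
  set e := 16 * _; set b := _ `^ _.
  have e0 : 0 <= e by exact: mulr_ge0 (ler0n _ _) (normr_ge0 _).
  have e1 : e <= 32 * `|mu| / k.
    have := ler_normB (mu / k) (mu / k'); rewrite !normrM !normfV (gtr0_norm k0) (gtr0_norm k0').
    have : `|mu| / k' <= `|mu| / k by rewrite ler_wpM2l // lef_pV2.
    rewrite /e -[32 * _ / k]mulrA; move: (_ / k') (_ / k) `|_ - _| => a a' a''; lra.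
  have e2 : e <= 1 by apply: le_trans e1 _; rewrite ler_pdivrMr // mul1r.
  have e3 : e <= tau by apply: le_trans e1 _; rewrite ler_pdivrMr // [leRHS]mulrC -ler_pdivrMr.
  have e4 : e ^+ 2 <= tau by apply: le_trans e3; rewrite expr2 ler_piMr.
  have Z20 : 0 < 2 * Z by rewrite mulr_gt0.
  have b0 : b <= tau.
    have -> : b = ((k / (2 * Z)) `^ (2 * ga))^-1.
      by rewrite /b -powRN -mulN1r (powRrM _ (-1)) powR_inv1 ?divr_ge0 ?(ltW k0) ?(ltW Z20) // invf_div.
    have p1 : 0 < (k / (2 * Z)) `^ (2 * ga) by apply: powR_gt0; exact: divr_gt0.
    have p2 : 0 < tau^-1 by rewrite invr_gt0.
    rewrite -[leRHS]invrK lef_pV2 ?posrE //.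
    by apply: hA; rewrite ler_pdivlMr.
  have b00 : 0 <= b by exact: powR_ge0.
  have q0 : 0 <= 4 * Z ^+ 2 + 2 by have := sqr_ge0 Z; lra.
  have s1 : 2 * e ^+ 2 + ((2 * Z) ^+ 2 + 2) * b <= (4 + 4 * Z ^+ 2) * tau.
    have -> : (2 * Z) ^+ 2 = 4 * Z ^+ 2 by ring.
    by have := ler_wpM2l q0 b0; lra.
  have s0 : 0 <= 2 * e ^+ 2 + ((2 * Z) ^+ 2 + 2) * b.
    apply: addr_ge0; apply: mulr_ge0 => //; first exact: sqr_ge0.
    by apply: addr_ge0 => //; exact: sqr_ge0.
  have -> : (del / 2) ^+ 2 = 2 * ((4 + 4 * Z ^+ 2) * tau) * (W + 1).
    have -> : (del / 2) ^+ 2 = tau * c by rewrite /tau divfK // gt_eqF.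
    by rewrite /c; ring.
  apply: ler_pM => //; first exact: mulr_ge0.
    by rewrite ler_wpM2l.
  by rewrite lerDl.
have := H v1 v2 (E4 _ _ _ _ hs k1 hm) (E4 _ _ _ _ hs k1' hm') b1 b2 b3.
pose D := (soliton_freq mu k / k - soliton_freq mu k' / k') * t.
have a1 : soliton_freq mu k * t + - (k * X) = 0.
  by rewrite /X; move: (soliton_freq mu k) => c1; field; rewrite gt_eqF.
have a2 : soliton_freq mu k' * t + - (k' * X) = - (k' * D).
  have ax (c1 c2 l : R) : 0 < l -> c2 * t + - (l * (c1 / k * t)) = - (l * ((c1 / k - c2 / l) * t)).
    by move=> l0; field; rewrite !gt_eqF.
  exact: ax.
have v1t : v1 t = soliton_at (mu / k) k 0 by apply/funext => x; rewrite /v1 /soliton a1.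
have v2t : v2 t = soliton_at (mu / k') k' (- (k' * D)) by apply/funext => x; rewrite /v2 /soliton a2.
rewrite v1t v2t => hN.
have tf := tameB (soliton_at_tame 0 hm k1) (soliton_at_tame (- (k' * D)) hm' k1').
have := Hs_norm_duality tf B0 (schwartz_gauss 0 i2) (tame_integ (tame_gauss 0 i2)) hB hN.
have -> : \int[leb]_x ((soliton_at (mu / k) k 0 x - soliton_at (mu / k') k' (- (k' * D)) x) * fourier_cos psi x) =
   K * \int[leb]_x ((soliton_at (mu / k) k 0 x - soliton_at (mu / k') k' (- (k' * D)) x) * gauss (4 * 2^-1)^-1 0 x).
  rewrite -RintegralZl //.
    by apply: eq_Rintegral => x _; rewrite fourier_cos_gauss // mul0r cos0 mulr1 mulrCA.
  have q0 : 0 <= (4 * 2^-1)^-1 :> R by rewrite invr_ge0 mulr_ge0 // invr_ge0.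
  have := integ_mul_bounded (tame_integ tf) (cont_meas (@cont_gauss R (4 * 2^-1)^-1 0)) (fun x => gauss_le1 0 x q0).
  by apply: integ_ext => x; rewrite mulrC.
have := E3 k D k1 kmu8 erefl; rewrite -/k'.
move: (\int[leb]_x _) => I hI.
have h1 : 2 * Z / k <= 4^-1 by rewrite ler_pdivrMr //; lra.
have h2 : 8 / (t * k) <= 4^-1.
  by rewrite ler_pdivrMr ?mulr_gt0 //; move: kt; rewrite ler_pdivrMr //; lra.
have h3 : 2^-1 <= I by lra.
rewrite leNgt => /negP; apply; rewrite normrM (gtr0_norm K0).
apply: (@lt_le_trans _ _ (K * 2^-1)); last by rewrite ler_wpM2l ?(ltW K0) // (le_trans h3) // ler_norm.
have B1 : 0 < 4 * (B + 1) by rewrite mulr_gt0 // ltr_wpDl.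
by rewrite /eps mulrAC ltr_pdivrMr // -mulrA ltr_pM2l //; lra.
Qed.

End SolitonNonuniform.

Theorem mainTheorem1 (R : realType) (mu s t : R) :
  s < 3 / 4 -> 0 < t -> ~ data_solution_map_unif_continuous mu s t.
Proof.
move=> hs t0; case: (lerP (- 2^-1) s) => sl; last exact: soliton_not_unif_continuous.
have [C C0 [hM hN1 hN2 hX hX1]] := @profile_lipschitz R.
exact: (breather_not_unif_continuous C0 hM hN1 hN2 hX hX1).
Qed.
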